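(* Let $K$ be a field, let $\theta$ be a unital action of an inverse monoid $S$ on a unital associative $K$-algebra $A$, and let $M$ be an $A\rtimes_\theta S$-bimodule. Assume that $A$ is separable over $K$. Then there is an isomorphism $$H_n(S, M/[A, M]) \cong H_{n}(A\rtimes_\theta S, M)$$ (for every $n\ge 0$), where $[A,M]$ is the $K$-submodule of $M$ generated by $\{ax-xa \mid a\in A,\ x\in M\}$.
   Context: Inverse monoids and actions. For an inverse monoid $S$, $E(S)$ is its set of idempotents, $s\le t$ means $s=et$ for some $e\in E(S)$, and $KS$, $KE(S)$ are the semigroup algebras (free $K$-modules on $S$, $E(S)$ with the multiplication extended linearly). $\mathcal I(A)$ is the symmetric inverse monoid of all bijections between subsets of $A$. A unital action of $S$ on $A$ is a semigroup homomorphism $\theta:S\to\mathcal I(A)$, $s\mapsto\theta_s$, such that the domain and range of each $\theta_s$ are ideals of $A$, $\theta_s$ is an isomorphism of $K$-algebras from its domain onto its range, $\theta_{1_S}=\mathrm{id}_A$, and the range of $\theta_s$ is $1_sA$ for some central idempotent $1_s$ of $A$ (so $\theta_s:1_{s^{-1}}A\to 1_sA$). Crossed product. $L(A,\theta,S)=\bigoplus_{s\in S}1_sA\,\delta_s$ ($\delta_s$ are symbols) with product $a\delta_s\cdot b\delta_t=a\,\theta_s(1_{s^{-1}}b)\,\delta_{st}$ is an associative $K$-algebra; $\mathcal N$ is its ideal generated by all $a\delta_s-a\delta_t$ with $s\le t$ and $a\in 1_sA$. The crossed product is $A\rtimes_\theta S=L(A,\theta,S)/\mathcal N$; $\overline w$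 denotes the class of $w$. The map $A\to A\rtimes_\theta S$, $a\mapsto\overline{a\delta_1}$, is an injective homomorphism of unital algebras, and through it any $A\rtimes_\theta S$-bimodule is an $A$-bimodule. Bimodules and Hochschild homology. For a unital $K$-algebra $R$, $R^e=R\otimes_K R^{\mathrm{op}}$. $R$-bimodules are identified with left $R^e$-modules by $(a\otimes b)\cdot x=axb$ and with right $R^e$-modules by $x\cdot(a\otimes b)=bxa$. For an $R$-bimodule $M$, $H_n(R,M)=\operatorname{Tor}_n^{R^e}(R,M)$. $A$ is separable over $K$ if $A$ is projective as an $A^e$-module. $KS$-module structures. An $A\rtimes_\theta S$-bimodule $M$ is a left $KS$-module by $s\cdot x=\overline{1_s\delta_s}\cdot x\cdot\overline{1_{s^{-1}}\delta_{s^{-1}}}$. The subspace $[A,M]$ is a left $KS$-submodule of $M$, and $M/[A,M]$ has the quotient $KS$-module structure. Homology of $S$. $KE(S)$ is a right $KS$-module by $e\cdot s=s^{-1}es$ ($e\in E(S)$, $s\in S$). For a left $KS$-module $V$, $H_n(S,V)=\operatorname{Tor}_n^{KS}(KE(S),V)$. *)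

(* Defs.v *)
From HB Require Import structures.
From mathcomp Require Import all_boot all_algebra finmap.
From mathcomp Require Import boolp.
From mathcomp Require Import monalg.

Set Implicit Arguments.
Unset Strict Implicit.
Unset Printing Implicit Defensive.

Import GRing.Theory.
Local Open Scope ring_scope.
Local Open Scope quotient_scope.

(* MathComp's algType forces 1 != 0. Neither the crossed product nor the
   enveloping algebra is nonzero by construction, so a unital K-algebra is taken
   to be a possibly trivial ring with a central ring morphism from K. *)
HB.mixin Record isPzAlgebra (K : pzRingType) A of GRing.PzRing A := {
  pzin : K -> A;
  pzin_is_zmod_morphism : zmod_morphism pzin;
  pzin_is_monoid_morphism : monoid_morphism pzin;
  pzinC : forall (k : K) (x : A), pzin k * x = x * pzin k
}.

#[short(type="pzAlgType")]
HB.structure Definition PzAlgebra (K : pzRingType) :=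
  {A of GRing.PzRing A & isPzAlgebra K A}.

(* sinv s is the unique t with s t s = s and t s t = t. *)
HB.mixin Record isInverseMonoid S of Monoid S := {
  sinv : S -> S;
  mulVs : forall s : S, (s * sinv s * s = s)%g;
  mulsV : forall s : S, (sinv s * s * sinv s = sinv s)%g;
  sinv_unique : forall s t : S,
    (s * t * s = s)%g -> (t * s * t = t)%g -> t = sinv s
}.

#[short(type="inverseMonoidType")]
HB.structure Definition InverseMonoid := {S of Monoid S & isInverseMonoid S}.

HB.instance Definition _ (K : pzRingType) (A : pzAlgType K) :=
  GRing.isZmodMorphism.Build K A (@pzin K A) (@pzin_is_zmod_morphism K A).
HB.instance Definition _ (K : pzRingType) (A : pzAlgType K) :=
  GRing.isMonoidMorphism.Build K A (@pzin K A) (@pzin_is_monoid_morphism K A).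

Lemma conv_pzinC (K : comPzRingType) (A : pzAlgType K) :
  forall (k : K) (x : A^c), (pzin k : A^c) * x = x * (pzin k : A^c).
Proof. by move=> k x; exact: (esym (pzinC k (x : A))). Qed.
Lemma conv_zmod (K : comPzRingType) (A : pzAlgType K) :
  zmod_morphism (@pzin K A : K -> A^c).
Proof. exact: (@pzin_is_zmod_morphism K A). Qed.
Lemma conv_mon (K : comPzRingType) (A : pzAlgType K) :
  monoid_morphism (@pzin K A : K -> A^c).
Proof.
split=> [|x y]; first exact: (@rmorph1 K A).
rewrite mulrC; exact: (@rmorphM K A).
Qed.
HB.instance Definition _ (K : comPzRingType) (A : pzAlgType K) :=
  isPzAlgebra.Build K A^c (@conv_zmod K A) (@conv_mon K A) (@conv_pzinC K A).

Section Bridge.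
Variables (K : comPzRingType) (A : algType K).
Let zm : zmod_morphism (fun k : K => k%:A : A).
Proof. by move=> k l; rewrite scalerBl. Qed.
Let mm : monoid_morphism (fun k : K => k%:A : A).
Proof. by split=> [|k l]; rewrite ?scale1r // -scalerAl mul1r scalerA. Qed.
Let cc (k : K) (x : A) : k%:A * x = x * k%:A.
Proof. by rewrite -scalerAl -scalerAr mul1r mulr1. Qed.
HB.instance Definition _ := isPzAlgebra.Build K A zm mm cc.
End Bridge.
(* A module over a K-algebra A, seen as a K-module through K -> A. Right
   A-modules are left modules over the converse ring A^c. *)
Section Restr.
Variables (K : pzRingType) (A : pzAlgType K).
Definition restr (X : lmodType A) : Type := X.
Variable X : lmodType A.
HB.instance Definition _ := GRing.Zmodule.on (restr X).
Let sc (k : K) (x : restr X) : restr X := pzin k *: (x : X).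
Let scA k l x : sc k (sc l x) = sc (k * l) x.
Proof. by rewrite /sc rmorphM scalerA. Qed.
Let sc1 : left_id 1 sc. Proof. by move=> x; rewrite /sc rmorph1 scale1r. Qed.
Let scDr : right_distributive sc +%R.
Proof. by move=> k x y; rewrite /sc scalerDr. Qed.
Let scDl x : {morph sc^~ x : k l / k + l}.
Proof. by move=> k l; rewrite /sc rmorphD scalerDl. Qed.
HB.instance Definition _ :=
  GRing.Zmodule_isLmodule.Build K (restr X) scA sc1 scDr scDl.
Lemma restrE (k : K) (x : restr X) : k *: x = pzin k *: (x : X).
Proof. by []. Qed.
End Restr.

(* Finitely supported functions T -> V, i.e. the direct sum of copies of V
   indexed by T; fs T R^o is the free R-module on T. The alias keeps the
   pointwise module structure below apart from the one of {malg V[T]}, which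
   needs V to be a nontrivial ring. *)
Definition fs (T : choiceType) (V : zmodType) := {malg V[T]}.
HB.instance Definition _ T V := GRing.Zmodule.on (fs T V).

Section FsLmod.
Variables (R : pzRingType) (T : choiceType) (V : lmodType R).
Definition fs_scale (c : R) (f : fs T V) : fs T V :=
  [malg t in msupp f => c *: f@_t].
Lemma fs_scaleE c f t : (fs_scale c f)@_t = c *: f@_t.
Proof. by rewrite mcoeffE; case: msuppP; rewrite ?scaler0. Qed.
Let scA k l x : fs_scale k (fs_scale l x) = fs_scale (k * l) x.
Proof. by apply/malgP=> t; rewrite !fs_scaleE scalerA. Qed.
Let sc1 : left_id 1 fs_scale.
Proof. by move=> x; apply/malgP=> t; rewrite !fs_scaleE scale1r. Qed.
Let scDr : right_distributive fs_scale +%R.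
Proof. by move=> k x y; apply/malgP=> t; rewrite !(fs_scaleE, mcoeffD) scalerDr. Qed.
Let scDl x : {morph fs_scale^~ x : k l / k + l}.
Proof. by move=> k l; apply/malgP=> t; rewrite !(fs_scaleE, mcoeffD) scalerDl. Qed.
HB.instance Definition _ :=
  GRing.Zmodule_isLmodule.Build R (fs T V) scA sc1 scDr scDl.
End FsLmod.


(* delta t v is v at t and 0 elsewhere. *)
Definition delta (T : choiceType) (V : zmodType) (t : T) (v : V) : fs T V :=
  << v *g t >>.

Definition fsum (T : choiceType) (V W : zmodType) (F : T -> V -> W)
  (f : fs T V) : W := \sum_(t <- msupp f) F t f@_t.

Section FsTheory.
Variables (T : choiceType) (V : zmodType).
Implicit Types f g : fs T V.

Lemma deltaD (t : T) (v w : V) : delta t (v + w) = delta t v + delta t w.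
Proof. exact: monalgUD. Qed.
Lemma delta0 (t : T) : delta t (0 : V) = 0.
Proof. exact: monalgU0. Qed.

Lemma fs_ind (P : fs T V -> Prop) : P 0 ->
  (forall f g, P f -> P g -> P (f + g)) -> (forall t v, P (delta t v)) ->
  forall f, P f.
Proof.
move=> P0 PD Pd f; rewrite [f]monalgE.
by elim/big_ind: _ => // t _; exact: Pd.
Qed.

Section Fsum.
Variables (W : zmodType) (F : T -> V -> W).
Hypothesis FD : forall t v w, F t (v + w) = F t v + F t w.

Let F0 t : F t 0 = 0.
Proof. by apply: (addrI (F t 0)); rewrite -FD !addr0. Qed.

Let fsumw f (d : {fset T}) : (msupp f `<=` d)%fset ->
  fsum F f = \sum_(t <- d) F t f@_t.
Proof.
move=> le; apply: big_fset_incl => // t _ /mcoeff_outdom ->; exact: F0.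
Qed.

Lemma fsumD f g : fsum F (f + g) = fsum F f + fsum F g.
Proof.
rewrite (fsumw (msuppD_le f g)) (fsumw (fsubsetUl (msupp f) (msupp g))).
rewrite (fsumw (fsubsetUr (msupp f) (msupp g))) -big_split.
apply: eq_bigr => t _ /=.
by rewrite mcoeffD FD.
Qed.

Lemma fsum_delta t v : fsum F (delta t v) = F t v.
Proof. by rewrite (fsumw msuppU_le) big_seq_fset1 mcoeffUU. Qed.

Lemma fsum0 : fsum F 0 = 0.
Proof. by rewrite /fsum msupp0 big_seq_fset0. Qed.
End Fsum.

Lemma fsumDf (W : zmodType) (F G : T -> V -> W) f :
  fsum (fun t v => F t v + G t v) f = fsum F f + fsum G f.
Proof. exact: big_split. Qed.

End FsTheory.

Lemma deltaZ (R : pzRingType) (T : choiceType) (V : lmodType R) (t : T) c (v : V) :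
  delta t (c *: v) = c *: (delta t v : fs T V).
Proof.
apply/malgP => u; rewrite fs_scaleE !mcoeffU.
by case: eqP => //; rewrite !mulr0n scaler0.
Qed.

Section InverseMonoidTheory.
Variable S : inverseMonoidType.
Implicit Types s t e f : S.
Local Open Scope group_scope.

Definition idem e := e * e == e.

Lemma sinvK s : sinv (sinv s) = s.
Proof. by symmetry; apply: sinv_unique; rewrite ?mulVs ?mulsV. Qed.

Lemma sinv_idem e : e * e = e -> sinv e = e.
Proof. by move=> ee; symmetry; apply: sinv_unique; rewrite !ee. Qed.

Lemma idem_mul e f : e * e = e -> f * f = f -> e * f * (e * f) = e * f.
Proof.
move=> ee ff; set x := sinv (e * f).
have mV : x * (e * f) * x = x := mulsV (e * f).
have Vm : e * f * x * (e * f) = e * f := mulVs (e * f).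
have fxe : f * x * e * (f * x * e) = f * x * e.
  by rewrite -{3}mV !mulgA.
have xE : f * x * e = x.
  apply: sinv_unique.
    by rewrite -[RHS]Vm !mulgA -(mulgA e f f) ff -(mulgA _ e e) ee.
  by rewrite -[RHS]fxe !mulgA -(mulgA _ e e) ee -(mulgA _ f f) ff.
have xx : x * x = x by rewrite xE in fxe.
have -> : e * f = x by rewrite -[LHS]sinvK -/x (sinv_idem xx).
exact: xx.
Qed.

Lemma idem_comm e f : e * e = e -> f * f = f -> e * f = f * e.
Proof.
move=> ee ff; have ef := idem_mul ee ff; have fe := idem_mul ff ee.
rewrite -[e * f](sinv_idem ef); symmetry; apply: sinv_unique; rewrite !mulgA.
  by rewrite -(mulgA e f f) ff -(mulgA _ e e) ee -!mulgA mulgA ef.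
by rewrite -(mulgA f e e) ee -(mulgA _ f f) ff -!mulgA mulgA fe.
Qed.

Lemma idem_sVs s : s * sinv s * (s * sinv s) = s * sinv s.
Proof. by rewrite mulgA mulVs. Qed.

Lemma idem_Vss s : sinv s * s * (sinv s * s) = sinv s * s.
Proof. by rewrite mulgA mulsV. Qed.

Lemma sinvM s t : sinv (s * t) = sinv t * sinv s.
Proof.
have c := idem_comm (idem_sVs t) (idem_Vss s).
symmetry; apply: sinv_unique.
  transitivity (s * (t * sinv t * (sinv s * s)) * t); first by rewrite !mulgA.
  rewrite c; transitivity (s * sinv s * s * (t * sinv t * t)).
    by rewrite !mulgA.
  by rewrite !mulVs.
transitivity (sinv t * (sinv s * s * (t * sinv t)) * sinv s).
  by rewrite !mulgA.
rewrite -c; transitivity (sinv t * t * sinv t * (sinv s * s * sinv s)).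
  by rewrite !mulgA.
by rewrite !mulsV.
Qed.

Lemma sinv1 : sinv 1 = 1 :> S.
Proof. by apply: sinv_idem; rewrite mul1g. Qed.

Lemma idem_conj e s : e * e = e ->
  sinv s * e * s * (sinv s * e * s) = sinv s * e * s.
Proof.
move=> ee; transitivity (sinv s * (e * (s * sinv s)) * e * s).
  by rewrite !mulgA.
rewrite (idem_comm ee (idem_sVs s)).
transitivity (sinv s * s * sinv s * (e * e) * s); first by rewrite !mulgA.
by rewrite ee mulsV.
Qed.

End InverseMonoidTheory.

Section Convolution.
Variables (S : monoidType) (A : pzRingType) (b : S -> A -> A).
Hypothesis bD : forall s x y, b s (x + y) = b s x + b s y.
Hypothesis bM : forall s x y, b s (x * y) = b s x * b s y.
Hypothesis bC : forall s t x, b (s * t)%g x = b s (b t x).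

(* The twisted product a d_s * x d_t = (a * b s x) d_(st), extended biadditively. *)
Definition conv (f g : fs S A) : fs S A :=
  fsum (fun s x => fsum (fun t y => delta (s * t)%g (x * b s y)) g) f.

Let inD s x t y z : delta (s * t)%g (x * b s (y + z)) =
  delta (s * t)%g (x * b s y) + delta (s * t)%g (x * b s z).
Proof. by rewrite bD mulrDr deltaD. Qed.

Let outD g s x y :
  fsum (fun t z => delta (s * t)%g ((x + y) * b s z)) g =
  fsum (fun t z => delta (s * t)%g (x * b s z)) g +
  fsum (fun t z => delta (s * t)%g (y * b s z)) g.
Proof. by rewrite -fsumDf; apply: eq_bigr => t _; rewrite mulrDl deltaD. Qed.

Lemma conv_delta s x t y :
  conv (delta s x) (delta t y) = delta (s * t)%g (x * b s y).
Proof. by rewrite /conv !fsum_delta. Qed.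

Lemma convDl : left_distributive conv +%R.
Proof. by move=> f g h; rewrite /conv fsumD. Qed.

Lemma convDr : right_distributive conv +%R.
Proof.
by move=> f g h; rewrite /conv -fsumDf; apply: eq_bigr => s _; rewrite fsumD.
Qed.

Lemma conv0f f : conv 0 f = 0.
Proof. by apply: (addrI (conv 0 f)); rewrite -convDl !addr0. Qed.
Lemma convf0 f : conv f 0 = 0.
Proof. by apply: (addrI (conv f 0)); rewrite -convDr !addr0. Qed.

Lemma convA : associative conv.
Proof.
move=> f g h.
elim/fs_ind: f => [|f1 f2 e1 e2|s x]; first by rewrite !conv0f.
  by rewrite !convDl e1 e2.
elim/fs_ind: g => [|f1 f2 e1 e2|t y]; first by rewrite !(convf0, conv0f).
  by rewrite !(convDl, convDr) e1 e2.
elim/fs_ind: h => [|f1 f2 e1 e2|u z]; first by rewrite !(convf0, conv0f).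
  by rewrite !(convDl, convDr) e1 e2.
by rewrite !conv_delta bM bC mulrA mulgA.
Qed.
End Convolution.

Section MonoidAlgebra.
Variables (K : comPzRingType) (G : monoidType).

(* The semigroup algebra KG: the untwisted product. *)
Definition mon_alg : Type := fs G K.
HB.instance Definition _ := GRing.Zmodule.on mon_alg.

Definition mon_mul : mon_alg -> mon_alg -> mon_alg := conv (fun=> id).
Definition mon_one : mon_alg := delta 1%g 1.
Let mulA : associative mon_mul. Proof. exact: convA. Qed.
Let mul1 : left_id mon_one mon_mul.
Proof.
move=> f; elim/fs_ind: f => [|f g ef eg|s x]; first exact: convf0.
  by rewrite /mon_mul convDr // -/mon_mul ef eg.
by rewrite /mon_mul conv_delta // mul1g mul1r.
Qed.
Let mulr1 : right_id mon_one mon_mul.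
Proof.
move=> f; elim/fs_ind: f => [|f g ef eg|s x]; first exact: conv0f.
  by rewrite /mon_mul convDl // -/mon_mul ef eg.
by rewrite /mon_mul conv_delta // mulg1 mulr1.
Qed.
Let mulDl : left_distributive mon_mul +%R. Proof. exact: convDl. Qed.
Let mulDr : right_distributive mon_mul +%R. Proof. exact: convDr. Qed.
HB.instance Definition _ :=
  GRing.Zmodule_isPzRing.Build mon_alg mulA mul1 mulr1 mulDl mulDr.

Lemma mon_delta (s t : G) (k l : K) :
  (delta s k : mon_alg) * (delta t l : mon_alg) = delta (s * t)%g (k * l).
Proof. exact: conv_delta. Qed.

Definition mon_pzin (k : K) : mon_alg := delta 1%g k.
Let pz_zmod : zmod_morphism mon_pzin.
Proof. by move=> x y; rewrite /mon_pzin /delta monalgUB. Qed.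
Let pz_mon : monoid_morphism mon_pzin.
Proof. by split=> [//|x y]; rewrite mon_delta mul1g. Qed.
Let pzC : forall k (x : mon_alg), mon_pzin k * x = x * mon_pzin k.
Proof.
move=> k x; elim/fs_ind: x => [|f g ef eg|s x]; first by rewrite mulr0 mul0r.
  by rewrite mulrDl mulrDr ef eg.
by rewrite !mon_delta mul1g mulg1 mulrC.
Qed.
HB.instance Definition _ :=
  isPzAlgebra.Build K mon_alg pz_zmod pz_mon pzC.
End MonoidAlgebra.

Definition is_submod (K : pzRingType) (V : lmodType K) (W : V -> Prop) :=
  W 0 /\ forall (k : K) u v, W u -> W v -> W (k *: u + v).

Definition is_ideal (A : pzRingType) (J : A -> Prop) :=
  [/\ J 0, forall x y, J x -> J y -> J (x - y)
    & forall a x, J x -> J (a * x) /\ J (x * a)].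

Section Span.
Variables (K : pzRingType) (V : lmodType K) (U : V -> Prop).

(* The K-submodule generated by U. *)
Definition span : {pred V} := fun v =>
  `[< forall W, is_submod W -> (forall u, U u -> W u) -> W v >].

Lemma span_closed : GRing.submod_closed span.
Proof.
split=> [|k u v /asboolP hu /asboolP hv].
  by apply/asboolP => W [W0 _] _.
apply/asboolP => W sW UW; exact: sW.2 (hu W sW UW) (hv W sW UW).
Qed.
HB.instance Definition _ := GRing.isSubmodClosed.Build K V span
  (GRing.submod_closed_semi span_closed).

Lemma mem_span u : U u -> u \in span.
Proof. by move=> Uu; apply/asboolP => W _; exact. Qed.

Lemma span_min (W : V -> Prop) : is_submod W -> (forall u, U u -> W u) ->
  forall v, v \in span -> W v.
Proof. by move=> sW UW v /asboolP; exact. Qed.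
End Span.

Section IdealGen.
Variables (A : pzRingType) (U : A -> Prop).

(* The two-sided ideal generated by U. *)
Definition ideal_gen : {pred A} := fun x =>
  `[< forall J, is_ideal J -> (forall u, U u -> J u) -> J x >].

Lemma ideal_gen_is_ideal : is_ideal (fun x => x \in ideal_gen).
Proof.
split=> [|x y /asboolP hx /asboolP hy|a x /asboolP hx].
- by apply/asboolP => J [].
- apply/asboolP => J iJ UJ; case: (iJ) => _ JB _; exact: JB (hx _ iJ UJ) (hy _ iJ UJ).
- split; apply/asboolP => J iJ UJ; case: (iJ) => _ _ JM;
    by have [] := JM a x (hx _ iJ UJ).
Qed.

Lemma ideal_gen_closed : zmod_closed ideal_gen.
Proof. by case: ideal_gen_is_ideal. Qed.
HB.instance Definition _ := GRing.isZmodClosed.Build A ideal_gen ideal_gen_closed.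

Lemma mem_ideal_gen u : U u -> u \in ideal_gen.
Proof. by move=> Uu; apply/asboolP => J _; exact. Qed.

Lemma ideal_gen_min (J : A -> Prop) : is_ideal J -> (forall u, U u -> J u) ->
  forall x, x \in ideal_gen -> J x.
Proof. by move=> sW UW v /asboolP; exact. Qed.
End IdealGen.

Section Cls.
Variables (V : zmodType) (I : zmodClosed V).
Definition cls : V -> Quotient.quot I := \pi.
Lemma cls_zmod : zmod_morphism cls.
Proof. exact: raddfB. Qed.
HB.instance Definition _ := GRing.isZmodMorphism.Build V (Quotient.quot I) cls cls_zmod.
Lemma clsE x y : (cls x = cls y) <-> (x - y \in I).
Proof.
rewrite Quotient.idealrBE; split=> [e|/eqP//]; apply/eqP; exact: e.
Qed.
Lemma cls_repr (q : Quotient.quot I) : cls (repr q) = q.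
Proof. exact: reprK. Qed.
Lemma cls_ind (P : Quotient.quot I -> Prop) : (forall v, P (cls v)) -> forall q, P q.
Proof. by move=> h q; rewrite -(cls_repr q). Qed.
Lemma repr_cls v : repr (cls v) - v \in I.
Proof. by apply/clsE; rewrite cls_repr. Qed.
End Cls.

Section Quo.
Variables (K : pzRingType) (V : lmodType K) (U : V -> Prop).
(* V modulo the submodule generated by U. *)
Definition quo : Type := Quotient.quot (span U).
HB.instance Definition _ := GRing.Zmodule.on quo.
Definition qcls (v : V) : quo := cls (span U) v.
Definition quo_scale (k : K) (q : quo) : quo := qcls (k *: repr q).

Lemma qclsE x y : (qcls x = qcls y) <-> (x - y \in span U).
Proof. exact: clsE. Qed.
Lemma qclsD x y : qcls (x + y) = qcls x + qcls y.
Proof. exact: (raddfD (cls (span U))). Qed.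
Lemma quo_scaleE k v : quo_scale k (qcls v) = qcls (k *: v).
Proof.
by apply/qclsE; rewrite -scalerBr; apply: rpredZ; exact: repr_cls.
Qed.
Lemma qcls_ind (P : quo -> Prop) : (forall v, P (qcls v)) -> forall q, P q.
Proof. exact: cls_ind. Qed.
Let scA k l x : quo_scale k (quo_scale l x) = quo_scale (k * l) x.
Proof. by elim/qcls_ind: x => v; rewrite !quo_scaleE scalerA. Qed.
Let sc1 : left_id 1 quo_scale.
Proof. by elim/qcls_ind => v; rewrite !quo_scaleE scale1r. Qed.
Let scDr : right_distributive quo_scale +%R.
Proof.
move=> k; elim/qcls_ind=> v; elim/qcls_ind=> w.
by rewrite -qclsD !quo_scaleE -qclsD scalerDr.
Qed.
Let scDl x : {morph quo_scale^~ x : k l / k + l}.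
Proof.
by elim/qcls_ind: x => v k l; rewrite !quo_scaleE -qclsD scalerDl.
Qed.
HB.instance Definition _ :=
  GRing.Zmodule_isLmodule.Build K quo scA sc1 scDr scDl.
Lemma qcls_linear : linear qcls.
Proof. by move=> k u v; rewrite qclsD -quo_scaleE. Qed.
HB.instance Definition _ := GRing.isLinear.Build K V quo _ qcls qcls_linear.
Lemma qclsZ k v : qcls (k *: v) = k *: qcls v.
Proof. by rewrite -quo_scaleE. Qed.

Section Lift.
Variables (W : lmodType K) (f : {linear V -> W}).
Definition quo_lift (q : quo) : W := f (repr q).
Hypothesis f0 : forall u, U u -> f u = 0.
Lemma quo_liftE v : quo_lift (qcls v) = f v.
Proof.
apply/eqP; rewrite -subr_eq0 -raddfB; apply/eqP.
apply: (span_min _ f0 (repr_cls _ _)); split=> [|k u w fu fw].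
  exact: raddf0.
by rewrite linearP fu fw scaler0 addr0.
Qed.
Lemma quo_lift_linear : linear quo_lift.
Proof.
move=> k; elim/qcls_ind=> v; elim/qcls_ind=> w.
by rewrite -linearP !quo_liftE linearP.
Qed.
End Lift.
End Quo.

Section AlgQuo.
Variables (K : pzRingType) (A : pzAlgType K) (U : A -> Prop).
(* A modulo the two-sided ideal generated by U. *)
Definition alg_quo : Type := Quotient.quot (ideal_gen U).
HB.instance Definition _ := GRing.Zmodule.on alg_quo.
Definition acls (x : A) : alg_quo := cls (ideal_gen U) x.
HB.instance Definition _ := GRing.Additive.copy acls (cls (ideal_gen U)).

Lemma aclsE x y : (acls x = acls y) <-> (x - y \in ideal_gen U).
Proof. exact: clsE. Qed.
Lemma acls_ind (P : alg_quo -> Prop) : (forall v, P (acls v)) -> forall q, P q.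
Proof. exact: cls_ind. Qed.
Definition aq_mul (p q : alg_quo) : alg_quo := acls (repr p * repr q).
Lemma aq_mulE x y : aq_mul (acls x) (acls y) = acls (x * y).
Proof.
apply/aclsE; have [_ _ M] := ideal_gen_is_ideal U.
set x' := repr _; set y' := repr _.
rewrite -(subrKA (x' * y)) -mulrBr -mulrBl; apply: rpredD.
  by have [] := M x' _ (repr_cls _ y : y' - y \in _).
by have [] := M y _ (repr_cls _ x : x' - x \in _).
Qed.
Let mulA : associative aq_mul.
Proof.
elim/acls_ind=> x; elim/acls_ind=> y; elim/acls_ind=> z.
by rewrite !aq_mulE mulrA.
Qed.
Let mul1 : left_id (acls 1) aq_mul.
Proof. by elim/acls_ind=> x; rewrite aq_mulE mul1r. Qed.
Let mulr1 : right_id (acls 1) aq_mul.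
Proof. by elim/acls_ind=> x; rewrite aq_mulE mulr1. Qed.
Let mulDl : left_distributive aq_mul +%R.
Proof.
elim/acls_ind=> x; elim/acls_ind=> y; elim/acls_ind=> z.
by rewrite -raddfD !aq_mulE mulrDl raddfD.
Qed.
Let mulDr : right_distributive aq_mul +%R.
Proof.
elim/acls_ind=> x; elim/acls_ind=> y; elim/acls_ind=> z.
by rewrite -raddfD !aq_mulE mulrDr raddfD.
Qed.
HB.instance Definition _ :=
  GRing.Zmodule_isPzRing.Build alg_quo mulA mul1 mulr1 mulDl mulDr.
Lemma acls_mon : monoid_morphism acls.
Proof. by split=> [//|x y]; rewrite -aq_mulE. Qed.
HB.instance Definition _ := GRing.isMonoidMorphism.Build A alg_quo acls acls_mon.
Let pz_zmod : zmod_morphism (acls \o pzin).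
Proof. exact: raddfB. Qed.
Let pz_mon : monoid_morphism (acls \o @pzin K A).
Proof. by split=> [|x y]; rewrite /= ?rmorph1 ?rmorphM ?rmorph1. Qed.
Let pzC k (x : alg_quo) : (acls \o pzin) k * x = x * (acls \o pzin) k.
Proof. by elim/acls_ind: x => x; rewrite /= -!rmorphM pzinC. Qed.
HB.instance Definition _ := isPzAlgebra.Build K alg_quo pz_zmod pz_mon pzC.
End AlgQuo.

Section LinExt.
Variables (K : pzRingType) (T : choiceType) (W : lmodType K).
Definition fs_lin (F : T -> W) (f : fs T K^o) : W :=
  fsum (fun t (k : K^o) => (k : K) *: F t) f.
Let FD (F : T -> W) t (k l : K) : (k + l) *: F t = k *: F t + l *: F t.
Proof. exact: scalerDl. Qed.
Lemma fs_lin_delta F t (k : K) : fs_lin F (delta t (k : K^o)) = k *: F t.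
Proof. by rewrite /fs_lin fsum_delta. Qed.
Lemma fs_lin_linear F : linear (fs_lin F).
Proof.
have aD f g : fs_lin F (f + g) = fs_lin F f + fs_lin F g by rewrite /fs_lin fsumD.
move=> c f g; rewrite aD; congr (_ + _).
elim/fs_ind: f => [|f h ef eh|t k].
- by rewrite scaler0 /fs_lin fsum0 scaler0.
- by rewrite scalerDr !aD ef eh scalerDr.
- by rewrite -deltaZ !fs_lin_delta scalerA.
Qed.
HB.instance Definition _ F :=
  GRing.isLinear.Build K (fs T K^o) W _ (fs_lin F) (fs_lin_linear F).
End LinExt.

Section Tensor.
Variables (K : fieldType) (L : pzAlgType K).

(* X (x)_L Y is the free K-module on X * Y modulo these relations; K acts by
   k (x (x) y) = x (x) k y. *)
Inductive tensor_rel (X : lmodType L^c) (Y : lmodType L) :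
    fs (X * Y)%type K^o -> Prop :=
  | TensorDl x x' y : tensor_rel
      (delta (x + x', y) 1 - delta (x, y) 1 - delta (x', y) 1)
  | TensorDr x y y' : tensor_rel
      (delta (x, y + y') 1 - delta (x, y) 1 - delta (x, y') 1)
  | TensorZ (l : L) x y : tensor_rel
      (delta ((l : L^c) *: x, y) 1 - delta (x, l *: y) 1)
  | TensorK (k : K) x y : tensor_rel
      (delta (x, (pzin k : L) *: y) 1 - delta (x, y) (k : K^o)).

Definition tensor (X : lmodType L^c) (Y : lmodType L) : lmodType K :=
  quo (@tensor_rel X Y).

Definition tens (X : lmodType L^c) (Y : lmodType L) (x : X) (y : Y) :
  tensor X Y := qcls _ (delta (x, y) (1 : K^o)).

Section TensTheory.
Variables (X : lmodType L^c) (Y : lmodType L).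
Let rel0 u v w : @tensor_rel X Y (u - v - w) ->
  qcls (@tensor_rel X Y) u = qcls (@tensor_rel X Y) v + qcls (@tensor_rel X Y) w.
Proof.
move=> h; rewrite -qclsD; apply/qclsE; rewrite opprD addrA; exact: mem_span.
Qed.
Let rel1 u v : @tensor_rel X Y (u - v) ->
  qcls (@tensor_rel X Y) u = qcls (@tensor_rel X Y) v.
Proof. by move=> h; apply/qclsE; exact: mem_span. Qed.
Lemma tensDl x x' y : tens (x + x') y = tens x y + tens x' y :> tensor X Y.
Proof. exact: rel0 (TensorDl _ _ _). Qed.
Lemma tensDr x y y' : tens x (y + y') = tens x y + tens x y' :> tensor X Y.
Proof. exact: rel0 (TensorDr _ _ _). Qed.
Lemma tensZ l x y : tens ((l : L^c) *: x) y = tens x ((l : L) *: y) :> tensor X Y.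
Proof. exact: rel1 (TensorZ _ _ _). Qed.
Lemma tensK k x y : tens x ((pzin k : L) *: y) = k *: tens x y :> tensor X Y.
Proof.
rewrite /tens -qclsZ -deltaZ.
rewrite (rel1 (TensorK k x y)); congr (qcls _ (delta _ _)).
exact: (esym (mulr1 k)).
Qed.
End TensTheory.

Section Tmap.
Variables (X : lmodType L^c) (Y Z : lmodType L) (f : {linear Y -> Z}).
Definition pre_tmap : fs (X * Y)%type K^o -> tensor X Z :=
  fs_lin (fun p => tens p.1 (f p.2)).
HB.instance Definition _ := GRing.Linear.on pre_tmap.
Definition tmap : tensor X Y -> tensor X Z := quo_lift pre_tmap.

Let pre_tmapE x y (k : K) :
  pre_tmap (delta (x, y) (k : K^o)) = k *: tens x (f y).
Proof. exact: fs_lin_delta. Qed.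

Let pre_tmapB u v : pre_tmap (u - v) = pre_tmap u - pre_tmap v.
Proof. exact: raddfB. Qed.

Let fZ l y : f (l *: y) = l *: f y.
Proof. exact: linearZ. Qed.

Lemma pre_tmap0 u : tensor_rel u -> pre_tmap u = 0.
Proof.
case=> [x x' y|x y y'|l x y|k x y]; rewrite !pre_tmapB !pre_tmapE ?scale1r.
- by rewrite tensDl -addrA -opprD subrr.
- by rewrite (raddfD f) tensDr -addrA -opprD subrr.
- by rewrite fZ tensZ subrr.
- by rewrite fZ tensK subrr.
Qed.

HB.instance Definition _ := GRing.isLinear.Build K (tensor X Y) (tensor X Z) _
  tmap (quo_lift_linear pre_tmap0).
End Tmap.
End Tensor.
Arguments tmap {K L} X {Y Z} f.


Section Submodule.
Variables (R : pzRingType) (V : lmodType R) (P : submodClosed V).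
Definition subm : Type := {v : V | v \in P}.
HB.instance Definition _ := [isSub of subm for @sval V (fun v => v \in P)].
HB.instance Definition _ := [Choice of subm by <:].
HB.instance Definition _ := [SubChoice_isSubLmodule of subm by <:].
End Submodule.

Section Kernel.
Variables (R : pzRingType) (V W : lmodType R) (f : {linear V -> W}).
Definition ker : {pred V} := fun v => f v == 0.
Let kerP : GRing.submod_closed ker.
Proof.
split=> [|k u v]; first by rewrite unfold_in raddf0.
by rewrite !unfold_in linearP => /eqP -> /eqP ->; rewrite scaler0 addr0.
Qed.
HB.instance Definition _ :=
  GRing.isSubmodClosed.Build R V ker (GRing.submod_closed_semi kerP).
End Kernel.

Section Homology.
Variables (K : pzRingType) (C : nat -> lmodType K).
Variable d : forall n, {linear C n.+1 -> C n}.

Definition cycle n : {pred C n} :=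
  match n return {pred C n} with
  | 0 => predT
  | m.+1 => fun z => d m z == 0
  end.
Let cycleP n : GRing.submod_closed (@cycle n).
Proof.
case: n => [|n]; split=> // [|k u v]; first by rewrite unfold_in /= raddf0.
rewrite !unfold_in /= linearP => /eqP -> /eqP ->.
by rewrite scaler0 addr0.
Qed.
HB.instance Definition _ n := GRing.isSubmodClosed.Build K (C n) (@cycle n)
  (GRing.submod_closed_semi (cycleP n)).

(* The complex ... -> C 2 -> C 1 -> C 0 -> 0. Nothing forces d n \o d n.+1 = 0:
   homology n is cycles modulo (the span of) those boundaries that are cycles. *)
Definition homology n : lmodType K :=
  quo (fun z : subm (@cycle n) => exists w : C n.+1, val z = d n w).
End Homology.

(* The standard free resolution of Y: res 0 is the free module on the underlying
   set of Y, mapping onto Y by eps; res n.+1 is the free module on the underlying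
   set of the n-th syzygy. *)
Section FreeResolution.
Variables (L : pzRingType).

Section Cover.
Variable X : lmodType L.
Definition free : lmodType L := fs X L^o.
Definition eps : free -> X := fs_lin id.
HB.instance Definition _ := GRing.Linear.on eps.
Lemma eps_delta x : eps (delta x (1 : L^o)) = x.
Proof. by rewrite /eps fs_lin_delta scale1r. Qed.
End Cover.

Section Step.
Variable X : lmodType L.
Definition res_step (x : free (subm (ker (@eps X)))) : free X := val (eps x).
Let res_step_linear : linear res_step.
Proof.
move=> k u v; transitivity (val (k *: eps u + eps v)); last exact: linearP.
by congr val; exact: linearP.
Qed.
HB.instance Definition _ := GRing.isLinear.Build L
  (free (subm (ker (@eps X)))) (free X) _ res_step res_step_linear.
Lemma res_stepP (z : free X) : eps z = 0 <-> exists w, z = res_step w.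
Proof.
split=> [z0|[w ->]]; last by apply/eqP; exact: valP (eps w).
have zk : z \in ker (@eps X) by apply/eqP.
by exists (delta (exist (fun z => z \in ker (@eps X)) z zk) 1);
  rewrite /res_step eps_delta.
Qed.
End Step.

Variable Y : lmodType L.

Fixpoint syz n : lmodType L :=
  if n is m.+1 then subm (ker (@eps (syz m))) else Y.

Definition res n : lmodType L := free (syz n).

Definition res_d n : {linear res n.+1 -> res n} := @res_step (syz n).

Lemma res_exact n (z : res n.+1) :
  res_d n z = 0 <-> exists w, z = res_d n.+1 w.
Proof.
rewrite -(res_stepP (z : free (syz n.+1))); split=> [z0|z0].
  by apply: val_inj.
exact: (congr1 val z0).
Qed.
End FreeResolution.

(* Tor_n^L(X, Y) as the n-th left derived functor of X (x)_L - at Y. *)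
Definition Tor (K : fieldType) (L : pzAlgType K) (n : nat)
  (X : lmodType L^c) (Y : lmodType L) : lmodType K :=
  homology (fun i => tmap X (@res_d L Y i)) n.

Section MonoidAction.
Variables (K : comPzRingType) (G : monoidType) (W : lmodType K).

Record left_rep := LeftRep {
  lrep :> G -> W -> W;
  lrep_linear : forall g, linear (lrep g);
  lrep1 : forall w, lrep 1%g w = w;
  lrepM : forall g h w, lrep (g * h)%g w = lrep g (lrep h w)
}.

Record right_rep := RightRep {
  rrep :> G -> W -> W;
  rrep_linear : forall g, linear (rrep g);
  rrep1 : forall w, rrep 1%g w = w;
  rrepM : forall g h w, rrep (g * h)%g w = rrep h (rrep g w)
}.

Definition mon_act (r : G -> W -> W) (f : mon_alg K G) (w : W) : W :=
  fs_lin (fun g => r g w) f.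

Section Generic.
Variable r : G -> W -> W.
Hypothesis r_lin : forall g, linear (r g).

Lemma mon_act_delta g k w : mon_act r (delta g (k : K^o)) w = k *: r g w.
Proof. exact: fs_lin_delta. Qed.
Lemma mon_actDl f f' w : mon_act r (f + f') w = mon_act r f w + mon_act r f' w.
Proof. exact: raddfD (fs_lin _) _ _. Qed.
Lemma mon_actB f f' w : mon_act r (f - f') w = mon_act r f w - mon_act r f' w.
Proof. exact: raddfB (fs_lin _) _ _. Qed.
Lemma mon_act0 w : mon_act r 0 w = 0.
Proof. exact: raddf0 (fs_lin _). Qed.
Lemma rD g v w : r g (v + w) = r g v + r g w.
Proof. by have := r_lin g 1 v w; rewrite !scale1r. Qed.
Lemma r0 g : r g 0 = 0.
Proof. by apply: (addrI (r g 0)); rewrite -rD !addr0. Qed.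
Lemma rZ g k w : r g (k *: w) = k *: r g w.
Proof. by have := r_lin g k w 0; rewrite r0 !addr0. Qed.
Lemma mon_actDr f v w : mon_act r f (v + w) = mon_act r f v + mon_act r f w.
Proof.
elim/fs_ind: f => [|f g ef eg|g k]; first by rewrite !mon_act0 addr0.
  by rewrite !mon_actDl ef eg addrACA.
by rewrite !mon_act_delta rD scalerDr.
Qed.
Lemma mon_actr0 f : mon_act r f 0 = 0.
Proof. by apply: (addrI (mon_act r f 0)); rewrite -mon_actDr !addr0. Qed.
End Generic.

Section LeftModule.
Variable r : left_rep.
(* The KG-module attached to a representation; r only serves to find the
   module structure back from the type. *)
Definition lrep_mod : Type := let _ := r in W.
HB.instance Definition _ := GRing.Zmodule.on lrep_mod.
Let act (f : mon_alg K G) (w : lrep_mod) : lrep_mod := mon_act r f w.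
Let actA f g w : act f (act g w) = act (f * g) w.
Proof.
have lin := lrep_linear r; rewrite /act.
elim/fs_ind: f => [|f f' ef eg|s k]; first by rewrite mul0r !mon_act0.
  by rewrite mulrDl !mon_actDl ef eg.
elim/fs_ind: g => [|f f' ef eg|t l]; first by rewrite mulr0 mon_act0 mon_actr0.
  by rewrite mulrDr !mon_actDl mon_actDr // ef eg.
by rewrite mon_delta !mon_act_delta rZ // scalerA lrepM.
Qed.
Let act1 : left_id 1 act.
Proof. by move=> w; rewrite /act mon_act_delta scale1r lrep1. Qed.
Let actDr : right_distributive act +%R.
Proof. by move=> f v w; apply: mon_actDr (lrep_linear r) _ _ _. Qed.
Let actDl w : {morph act^~ w : f g / f + g}.
Proof. by move=> f g; exact: mon_actDl. Qed.
HB.instance Definition _ :=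
  GRing.Zmodule_isLmodule.Build (mon_alg K G) lrep_mod actA act1 actDr actDl.
End LeftModule.

Section RightModule.
Variable r : right_rep.
Definition rrep_mod : Type := let _ := r in W.
HB.instance Definition _ := GRing.Zmodule.on rrep_mod.
Let act (f : (mon_alg K G)^c) (w : rrep_mod) : rrep_mod := mon_act r f w.
Let actA f g w : act f (act g w) = act (f * g) w.
Proof.
have lin := rrep_linear r; rewrite /act -[f * g]/((g : mon_alg K G) * f).
elim/fs_ind: f => [|f f' ef eg|s k]; first by rewrite mulr0 !mon_act0.
  by rewrite mulrDr !mon_actDl ef eg.
elim/fs_ind: g => [|f f' ef eg|t l]; first by rewrite mul0r mon_act0 mon_actr0.
  by rewrite mulrDl !mon_actDl mon_actDr // ef eg.
by rewrite mon_delta !mon_act_delta rZ // scalerA rrepM mulrC.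
Qed.
Let act1 : left_id 1 act.
Proof. by move=> w; rewrite /act mon_act_delta scale1r rrep1. Qed.
Let actDr : right_distributive act +%R.
Proof. by move=> f v w; apply: mon_actDr (rrep_linear r) _ _ _. Qed.
Let actDl w : {morph act^~ w : f g / f + g}.
Proof. by move=> f g; exact: mon_actDl. Qed.
HB.instance Definition _ :=
  GRing.Zmodule_isLmodule.Build (mon_alg K G)^c rrep_mod actA act1 actDr actDl.
End RightModule.
End MonoidAction.

Section QuotientModules.
Variables (K : pzRingType) (A : pzAlgType K) (U : A -> Prop).

Section Left.
Variables (X : lmodType A).
Hypothesis UX : forall u (x : X), U u -> u *: x = 0.
Definition aq_lmod : Type := let _ := UX in X.
HB.instance Definition _ := GRing.Zmodule.on aq_lmod.
Let act (q : alg_quo U) (x : aq_lmod) : aq_lmod := (repr q : A) *: (x : X).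
Let actE a x : act (acls U a) x = a *: (x : X).
Proof.
apply/eqP; rewrite -subr_eq0 -scalerBl; apply/eqP.
apply: (ideal_gen_min (J := fun a => forall x : X, a *: x = 0)) (repr_cls _ a) x.
- split=> [y|b c hb hc y|b c hc]; first exact: scale0r.
    by rewrite scalerBl hb hc subrr.
  by split=> y; rewrite -scalerA hc ?scaler0.
- by move=> u Uu y; exact: UX.
Qed.
Let actA f g w : act f (act g w) = act (f * g) w.
Proof.
elim/acls_ind: f => f; elim/acls_ind: g => g.
by rewrite -rmorphM !actE scalerA.
Qed.
Let act1 : left_id 1 act.
Proof. by move=> w; rewrite -(rmorph1 (acls U)) actE scale1r. Qed.
Let actDr : right_distributive act +%R.
Proof. by move=> f v w; exact: scalerDr. Qed.
Let actDl w : {morph act^~ w : f g / f + g}.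
Proof.
by elim/acls_ind => f; elim/acls_ind => g; rewrite -raddfD !actE scalerDl.
Qed.
HB.instance Definition _ :=
  GRing.Zmodule_isLmodule.Build (alg_quo U) aq_lmod actA act1 actDr actDl.
End Left.

Section Right.
Variables (X : lmodType A^c).
Hypothesis UX : forall u (x : X), U u -> (u : A^c) *: x = 0.
Definition aq_rmod : Type := let _ := UX in X.
HB.instance Definition _ := GRing.Zmodule.on aq_rmod.
Let act (q : (alg_quo U)^c) (x : aq_rmod) : aq_rmod :=
  (repr (q : alg_quo U) : A^c) *: (x : X).
Let actE a x : act (acls U a) x = (a : A^c) *: (x : X).
Proof.
have kill c : c \in ideal_gen U -> forall y : X, (c : A^c) *: y = 0.
  apply: (@ideal_gen_min A U (fun c => forall y : X, (c : A^c) *: y = 0) _ _ c).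
    split=> [y|d e hd he y|d e he]; first exact: scale0r.
      by rewrite -[d - e]/((d : A^c) - e) scalerBl hd he subrr.
    split=> y.
      by rewrite -[d * e]/((e : A^c) * d) -scalerA he.
    by rewrite -[e * d]/((d : A^c) * e) -scalerA he scaler0.
  by move=> u Uu y; exact: UX.
apply/eqP; rewrite -subr_eq0 -scalerBl; apply/eqP.
exact: kill (repr_cls _ a) x.
Qed.
Let actA f g w : act f (act g w) = act (f * g) w.
Proof.
elim/acls_ind: f => f; elim/acls_ind: g => g.
rewrite -[_ * _]/(acls U g * acls U f) -rmorphM !actE.
by rewrite scalerA.
Qed.
Let act1 : left_id 1 act.
Proof. by move=> w; rewrite -[1]/(acls U 1) actE scale1r. Qed.
Let actDr : right_distributive act +%R.
Proof. by move=> f v w; exact: scalerDr. Qed.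
Let actDl w : {morph act^~ w : f g / f + g}.
Proof.
elim/acls_ind => f; elim/acls_ind => g.
by rewrite -[_ + _]/(acls U f + acls U g) -raddfD !actE scalerDl.
Qed.
HB.instance Definition _ :=
  GRing.Zmodule_isLmodule.Build (alg_quo U)^c aq_rmod actA act1 actDr actDl.
End Right.
End QuotientModules.

Section Enveloping.
Variables (K : fieldType) (R : pzAlgType K).

(* The multiplicative monoid R * R^op. *)
Definition opair : Type := (R * R)%type.
HB.instance Definition _ := Choice.on opair.
Definition opair_mul (p q : opair) : opair := (p.1 * q.1, q.2 * p.2).
Let opA : associative opair_mul.
Proof. by move=> p q s; rewrite /opair_mul /= !mulrA. Qed.
Let op1 : left_id ((1, 1) : opair) opair_mul.
Proof. by case=> a b; rewrite /opair_mul /= mul1r mulr1. Qed.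
Let opr1 : right_id ((1, 1) : opair) opair_mul.
Proof. by case=> a b; rewrite /opair_mul /= mul1r mulr1. Qed.
HB.instance Definition _ := isMonoid.Build opair opA op1 opr1.

(* R^e = R (x)_K R^op: the monoid algebra of R * R^op has basis the pairs (a, b),
   with (a, b) (c, d) = (a c, d b); modulo the bilinearity relations it is the
   tensor product. The relations are stable under multiplication by pairs on
   both sides, so their span is already an ideal. *)
Inductive env_rel : mon_alg K opair -> Prop :=
  | EnvDl a a' b : env_rel
      (delta (a + a', b) 1 - delta (a, b) 1 - delta (a', b) 1)
  | EnvDr a b b' : env_rel
      (delta (a, b + b') 1 - delta (a, b) 1 - delta (a, b') 1)
  | EnvZl k a b : env_rel (delta (pzin k * a, b) 1 - delta (a, b) k)
  | EnvZr k a b : env_rel (delta (a, pzin k * b) 1 - delta (a, b) k).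

Definition env : pzAlgType K := alg_quo env_rel.

Definition env_tens (a b : R) : env :=
  acls env_rel (delta ((a, b) : opair) (1 : K)).

(* (a (x) b) . x = a x b *)
Definition left_mul2 (p : opair) (x : restr R^o) : restr R^o :=
  p.1 * (x : R) * p.2.
Let left_mul2_linear p : linear (left_mul2 p).
Proof.
move=> k x y; change (p.1 * (pzin k * (x : R) + y) * p.2 =
  pzin k * (p.1 * (x : R) * p.2) + p.1 * (y : R) * p.2).
by rewrite mulrDr mulrDl !mulrA -pzinC.
Qed.
Let left_mul21 x : left_mul2 1%g x = x.
Proof. by rewrite /left_mul2 mul1r mulr1. Qed.
Let left_mul2M p q x : left_mul2 (p * q)%g x = left_mul2 p (left_mul2 q x).
Proof. by rewrite /left_mul2 /= !mulrA. Qed.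
Definition reg_left_rep : left_rep opair (restr R^o) :=
  LeftRep left_mul2_linear left_mul21 left_mul2M.

(* x . (a (x) b) = b x a *)
Definition right_mul2 (p : opair) (x : restr R^o) : restr R^o :=
  p.2 * (x : R) * p.1.
Let right_mul2_linear p : linear (right_mul2 p).
Proof.
move=> k x y; change (p.2 * (pzin k * (x : R) + y) * p.1 =
  pzin k * (p.2 * (x : R) * p.1) + p.2 * (y : R) * p.1).
by rewrite mulrDr mulrDl !mulrA -pzinC.
Qed.
Let right_mul21 x : right_mul2 1%g x = x.
Proof. by rewrite /right_mul2 mul1r mulr1. Qed.
Let right_mul2M p q x : right_mul2 (p * q)%g x = right_mul2 q (right_mul2 p x).
Proof. by rewrite /right_mul2 /= !mulrA. Qed.
Definition reg_right_rep : right_rep opair (restr R^o) :=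
  RightRep right_mul2_linear right_mul21 right_mul2M.

Lemma reg_left_env0 u x : env_rel u -> mon_act left_mul2 u x = 0.
Proof.
case=> [a a' b|a b b'|k a b|k a b]; rewrite !mon_actB !mon_act_delta ?scale1r.
- change ((a + a') * (x : R) * b - a * (x : R) * b - a' * (x : R) * b = 0 :> R).
  by rewrite ?mulrDr ?mulrDl -addrA -opprD subrr.
- change (a * (x : R) * (b + b') - a * (x : R) * b - a * (x : R) * b' = 0 :> R).
  by rewrite ?mulrDr ?mulrDl -addrA -opprD subrr.
- change ((pzin k * a) * (x : R) * b - pzin k * (a * (x : R) * b) = 0 :> R).
  by rewrite !mulrA subrr.
- change (a * (x : R) * (pzin k * b) - pzin k * (a * (x : R) * b) = 0 :> R).
  by rewrite (pzinC k b) !mulrA -(pzinC k) !mulrA subrr.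
Qed.

Lemma reg_right_env0 u x : env_rel u -> mon_act right_mul2 u x = 0.
Proof.
case=> [a a' b|a b b'|k a b|k a b]; rewrite !mon_actB !mon_act_delta ?scale1r.
- change (b * (x : R) * (a + a') - b * (x : R) * a - b * (x : R) * a' = 0 :> R).
  by rewrite ?mulrDr ?mulrDl -addrA -opprD subrr.
- change ((b + b') * (x : R) * a - b * (x : R) * a - b' * (x : R) * a = 0 :> R).
  by rewrite ?mulrDr ?mulrDl -addrA -opprD subrr.
- change (b * (x : R) * (pzin k * a) - pzin k * (b * (x : R) * a) = 0 :> R).
  by rewrite (pzinC k a) !mulrA -(pzinC k) !mulrA subrr.
- change ((pzin k * b) * (x : R) * a - pzin k * (b * (x : R) * a) = 0 :> R).
  by rewrite !mulrA subrr.
Qed.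

Lemma reg_left_env u (x : lrep_mod reg_left_rep) : env_rel u -> u *: x = 0.
Proof. exact: reg_left_env0. Qed.

Lemma reg_right_env u (x : rrep_mod reg_right_rep) :
  env_rel u -> (u : (mon_alg K opair)^c) *: x = 0.
Proof. exact: reg_right_env0. Qed.

Definition reg_lmod : lmodType env := aq_lmod reg_left_env.
Definition reg_rmod : lmodType env^c := aq_rmod reg_right_env.
End Enveloping.

Definition projective (L : pzRingType) (P : lmodType L) :=
  forall (M N : lmodType L) (g : {linear M -> N}) (f : {linear P -> N}),
    (forall y, exists x, g x = y) -> exists h : {linear P -> M}, g \o h =1 f.

Definition separable (K : fieldType) (A : pzAlgType K) :=
  projective (reg_lmod A).

Definition hochschild (K : fieldType) (R : pzAlgType K) (n : nat)
  (M : lmodType (env R)) : lmodType K := Tor n (reg_rmod R) M.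

Definition pdom (T : Type) (f : T -> option T) (x : T) := exists y, f x = Some y.
Definition pran (T : Type) (f : T -> option T) (y : T) := exists x, f x = Some y.

(* A homomorphism from S to the symmetric inverse monoid of A: partial injective
   maps A -> option A, composed right to left. *)
Record unital_action (K : fieldType) (S : inverseMonoidType) (A : pzAlgType K) :=
  UnitalAction {
  ua :> S -> A -> option A;
  ua_inj : forall s x y z, ua s x = Some z -> ua s y = Some z -> x = y;
  ua_mul : forall s t x, ua (s * t)%g x = obind (ua s) (ua t x);
  ua_dom_ideal : forall s, is_ideal (pdom (ua s));
  ua_ran_ideal : forall s, is_ideal (pran (ua s));
  ua_add : forall s x x' y y', ua s x = Some y -> ua s x' = Some y' ->
    ua s (x + x') = Some (y + y');
  ua_mulr : forall s x x' y y', ua s x = Some y -> ua s x' = Some y' ->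
    ua s (x * x') = Some (y * y');
  ua_scale : forall s k x y, ua s x = Some y ->
    ua s (pzin k * x) = Some (pzin k * y);
  ua_id : forall x, ua 1%g x = Some x;
  ua_one : S -> A;
  ua_one_idem : forall s, ua_one s * ua_one s = ua_one s;
  ua_one_central : forall s a, ua_one s * a = a * ua_one s;
  ua_ranE : forall s y, pran (ua s) y <-> exists a, y = ua_one s * a
}.

Section CrossedProduct.
Variables (K : fieldType) (S : inverseMonoidType) (A : pzAlgType K).
Variable th : unital_action S A.
Implicit Types (s t : S) (a b x y : A).

Local Notation one s := (ua_one th s).

(* beta s x = theta_s (1_(s^-1) x); the default value 0 is never used (betaP). *)
Definition beta s x : A := odflt 0 (th s (one (sinv s) * x)).

Lemma ua_inv s x y : th s x = Some y -> th (sinv s) y = Some x.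
Proof.
move=> e; have := ua_mul th (s * sinv s)%g s x.
rewrite mulVs e /= (ua_mul th s (sinv s)) /=.
case e': (th (sinv s) y) => [z|] //= /esym e2.
by rewrite (ua_inj e2 e).
Qed.

Lemma ua_domE s x : pdom (th s) x <-> exists a, x = one (sinv s) * a.
Proof.
rewrite -(ua_ranE th); split=> [] [y e]; exists y; first exact: ua_inv.
by rewrite -[s]sinvK; exact: ua_inv.
Qed.

Lemma ua_dom_one s x y : th s x = Some y -> one (sinv s) * x = x.
Proof.
move=> e; have [|a ->] := (ua_domE s x).1; first by exists y.
by rewrite mulrA ua_one_idem.
Qed.

Lemma ua_ran_one s x y : th s x = Some y -> one s * y = y.
Proof.
move=> e; have [|a ->] := (ua_ranE th s y).1; first by exists x.
by rewrite mulrA ua_one_idem.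
Qed.

Lemma betaP s x : th s (one (sinv s) * x) = Some (beta s x).
Proof.
rewrite /beta; have [|y ->//] := (ua_domE s (one (sinv s) * x)).2.
by exists x.
Qed.

Lemma betaE s x y : th s (one (sinv s) * x) = Some y -> beta s x = y.
Proof. by rewrite /beta => ->. Qed.

Lemma beta_ua s x y : th s x = Some y -> beta s x = y.
Proof. by move=> e; apply: betaE; rewrite (ua_dom_one e). Qed.

Lemma betaD s x y : beta s (x + y) = beta s x + beta s y.
Proof. by apply: betaE; rewrite mulrDr; apply: ua_add; apply: betaP. Qed.

Lemma betaM s x y : beta s (x * y) = beta s x * beta s y.
Proof.
apply: betaE; rewrite -(ua_one_idem th) -mulrA (mulrA _ x) (ua_one_central th _ x).
by rewrite -mulrA mulrA; apply: ua_mulr; apply: betaP.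
Qed.

Lemma betaK s k x : beta s (pzin k * x) = pzin k * beta s x.
Proof.
by apply: betaE; rewrite mulrA -pzinC -mulrA; apply: ua_scale; apply: betaP.
Qed.

Lemma one_beta s x : one s * beta s x = beta s x.
Proof. exact: ua_ran_one (betaP s x). Qed.

Lemma beta_one s x : beta s (one (sinv s) * x) = beta s x.
Proof. by apply: betaE; rewrite mulrA ua_one_idem betaP. Qed.

Lemma beta1 s : beta s 1 = one s.
Proof.
have [|u e] := (ua_ranE th s (one s)).2; first by exists 1; rewrite mulr1.
by rewrite -[LHS]one_beta -{1}(beta_ua e) -betaM mulr1 (beta_ua e).
Qed.

Lemma one1 : one 1%g = 1.
Proof.
have [|a e] := (ua_ranE th 1%g 1).1; first by exists 1; rewrite ua_id.
by rewrite -[LHS]mulr1 {1}e mulrA ua_one_idem -e.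
Qed.

Lemma beta_id x : beta 1%g x = x.
Proof. exact: beta_ua (ua_id th x). Qed.

Lemma betaC s t x : beta (s * t)%g x = beta s (beta t x).
Proof.
set e := one (sinv (s * t)%g).
have dst y z : th (s * t)%g y = Some z -> e * y = y by apply: ua_dom_one.
have eE : th (s * t)%g e = Some (beta (s * t)%g 1) by rewrite -betaP mulr1.
have := eE; rewrite ua_mul; case te: (th t e) => [f|] //= fs1.
have tf : f = one (sinv s) * one t.
  have f1 := ua_dom_one fs1; have f2 := ua_ran_one te.
  have [u u0] : pran (th t) (one (sinv s) * one t).
    by apply/(ua_ranE th); exists (one (sinv s)); rewrite ua_one_central.
  have [v v0] : pdom (th s) (one (sinv s) * one t).
    by apply/ua_domE; exists (one t).
  have eu : e * u = u by apply: (dst _ v); rewrite ua_mul u0.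
  have := ua_mulr te u0; rewrite eu u0 => -[->].
  by rewrite mulrA -[f * _]ua_one_central f1 -ua_one_central f2.
have ex : th t (e * x) = Some (one (sinv s) * beta t x).
  have := ua_mulr te (betaP t x); rewrite tf -mulrA one_beta mulrA.
  by rewrite -ua_one_central (ua_dom_one te).
by apply: betaE; rewrite -/e ua_mul ex /= betaP.
Qed.

Lemma beta_idem s x : beta (sinv s * s)%g x = one (sinv s) * x.
Proof.
rewrite betaC; apply: beta_ua; apply: ua_inv; exact: betaP.
Qed.

Lemma oneM s t : one (s * t)%g = beta s (one t).
Proof. by rewrite -!beta1 betaC. Qed.

Lemma beta0 s : beta s 0 = 0.
Proof. by apply: (addrI (beta s 0)); rewrite -betaD !addr0. Qed.

(* L(A, theta, S) as the finitely supported f : S -> A with f s in 1_s A. *)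
Definition skew_pred : {pred fs S A} :=
  fun f => `[< forall s, exists a, f@_s = one s * a >].

Lemma skew_predP f : reflect (forall s, one s * f@_s = f@_s) (f \in skew_pred).
Proof.
apply: (iffP (asboolP _)) => h s; last by exists f@_s; rewrite h.
by have [a ->] := h s; rewrite mulrA ua_one_idem.
Qed.

Let skew_zmod : zmod_closed skew_pred.
Proof.
split=> [|f g /skew_predP hf /skew_predP hg]; apply/skew_predP => s.
  by rewrite mcoeff0 mulr0.
by rewrite mcoeffB mulrBr hf hg.
Qed.
HB.instance Definition _ := GRing.isZmodClosed.Build (fs S A) skew_pred skew_zmod.

Lemma skew_delta s a : delta s (one s * a) \in skew_pred.
Proof.
apply/skew_predP => t; rewrite mcoeffU; case: eqP => [->|_].
  by rewrite mulrA ua_one_idem.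
by rewrite mulr0n mulr0.
Qed.

Definition skew : Type := {f : fs S A | f \in skew_pred}.
HB.instance Definition _ := [isSub of skew for @sval (fs S A) (fun f => f \in skew_pred)].
HB.instance Definition _ := [Choice of skew by <:].
HB.instance Definition _ := [SubChoice_isSubZmodule of skew by <:].

Lemma skew_conv (f g : skew) : conv beta (val f) (val g) \in skew_pred.
Proof.
have /skew_predP hf := valP f; have /skew_predP hg := valP g.
apply: rpred_sum => s _; apply: rpred_sum => t _.
set a := (val f)@_s; set b := (val g)@_t.
suff -> : a * beta s b = one (s * t)%g * (a * beta s b) by exact: skew_delta.
rewrite mulrA ua_one_central -mulrA oneM -betaM.
by rewrite hg.
Qed.

Definition skew_mul (f g : skew) : skew :=
  exist (fun f => f \in skew_pred) _ (skew_conv f g).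

(* (1_s a) d_s *)
Definition skew_mon s a : skew :=
  exist (fun f => f \in skew_pred) _ (skew_delta s a).

Let mulA : associative skew_mul.
Proof.
move=> f g h; apply: val_inj; apply: convA; [exact: betaD|exact: betaM|exact: betaC].
Qed.
Let mulDl : left_distributive skew_mul +%R.
Proof. by move=> f g h; apply: val_inj; apply: convDl. Qed.
Let mulDr : right_distributive skew_mul +%R.
Proof. by move=> f g h; apply: val_inj; apply: convDr; exact: betaD. Qed.
Let mul1 : left_id (skew_mon 1%g 1) skew_mul.
Proof.
move=> f; apply: val_inj; rewrite /= one1 mulr1.
elim/fs_ind: (val f) => [|g h eg eh|s x]; first exact: (convf0 betaD).
  by rewrite (convDr betaD) eg eh.
by rewrite (conv_delta betaD) mul1g mul1r beta_id.
Qed.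
Let mulr1' : right_id (skew_mon 1%g 1) skew_mul.
Proof.
move=> f; apply: val_inj; rewrite /= one1 mulr1 [RHS]monalgE.
have /skew_predP hf := valP f; apply: eq_bigr => s _.
rewrite fsum_delta => [|t y z]; last by rewrite betaD mulrDr deltaD.
by rewrite mulg1 beta1 -ua_one_central hf.
Qed.
HB.instance Definition _ :=
  GRing.Zmodule_isPzRing.Build skew mulA mul1 mulr1' mulDl mulDr.

Lemma skew_monM s a t b :
  skew_mon s a * skew_mon t b = skew_mon (s * t)%g (a * beta s b).
Proof.
apply: val_inj; rewrite /= (conv_delta betaD).
congr delta; rewrite betaM -oneM -[in RHS](one_beta s b) (ua_one_central th s a).
rewrite !mulrA (ua_one_central th (s * t)%g a) -(mulrA a (one s)).
by rewrite (ua_one_central th s) mulrA.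
Qed.

Let skew_pzin (k : K) : skew := skew_mon 1%g (pzin k).
Let pz_zmod : zmod_morphism skew_pzin.
Proof.
move=> k l; apply: val_inj; rewrite /= rmorphB mulrBr; exact: monalgUB.
Qed.
Let pz_mon : monoid_morphism skew_pzin.
Proof.
split=> [|k l]; first by rewrite /skew_pzin rmorph1.
by rewrite /skew_pzin skew_monM mul1g beta_id rmorphM.
Qed.
Let pzC k (x : skew) : skew_pzin k * x = x * skew_pzin k.
Proof.
apply: val_inj; rewrite /= one1 mul1r; have /skew_predP hx := valP x.
have rD s a y z t : delta (t * s)%g (a * beta t (y + z)) =
    delta (t * s)%g (a * beta t y) + delta (t * s)%g (a * beta t z).
  by rewrite betaD mulrDr deltaD.
rewrite {1}/conv fsum_delta; last by move=> t y z; rewrite -fsumDf;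
  apply: eq_bigr => s _; rewrite mulrDl deltaD.
apply: eq_bigr => s _; rewrite fsum_delta; last by move=> *; exact: rD.
rewrite mul1g mulg1 beta_id -[X in beta s X]mulr1 betaK beta1.
by rewrite mulrA -pzinC -mulrA -(ua_one_central th s) hx.
Qed.
HB.instance Definition _ := isPzAlgebra.Build K skew pz_zmod pz_mon pzC.

Definition nat_le (s t : S) : Prop := exists2 e : S, (e * e = e)%g & (s = e * t)%g.

(* u = a d_s - a d_t with s <= t and a in 1_s A; then a is also in 1_t A. *)
Definition skew_rel (u : skew) : Prop :=
  exists s t a, [/\ nat_le s t, exists b, a = one s * b
                & val u = delta s a - delta t a].

Definition crossed : pzAlgType K := alg_quo skew_rel.

(* The class of 1_s d_s *)
Definition unit_cls s : crossed := acls skew_rel (skew_mon s (one s)).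
Definition incl a : crossed := acls skew_rel (skew_mon 1%g a).

Lemma unit_clsM s t : unit_cls s * unit_cls t = unit_cls (s * t)%g.
Proof.
by rewrite /unit_cls -rmorphM skew_monM one_beta -oneM.
Qed.

Lemma unit_cls1 : unit_cls 1%g = 1.
Proof. by rewrite /unit_cls one1. Qed.

Lemma unit_incl s a : unit_cls s * incl a = incl (beta s a) * unit_cls s.
Proof.
rewrite /unit_cls /incl -!rmorphM !skew_monM mulg1 mul1g beta_id.
by rewrite one_beta -ua_one_central one_beta.
Qed.

Lemma incl_unit s a :
  incl a * unit_cls (sinv s) = unit_cls (sinv s) * incl (beta s a).
Proof.
rewrite /unit_cls /incl -!rmorphM !skew_monM mulg1 mul1g beta_id.
rewrite -betaC beta_idem; congr (acls _ _); apply: val_inj; rewrite /=.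
by rewrite -ua_one_central !mulrA !ua_one_idem.
Qed.
End CrossedProduct.

Section IdempotentModule.
Variables (K : fieldType) (S : inverseMonoidType).

Definition idempotents : Type := {e : S | idem e}.
HB.instance Definition _ := Choice.on idempotents.

Let conj_proof (e : idempotents) s : idem (sinv s * val e * s)%g.
Proof. by apply/eqP; apply: idem_conj; apply/eqP; exact: (valP e). Qed.
Definition idem_conj_by (s : S) (e : idempotents) : idempotents :=
  exist (fun e => idem e) _ (conj_proof e s).

(* e . s = s^-1 e s *)
Definition KE_act (s : S) : fs idempotents K^o -> fs idempotents K^o :=
  fs_lin (fun e => delta (idem_conj_by s e) (1 : K^o)).
Let KE_linear s : linear (KE_act s). Proof. exact: linearP. Qed.
Let KE_delta s e k :
  KE_act s (delta e (k : K^o)) = delta (idem_conj_by s e) (k : K^o).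
Proof. by rewrite /KE_act fs_lin_delta -deltaZ [_ *: _]mulr1. Qed.
Let KE0 s : KE_act s 0 = 0. Proof. exact: raddf0. Qed.
Let KED s f g : KE_act s (f + g) = KE_act s f + KE_act s g.
Proof. exact: raddfD. Qed.
Let KE1 w : KE_act 1%g w = w.
Proof.
elim/fs_ind: w => [|f g ef eg|e k]; rewrite ?KE0 ?KED ?ef ?eg // KE_delta.
congr delta; apply: val_inj => /=.
by rewrite sinv1 mul1g mulg1.
Qed.
Let KEM s t w : KE_act (s * t)%g w = KE_act t (KE_act s w).
Proof.
elim/fs_ind: w => [|f g ef eg|e k]; rewrite ?KE0 ?KED ?ef ?eg // !KE_delta.
by congr delta; apply: val_inj; rewrite /= sinvM !mulgA.
Qed.

(* KE(S) as a right KS-module. *)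
Definition KE : lmodType (mon_alg K S)^c :=
  rrep_mod (RightRep KE_linear KE1 KEM).

Definition inv_homology (n : nat) (V : lmodType (mon_alg K S)) : lmodType K :=
  Tor n KE V.
End IdempotentModule.

Section Bimodule.
Variables (K : fieldType) (R : pzAlgType K) (M : lmodType (env R)).

Definition bimul (a : R) (x : M) (b : R) : M := env_tens a b *: x.

Lemma bimulM a b a' b' x :
  bimul a (bimul a' x b') b = bimul (a * a') x (b' * b).
Proof.
rewrite /bimul scalerA; congr (_ *: _).
rewrite /env_tens -rmorphM; congr (acls _ _).
by rewrite mon_delta mulr1.
Qed.

Lemma bimul1 x : bimul 1 x 1 = x.
Proof. exact: scale1r. Qed.

Lemma bimulB a b x y : bimul a (x - y) b = bimul a x b - bimul a y b.
Proof. exact: scalerBr. Qed.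

Lemma bimul_linear a b : linear (fun x : restr M => bimul a x b : restr M).
Proof.
move=> k x y; change (env_tens a b *: (pzin k *: (x : M) + y) =
  pzin k *: (env_tens a b *: (x : M)) + env_tens a b *: y).
by rewrite scalerDr !scalerA pzinC.
Qed.
End Bimodule.

Section Coinvariants.
Variables (K : fieldType) (S : inverseMonoidType) (A : pzAlgType K).
Variables (th : unital_action S A) (M : lmodType (env (crossed th))).

(* s . x = [1_s d_s] x [1_(s^-1) d_(s^-1)] *)
Definition M_act (s : S) (x : restr M) : restr M :=
  bimul (unit_cls th s) (x : M) (unit_cls th (sinv s)).
Let M_linear s : linear (M_act s). Proof. exact: bimul_linear. Qed.
Let M1 x : M_act 1%g x = x.
Proof. by rewrite /M_act sinv1 unit_cls1 bimul1. Qed.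
Let MM s t x : M_act (s * t)%g x = M_act s (M_act t x).
Proof. by rewrite /M_act bimulM !unit_clsM sinvM. Qed.

(* The generators a x - x a of [A, M]. *)
Definition comm_gen (z : restr M) : Prop :=
  exists (a : A) (x : M), z = bimul (incl th a) x 1 - bimul 1 x (incl th a).

Lemma comm_stable s z : z \in span comm_gen -> M_act s z \in span comm_gen.
Proof.
move: z; apply: span_min.
  split=> [|k u v hu hv].
    rewrite -(subrr 0) (_ : M_act s _ = 0) ?rpred0 //.
    by rewrite subrr /M_act /bimul scaler0.
  by rewrite M_linear; apply: rpredD => //; apply: rpredZ.
move=> _ [a [x ->]]; apply: mem_span; exists (beta th s a), (M_act s x).
have eL : M_act s (bimul (incl th a) x 1) =
    bimul (incl th (beta th s a)) (M_act s x) 1.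
  by rewrite /M_act (bimulM _ _ _ 1) mul1r unit_incl bimulM mulr1.
have eR : M_act s (bimul 1 x (incl th a)) =
    bimul 1 (M_act s x) (incl th (beta th s a)).
  by rewrite /M_act (bimulM _ _ 1 _) mulr1 incl_unit bimulM mul1r.
rewrite -eL -eR; exact: bimulB.
Qed.

Let pre_act (s : S) : restr M -> quo comm_gen := qcls comm_gen \o M_act s.
Let pre_linear s : linear (pre_act s).
Proof. by move=> k u v; rewrite /pre_act /= M_linear qcls_linear. Qed.
HB.instance Definition _ s :=
  GRing.isLinear.Build K (restr M) (quo comm_gen) _ (pre_act s) (pre_linear s).
Let pre0 s u : comm_gen u -> pre_act s u = 0.
Proof.
move=> hu; rewrite /pre_act /= -[RHS](raddf0 (cls (span comm_gen))).
apply/qclsE; rewrite subr0; apply: comm_stable; exact: mem_span.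
Qed.
Definition coinv_act (s : S) : quo comm_gen -> quo comm_gen :=
  quo_lift (pre_act s).
Lemma coinv_actE s x : coinv_act s (qcls comm_gen x) = qcls comm_gen (M_act s x).
Proof. exact: (quo_liftE (pre0 s)). Qed.
Let coinv_linear s : linear (coinv_act s).
Proof. exact: quo_lift_linear (pre0 s). Qed.
Let coinv1 q : coinv_act 1%g q = q.
Proof. by elim/qcls_ind: q => x; rewrite coinv_actE M1. Qed.
Let coinvM s t q : coinv_act (s * t)%g q = coinv_act s (coinv_act t q).
Proof. by elim/qcls_ind: q => x; rewrite !coinv_actE MM. Qed.

(* M / [A, M] as a left KS-module. *)
Definition coinv : lmodType (mon_alg K S) :=
  lrep_mod (LeftRep coinv_linear coinv1 coinvM).
End Coinvariants.

(* Main.v *)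
(* Write L for the crossed product, F(M) = M/[A, M], and P for the free
   resolution of M over L^e.

   Since KE(S) (x)_KS F(M) and L (x)_(L^e) M are naturally isomorphic (e (x) [x]
   goes to d_e (x) x, and r (x) x comes from 1 (x) [r x]), the Hochschild
   homology is the homology of KE(S) (x)_KS F(P). Separability of A makes F
   exact, so F(P) is a resolution of F(M), and it remains to see that its terms
   are flat over KS.

   On free L^e-modules, F is KS (x)_KE(S) N with N a free L-module, that is, the
   quotient of KS (x)_K N by the images of the commuting operators
   D_e : s (x) n |-> s e (x) n - s (x) e n. As D_e^3 = D_e, this is a filtered
   colimit of direct summands of KS (x)_K N, which is flat because K is a field.

   Two flat resolutions of V have the same homology after tensoring with X: for
   0 -> X' -> free -> X -> 0 exact, the homology in degree n + 1 for X is the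
   homology in degree n for X', so one can induct on n with X varying. *)

From HB Require Import structures.
From mathcomp Require Import all_boot all_algebra finmap.
From mathcomp Require Import boolp classical_sets.
From mathcomp Require Import monalg.
Require Import Defs.

Set Implicit Arguments.
Unset Strict Implicit.
Unset Printing Implicit Defensive.

Import GRing.Theory.
Local Open Scope ring_scope.

(** Coinvariants of a free bimodule are shown to be flat and not projective: making finitely many
    D_e vanish splits off a direct summand, but S may have infinitely many idempotents and the limit
    need not split. Resolutions with flat terms need not be homotopy equivalent, which is why the
    comparison shifts dimensions in X.

    The identity D_e^3 = D_e has a simple source. D_e = R_e - L_e, where R_e multiplies the KS
    factor on the right by e and L_e acts on N; these are commuting idempotents. Hence 1 - D_e^2 is
    an idempotent that kills the image of D_e and is congruent to 1 modulo it. All D_e commute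
    because idempotents of S commute.

    The shape KS (x)_KE(S) N comes from x (x) a d_s in L^e. Modulo commutators with A the
    coefficient a can be moved onto x, and d_s in the second factor is produced by the action of
    s^-1, since s^-1 . [y (x) 1] = [d_(s^-1) y (x) d_s]. What remains is the identification of a d_s
    with a d_t for s <= t, which lets an idempotent pass from the KS factor to x. *)

Definition linmap (R : pzRingType) (U V : lmodType R) (f : U -> V)
    (fP : linear f) : {linear U -> V} :=
  HB.pack f (GRing.isLinear.Build R U V _ f fP).

Lemma linmapE (R : pzRingType) (U V : lmodType R) (f : U -> V)
    (fP : linear f) x :
  linmap fP x = f x.
Proof. by []. Qed.

Lemma linear_from_additive (R : pzRingType) (U V : lmodType R) (f : U -> V) :
  {morph f : x y / x + y} -> (forall k x, f (k *: x) = k *: f x) -> linear f.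
Proof. by move=> fD fZ k x y; rewrite fD fZ. Qed.

Lemma linear_sub (R : pzRingType) (U V : lmodType R) (f g : U -> V) :
  linear f -> linear g -> linear (fun x => f x - g x).
Proof. by move=> fL gL k x y; rewrite fL gL scalerBr opprD addrACA. Qed.

Lemma additive0 (U V : zmodType) (f : U -> V) :
  (forall x y, f (x + y) = f x + f y) -> f 0 = 0.
Proof. by move=> fD; apply: (addrI (f 0)); rewrite -fD !addr0. Qed.

Lemma additiveB (U V : zmodType) (f : U -> V) :
  (forall x y, f (x + y) = f x + f y) -> forall x y, f (x - y) = f x - f y.
Proof. by move=> fD x y; apply/eqP; rewrite eq_sym subr_eq -fD subrK. Qed.

Lemma additive_eq (T : choiceType) (V U : zmodType) (f g : fs T V -> U) :
  (forall x y, f (x + y) = f x + f y) -> (forall x y, g (x + y) = g x + g y) ->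
  (forall t v, f (delta t v) = g (delta t v)) -> f =1 g.
Proof.
move=> fD gD e; elim/fs_ind => [|x y ex ey|//].
  by rewrite (additive0 fD) (additive0 gD).
by rewrite fD gD; exact: congr2 ex ey.
Qed.

Lemma fsum_linear (K : pzRingType) (T : choiceType) (V W : lmodType K)
    (F : T -> V -> W) :
  (forall t, linear (F t)) -> linear (fsum F : fs T V -> W).
Proof.
move=> FL.
have FD t v w : F t (v + w) = F t v + F t w.
  by have := FL t 1 v w; rewrite !scale1r.
have FZ t k v : F t (k *: v) = k *: F t v.
  by have := FL t k v 0; rewrite (additive0 (FD t)) !addr0.
apply: (@linear_from_additive K (fs T V) W) => [|k]; first exact: fsumD.
apply: additive_eq => [x y|x y|t v].
- by rewrite scalerDr (fsumD FD).
- by rewrite (fsumD FD) scalerDr.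
- by rewrite -deltaZ !(fsum_delta FD) FZ.
Qed.

Lemma subr_subACA (V : zmodType) (a b c d : V) : a - b - (c - d) = a - c -
    (b - d).
Proof. by rewrite !opprD !opprK addrACA. Qed.

(** This is (R - L)^3 = R - L for commuting idempotents R and L, evaluated at x: D is R - L, and a,
    b, c are R x, L x, R L x. *)
Lemma additive_cube (V : zmodType) (D : V -> V) (a b c : V) :
  (forall x y, D (x - y) = D x - D y) ->
  D a = a - c -> D b = c - b -> D c = 0 ->
  D (D (a - b)) = a - b.
Proof.
by move=> DB Da Db Dc; rewrite !(DB, Da, Db, Dc) subr0 sub0r opprK addrA subrK.
Qed.

(** * Tensor products: universal property and right exactness *)

Section TensorUniversal.
Variables (K : fieldType) (L : pzAlgType K).
Variables (X : lmodType L^c) (Y : lmodType L).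

(** A scalar in front of a generator is absorbed into the right factor, so pure tensors generate the
    tensor product already as an additive group. *)
Lemma tensor_ind (P : tensor X Y -> Prop) : P 0 ->
  (forall u v, P u -> P v -> P (u + v)) -> (forall x y, P (tens x y)) ->
  forall u, P u.
Proof.
move=> P0 PD Pt; elim/qcls_ind => f; elim/fs_ind: f => [|f g Pf Pg|[x y] k].
- by rewrite raddf0.
- by rewrite raddfD; exact: PD.
- suff -> : qcls (@tensor_rel K L X Y) (delta (x, y) (k : K^o)) =
            tens x ((pzin k : L) *: y) by [].
  by rewrite tensK /tens -qclsZ -deltaZ; congr (qcls _ (delta _ _));
    rewrite [RHS]mulr1.
Qed.

Lemma tens0l y : tens (0 : X) y = 0 :> tensor X Y.
Proof. by apply: (addrI (tens 0 y)); rewrite -tensDl !addr0. Qed.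
Lemma tens0r x : tens x (0 : Y) = 0 :> tensor X Y.
Proof. by apply: (addrI (tens x 0)); rewrite -tensDr !addr0. Qed.
Lemma tensNl (x : X) (y : Y) : tens (- x) y = - tens x y :> tensor X Y.
Proof. by apply: (addrI (tens x y)); rewrite -tensDl !subrr tens0l. Qed.
Lemma tensNr (x : X) (y : Y) : tens x (- y) = - tens x y :> tensor X Y.
Proof. by apply: (addrI (tens x y)); rewrite -tensDr !subrr tens0r. Qed.
Lemma tensBr (x : X) (y y' : Y) : tens x (y - y') = tens x y - tens x y'
    :> tensor X Y.
Proof. by rewrite tensDr tensNr. Qed.
Lemma tensBl (x x' : X) (y : Y) : tens (x - x') y = tens x y - tens x' y
    :> tensor X Y.
Proof. by rewrite tensDl tensNl. Qed.
Lemma tensKl (k : K) (x : X) (y : Y) :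
  tens ((pzin k : L^c) *: x) y = k *: tens x y :> tensor X Y.
Proof. by rewrite (tensZ (pzin k : L)) tensK. Qed.

Variables (Z : lmodType K) (phi : X -> Y -> Z).
Hypothesis phiDl : forall x x' y, phi (x + x') y = phi x y + phi x' y.
Hypothesis phiDr : forall x y y', phi x (y + y') = phi x y + phi x y'.
Hypothesis phiZ : forall (l : L) x y, phi ((l : L^c) *: x) y = phi x (l *: y).
Hypothesis phiK : forall k x y, phi x ((pzin k : L) *: y) = k *: phi x y.

Definition tensor_pre : fs (X * Y)%type K^o -> Z :=
    fs_lin (fun p => phi p.1 p.2).
HB.instance Definition _ := GRing.Linear.on tensor_pre.

Lemma tensor_pre0 u : tensor_rel u -> tensor_pre u = 0.
Proof.
have preB v w : tensor_pre (v - w) = tensor_pre v - tensor_pre w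
  by exact: raddfB.
have preE x y (k : K) : tensor_pre (delta (x, y) (k : K^o)) = k *: phi x y.
  exact: fs_lin_delta.
case=> [x x' y|x y y'|l x y|k x y]; rewrite !preB !preE ?scale1r.
- by rewrite phiDl -addrA -opprD subrr.
- by rewrite phiDr -addrA -opprD subrr.
- by rewrite phiZ subrr.
- by rewrite phiK subrr.
Qed.

Lemma tensor_univ : exists F : {linear tensor X Y -> Z},
  forall x y, F (tens x y) = phi x y.
Proof.
exists (linmap (quo_lift_linear tensor_pre0)) => x y.
rewrite linmapE /tens (quo_liftE tensor_pre0).
exact: etrans (fs_lin_delta _ _ _) (scale1r _).
Qed.
End TensorUniversal.

Section TensorFunctoriality.
Variables (K : fieldType) (L : pzAlgType K).

Section Bmap.
Variables (X X' : lmodType L^c) (Y Y' : lmodType L).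
Variables (f : {linear X -> X'}) (g : {linear Y -> Y'}).

Lemma bmap_exists : exists F : {linear tensor X Y -> tensor X' Y'},
  forall x y, F (tens x y) = tens (f x) (g y).
Proof.
apply: tensor_univ => [x x' y|x y y'|l x y|k x y].
- by rewrite raddfD tensDl.
- by rewrite raddfD tensDr.
- by rewrite !linearZ_LR tensZ.
- by rewrite linearZ_LR tensK.
Qed.
Definition bmap : {linear tensor X Y -> tensor X' Y'} := sval (cid bmap_exists).
Lemma bmapE x y : bmap (tens x y) = tens (f x) (g y).
Proof. by rewrite /bmap; case: cid => F /= ->. Qed.
End Bmap.

Definition rmap (X : lmodType L^c) (Y Y' : lmodType L) (g : {linear Y -> Y'}) :
  {linear tensor X Y -> tensor X Y'} := bmap idfun g.
Lemma rmapE (X : lmodType L^c) (Y Y' : lmodType L) (g : {linear Y -> Y'}) x y :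
  rmap X g (tens x y) = tens x (g y).
Proof. exact: bmapE. Qed.

Lemma tmap_rmap (X : lmodType L^c) (Y Y' : lmodType L) (g : {linear Y -> Y'}) :
  tmap X g =1 rmap X g.
Proof.
have tD u v : tmap X g (u + v) = tmap X g u + tmap X g v by exact: raddfD.
have t0 : tmap X g 0 = 0 by exact: raddf0.
elim/tensor_ind => [|u v eu ev|x y]; first by rewrite t0 linear0.
  by rewrite tD eu ev linearD.
rewrite rmapE /tmap /tens quo_liftE; last exact: pre_tmap0.
exact: etrans (fs_lin_delta _ _ _) (scale1r _).
Qed.

Definition lmap (X X' : lmodType L^c) (f : {linear X -> X'}) (Y : lmodType L) :
  {linear tensor X Y -> tensor X' Y} := bmap f idfun.
Lemma lmapE (X X' : lmodType L^c) (f : {linear X -> X'}) (Y : lmodType L) x y :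
  lmap f Y (tens x y) = tens (f x) y.
Proof. exact: bmapE. Qed.

Lemma lmap_rmap (X X' : lmodType L^c) (f : {linear X -> X'})
    (Y Y' : lmodType L) (g : {linear Y -> Y'}) u :
  lmap f Y' (rmap X g u) = rmap X' g (lmap f Y u).
Proof.
elim/tensor_ind: u => [|u v eu ev|x y]; first by rewrite !linear0.
  by rewrite 2!linearD eu ev 2!linearD.
by rewrite !(rmapE, lmapE).
Qed.

Lemma rmap_comp (X : lmodType L^c) (Y Y' Y'' : lmodType L)
    (g : {linear Y -> Y'}) (h : {linear Y' -> Y''}) (k : {linear Y -> Y''}) :
  (forall y, k y = h (g y)) -> forall u, rmap X k u = rmap X h (rmap X g u).
Proof.
move=> e; elim/tensor_ind => [|u v eu ev|x y]; first by rewrite !linear0.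
  by rewrite 3!linearD eu ev.
by rewrite !rmapE e.
Qed.

Lemma rmap_id (X : lmodType L^c) (Y : lmodType L) (g : {linear Y -> Y}) :
  g =1 id -> rmap X g =1 id.
Proof.
move=> e; elim/tensor_ind => [|u v eu ev|x y]; first by rewrite linear0.
  by rewrite linearD eu ev.
by rewrite !rmapE e.
Qed.

Section Surjective.
Variables (X X' : lmodType L^c) (Y Y' : lmodType L).
Variables (f : {linear X -> X'}) (g : {linear Y -> Y'}).
Hypothesis f_surj : forall x', exists x, f x = x'.
Hypothesis g_surj : forall y', exists y, g y = y'.

Lemma bmap_surj u' : exists u, bmap f g u = u'.
Proof.
elim/tensor_ind: u' => [|u v [u' <-] [v' <-]|x y].
- by exists 0; rewrite raddf0.
- by exists (u' + v'); rewrite raddfD.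
- by have [[x' <-] [y' <-]] := (f_surj x, g_surj y); exists (tens x' y');
    rewrite bmapE.
Qed.

(* The inverse of (X (x) Y)/W -> X' (x) Y' sends x' (x) y' to the class of a
   tensor of lifts. *)
Lemma bmap_ker (W : tensor X Y -> Prop) : is_submod W ->
  (forall x y, f x = 0 -> W (tens x y)) ->
  (forall x y, g y = 0 -> W (tens x y)) ->
  forall u, bmap f g u = 0 -> W u.
Proof.
move=> sW Wf Wg.
have WE v : W v <-> v \in span W.
  split; first exact: mem_span.
  exact: span_min.
pose lx x' := sval (cid (f_surj x')); pose ly y' := sval (cid (g_surj y')).
have lxE x' : f (lx x') = x' := svalP (cid (f_surj x')).
have lyE y' : g (ly y') = y' := svalP (cid (g_surj y')).
pose phi x' y' : quo W := qcls W (tens (lx x') (ly y')).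
have phiE x y : phi (f x) (g y) = qcls W (tens x y).
  apply/qclsE/WE.
  have -> : tens (lx (f x)) (ly (g y)) - tens x y =
    1 *: tens (lx (f x) - x) (ly (g y)) + tens x (ly (g y) - y) :> tensor X Y.
    by rewrite tensBl tensBr scale1r addrA subrK.
  by apply: sW.2; [apply: Wf|apply: Wg]; rewrite linearB ?lxE ?lyE subrr.
have [|||k x' y'|F FE] := @tensor_univ K L X' Y' (quo W) phi.
- move=> x x' y; rewrite -(lxE x) -(lxE x') -(lyE y) -raddfD !phiE.
  by rewrite -raddfD tensDl.
- move=> x y y'; rewrite -(lxE x) -(lyE y) -(lyE y') -raddfD !phiE.
  by rewrite -raddfD tensDr.
- move=> l x y; rewrite -(lxE x) -(lyE y) -!linearZ_LR !phiE.
  by rewrite tensZ.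
- by rewrite -(lxE x') -(lyE y') -linearZ_LR !phiE tensK qclsZ.
have FbE v : F (bmap f g v) = qcls W v.
  elim/tensor_ind: v => [|u v eu ev|x y]; first by rewrite !raddf0.
    by rewrite linearD linearD eu ev raddfD.
  by rewrite bmapE FE phiE.
move=> u u0; apply/WE; have := FbE u; rewrite u0 raddf0 => /esym.
by rewrite -[X in _ = X -> _](raddf0 (qcls W)) => /qclsE; rewrite subr0.
Qed.
End Surjective.

Lemma rmap_surj (X : lmodType L^c) (Y Y' : lmodType L) (g : {linear Y -> Y'}) :
  (forall y', exists y, g y = y') -> forall u', exists u, rmap X g u = u'.
Proof.
move=> gs; apply: bmap_surj => // x; by exists x.
Qed.

Lemma lmap_surj (X X' : lmodType L^c) (f : {linear X -> X'}) (Y : lmodType L) :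
  (forall x', exists x, f x = x') -> forall u', exists u, lmap f Y u = u'.
Proof. by move=> fs; apply: bmap_surj => // y; exists y. Qed.

(** W is left arbitrary for two uses: the image of another map gives right exactness, and the
    tensors killed by some operator give the kernel argument in [flat_quotient]. *)
Lemma rmap_ker (X : lmodType L^c) (Y Y' : lmodType L) (g : {linear Y -> Y'})
    (W : tensor X Y -> Prop) :
  (forall y', exists y, g y = y') -> is_submod W ->
  (forall x y, g y = 0 -> W (tens x y)) ->
  forall u, rmap X g u = 0 -> W u.
Proof.
move=> gs sW Wg u; apply: (bmap_ker _ gs) => //.
  by move=> x; exists x.
by move=> x y /= ->; rewrite tens0l; exact: sW.1.
Qed.

Lemma lmap_ker (X X' : lmodType L^c) (f : {linear X -> X'}) (Y : lmodType L)
    (W : tensor X Y -> Prop) :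
  (forall x', exists x, f x = x') -> is_submod W ->
  (forall x y, f x = 0 -> W (tens x y)) ->
  forall u, lmap f Y u = 0 -> W u.
Proof.
move=> fs sW Wf u; apply: (bmap_ker fs) => //; first by move=> y; exists y.
by move=> x y /= ->; rewrite tens0r; exact: sW.1.
Qed.

Lemma image_submod (U V : lmodType K) (f : {linear U -> V}) :
  is_submod (fun v => exists u, v = f u).
Proof.
split; first by exists 0; rewrite raddf0.
by move=> k _ _ [u ->] [v ->]; exists (k *: u + v); rewrite linearP.
Qed.

Lemma rmap_exact (X : lmodType L^c) (Y' Y Y'' : lmodType L)
    (f : {linear Y' -> Y}) (g : {linear Y -> Y''}) :
  (forall y'', exists y, g y = y'') ->
  (forall y, g y = 0 -> exists y', y = f y') ->
  forall u, rmap X g u = 0 -> exists v, u = rmap X f v.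
Proof.
move=> gs ex; apply: rmap_ker => //; first exact: image_submod.
by move=> x y /ex[y' ->]; exists (tens x y'); rewrite rmapE.
Qed.

Lemma lmap_exact (X' X X'' : lmodType L^c) (Y : lmodType L)
    (f : {linear X' -> X}) (g : {linear X -> X''}) :
  (forall x'', exists x, g x = x'') ->
  (forall x, g x = 0 -> exists x', x = f x') ->
  forall u, lmap g Y u = 0 -> exists v, u = lmap f Y v.
Proof.
move=> gs ex; apply: lmap_ker => //; first exact: image_submod.
by move=> x y /ex[x' ->]; exists (tens x' y); rewrite lmapE.
Qed.
End TensorFunctoriality.

(** * Homology and linear relations *)

Definition isom (K : pzRingType) (U W : lmodType K) :=
  exists f : {linear U -> W}, bijective f.

Section Isom.
Variable K : pzRingType.
Implicit Types U V W : lmodType K.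

(* A linear relation that is total on both sides and relates 0 only to 0 is the
   graph of an isomorphism. *)
Lemma isom_of_relation U W (R : U -> W -> Prop) :
  (forall k u u' w w', R u w -> R u' w' -> R (k *: u + u') (k *: w + w')) ->
  (forall u, exists w, R u w) -> (forall w, exists u, R u w) ->
  (forall u w, R u w -> u = 0 <-> w = 0) -> isom U W.
Proof.
move=> Rlin Rl Rr R0.
have Rfun u w w' : R u w -> R u w' -> w = w'.
  move=> r r'; have := Rlin (-1) _ _ _ _ r r'; rewrite !scaleN1r addNr.
  by move=> /R0[/(_ erefl) e _]; apply/eqP; rewrite eq_sym -subr_eq0 addrC e.
have Rinj u u' w : R u w -> R u' w -> u = u'.
  move=> r r'; have := Rlin (-1) _ _ _ _ r r'; rewrite !scaleN1r addNr.
  by move=> /R0[_ /(_ erefl) e]; apply/eqP; rewrite eq_sym -subr_eq0 addrC e.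
pose f u := sval (cid (Rl u)); have fR u : R u (f u) := svalP (cid (Rl u)).
pose g w := sval (cid (Rr w)); have gR w : R (g w) w := svalP (cid (Rr w)).
have fP : linear f by move=> k u v; apply: Rfun (fR _) _; exact: Rlin.
exists (linmap fP), g => x; first exact: Rinj (gR _) (fR _).
exact: Rfun (fR _) (gR _).
Qed.

Lemma isom_sym U W : isom U W -> isom W U.
Proof.
case=> f [g fK gK]; apply: (@isom_of_relation _ _ (fun w u => f u = w)).
- by move=> k w w' u u' <- <-; rewrite linearP.
- by move=> w; exists (g w).
- by move=> u; exists (f u).
- move=> w u <-; split=> [e|->]; last exact: linear0.
  by rewrite -(fK u) e -(fK 0) linear0.
Qed.

Lemma isom_trans U V W : isom U V -> isom V W -> isom U W.
Proof.
case=> f [f' fK f'K] [g [g' gK g'K]]; exists (g \o f).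
by exists (f' \o g') => x /=; rewrite ?gK ?fK ?f'K ?g'K.
Qed.
End Isom.

Section HomologyIsom.
Variables (K : pzRingType) (C C' : nat -> lmodType K).
Variables (d : forall n, {linear C n.+1 -> C n}).
Variables (d' : forall n, {linear C' n.+1 -> C' n}).
Variables (n n' : nat) (R : C n -> C' n' -> Prop).

(** A relation replaces a chain map because connecting maps and passages between resolutions go
    through choices of lifts. The last hypothesis, read in both directions, makes the induced
    relation on classes single valued and injective. *)
Lemma homology_isom :
  (forall k u u' w w', R u w -> R u' w' -> R (k *: u + u') (k *: w + w')) ->
  (forall z, z \in @cycle K C d n -> exists2 z', z' \in @cycle K C' d' n' & R z
    z') ->
  (forall z', z' \in @cycle K C' d' n' -> exists2 z,
    z \in @cycle K C d n & R z z') ->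
  (forall z z', z \in @cycle K C d n -> z' \in @cycle K C' d' n' -> R z z' ->
     (exists w, z = d n w) <-> (exists w, z' = d' n' w)) ->
  isom (homology d n) (homology d' n').
Proof.
move=> Rlin Rl Rr RB.
(* Homology divides by the span of the boundaries; these already form a submodule, so a class
   vanishes only if its representative is itself a boundary. *)
have bP (D : nat -> lmodType K) (e : forall m, {linear D m.+1 -> D m}) m
    (z : subm (@cycle K D e m)) : qcls _ z = 0 :> homology e m <->
    exists w, val z = e m w.
  split=> [|h]; last first.
    by rewrite -(raddf0 (qcls _)); apply/qclsE; rewrite subr0; exact: mem_span.
  rewrite -[X in _ = X -> _](raddf0 (qcls _)) => /qclsE; rewrite subr0.
  apply: (span_min (W := fun z => exists w, val z = e m w)) => //.
  split; first by exists 0; rewrite raddf0 linear0.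
  move=> k u v [a ea] [b eb]; exists (k *: a + b).
  by rewrite linearP -ea -eb.
pose Q (q : homology d n) (q' : homology d' n') :=
  exists (z : subm (@cycle K C d n)) (z' : subm (@cycle K C' d' n')),
    [/\ q = qcls _ z, q' = qcls _ z' & R (val z) (val z')].
apply: (@isom_of_relation _ _ _ Q).
- move=> k _ _ _ _ [z [z' [-> -> r]]] [t [t' [-> -> s]]].
  by exists (k *: z + t), (k *: z' + t'); split;
    [by rewrite linearP|by rewrite linearP|exact: Rlin].
- elim/qcls_ind => z; have [z' c r] := Rl _ (valP z).
  by exists (qcls _ (Sub z' c : subm (@cycle K C' d' n'))), z, (Sub z' c).
- elim/qcls_ind => z'; have [z c r] := Rr _ (valP z').
  by exists (qcls _ (Sub z c : subm (@cycle K C d n))), (Sub z c), z'.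
- move=> _ _ [z [z' [-> -> r]]]; split=> /bP h; apply/bP.
    exact/(RB _ _ (valP z) (valP z') r).
  exact/(RB _ _ (valP z) (valP z') r).
Qed.
End HomologyIsom.

Lemma restr_map_linear (K : pzRingType) (L : pzAlgType K) (Y Z : lmodType L)
    (g : {linear Y -> Z}) : linear (fun y : restr Y => g y : restr Z).
Proof. by move=> k x y; rewrite !restrE linearP. Qed.
Definition restr_map (K : pzRingType) (L : pzAlgType K) (Y Z : lmodType L)
  (g : {linear Y -> Z}) : {linear restr Y -> restr Z} :=
  linmap (restr_map_linear g).

(** * Free and flat modules *)

Section FreeTensor.
Variables (K : fieldType) (L : pzAlgType K) (T : choiceType).

Section Right.
Variable Y : lmodType L.
Let F : lmodType L^c := fs T (L^c)^o.

(** Together with [free_right_decomp], the maps c, one for each t, identify F (x)_L Y with a direct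
    sum of copies of Y indexed by T. L need not be commutative, so the tensor product is only a
    K-space and the coordinates take values in [restr Y]. *)
Lemma free_right_coord t : exists c : {linear tensor F Y -> restr Y},
  forall f y, c (tens f y) = ((f : fs T (L^c)^o)@_t : L) *: y.
Proof.
apply: (tensor_univ (phi := fun (f : F) (y : Y) =>
  (((f : fs T (L^c)^o)@_t : L) *: y : restr Y))) => [f f' y|f y y'|l f y|k f y].
- rewrite mcoeffD; exact: (@scalerDl L Y y (f@_t : L) (f'@_t : L)).
- exact: (@scalerDr L Y).
- by rewrite fs_scaleE scalerA.
- by rewrite restrE !scalerA pzinC.
Qed.

Lemma free_right_decomp (u : tensor F Y) :
  exists g : fs T Y, u = fsum (fun t y => tens (delta t (1 : (L^c)^o) : F) y) g.
Proof.
have tD t y y' : tens (delta t (1 : (L^c)^o) : F) (y + y') =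
    tens (delta t (1 : (L^c)^o) : F) y + tens (delta t (1 : (L^c)^o) : F) y'
    :> tensor F Y by exact: tensDr.
elim/tensor_ind: u => [|u v [g ->] [h ->]|f y].
- by exists 0; rewrite fsum0.
- by exists (g + h); rewrite fsumD.
elim/fs_ind: f => [|f f' [g e] [g' e']|t l].
- by exists 0; rewrite fsum0 tens0l.
- by exists (g + g'); rewrite tensDl e e' fsumD.
- exists (delta t ((l : L) *: y)); rewrite (fsum_delta tD).
  have -> : delta t l = (l : L^c) *: (delta t (1 : (L^c)^o) : F).
    by rewrite -deltaZ; congr delta; exact: esym (@mulr1 L^c l).
  exact: (tensZ (l : L)).
Qed.

Lemma free_right_coordE t (c : {linear tensor F Y -> restr Y}) :
  (forall f y, c (tens f y) = ((f : fs T (L^c)^o)@_t : L) *: y) ->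
  forall h, c (fsum (fun t y => tens (delta t (1 : (L^c)^o) : F) y) h) = h@_t.
Proof.
move=> cE; have tD s y y' : tens (delta s (1 : (L^c)^o) : F) (y + y') =
    tens (delta s (1 : (L^c)^o) : F) y + tens (delta s (1 : (L^c)^o) : F) y'
    :> tensor F Y by exact: tensDr.
elim/fs_ind => [|f g ef eg|s y].
- by rewrite fsum0 linear0 mcoeff0.
- rewrite (fsumD tD) linearD mcoeffD; exact: (congr2 +%R ef eg).
- rewrite (fsum_delta tD) cE !mcoeffU; case: eqP => _.
    exact: (@scale1r L Y).
  exact: (@scale0r L Y).
Qed.
End Right.

Lemma free_right_exact (Y' Y Y'' : lmodType L) (f : {linear Y' -> Y})
    (g : {linear Y -> Y''}) :
  (forall y, g y = 0 -> exists y', y = f y') ->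
  forall u : tensor (fs T (L^c)^o : lmodType L^c) Y,
    rmap _ g u = 0 -> exists v, u = rmap _ f v.
Proof.
move=> ex u; have [h uE] := free_right_decomp u => e0.
have gh t : g h@_t = 0.
  have [c cE] := free_right_coord Y t; have [c' cE'] := free_right_coord Y'' t.
  have nat v : c' (rmap _ g v) = restr_map g (c v).
    elim/tensor_ind: v => [|v w ev ew|x y].
    - by rewrite !linear0.
    - rewrite !linearD; exact: (congr2 +%R ev ew).
    - by rewrite rmapE cE cE'; exact: esym (linearZ_LR g _ _).
  have := nat u; rewrite e0 linear0 uE (free_right_coordE cE); exact: esym.
(* Preimages are chosen for every t, even where h vanishes, and may be nonzero there; the sum below
   therefore runs over the support of h. *)
pose k t := sval (cid (ex _ (gh t)));
  have kE t : h@_t = f (k t) := svalP (cid (ex _ (gh t))).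
exists (\sum_(t <- msupp h) tens (delta t (1 : (L^c)^o) : fs T (L^c)^o) (k t)).
rewrite uE [RHS]linear_sum; apply: eq_bigr => t _; rewrite [RHS]rmapE.
exact: congr1 (kE t).
Qed.

Section Left.
Variable X : lmodType L^c.
Let F : lmodType L := fs T L^o.

Lemma free_left_coord t : exists c : {linear tensor X F -> restr X},
  forall x f, c (tens x f) = ((f : fs T L^o)@_t : L^c) *: x.
Proof.
apply: (tensor_univ (phi := fun (x : X) (f : F) =>
  (((f : fs T L^o)@_t : L^c) *: x : restr X))) => [x x' f|x f f'|l x f|k x f].
- exact: (@scalerDr L^c X).
- rewrite mcoeffD; exact: (@scalerDl L^c X x (f@_t : L^c) (f'@_t : L^c)).
- by rewrite fs_scaleE scalerA.
- by rewrite fs_scaleE restrE scalerA; congr (_ *: x);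
    exact: (@pzinC K L k (f@_t)).
Qed.

Lemma free_left_decomp (u : tensor X F) :
  exists g : fs T X, u = fsum (fun t x => tens x (delta t (1 : L^o) : F)) g.
Proof.
have tD t x x' : tens (x + x') (delta t (1 : L^o) : F) =
    tens x (delta t (1 : L^o) : F) + tens x' (delta t (1 : L^o) : F)
    :> tensor X F by exact: tensDl.
elim/tensor_ind: u => [|u v [g ->] [h ->]|x f].
- by exists 0; rewrite fsum0.
- by exists (g + h); rewrite fsumD.
elim/fs_ind: f => [|f f' [g e] [g' e']|t l].
- by exists 0; rewrite fsum0 tens0r.
- by exists (g + g'); rewrite tensDr e e' fsumD.
- exists (delta t ((l : L^c) *: x)); rewrite (fsum_delta tD).
  have -> : delta t l = (l : L) *: (delta t (1 : L^o) : F).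
    by rewrite -deltaZ; congr delta; exact: esym (@mulr1 L l).
  exact: esym (tensZ (l : L) _ _).
Qed.

Lemma free_left_coordE t (c : {linear tensor X F -> restr X}) :
  (forall x f, c (tens x f) = ((f : fs T L^o)@_t : L^c) *: x) ->
  forall h, c (fsum (fun t x => tens x (delta t (1 : L^o) : F)) h) = h@_t.
Proof.
move=> cE; have tD s x x' : tens (x + x') (delta s (1 : L^o) : F) =
    tens x (delta s (1 : L^o) : F) + tens x' (delta s (1 : L^o) : F)
    :> tensor X F by exact: tensDl.
elim/fs_ind => [|f g ef eg|s y].
- by rewrite fsum0 linear0 mcoeff0.
- rewrite (fsumD tD) linearD mcoeffD; exact: (congr2 +%R ef eg).
- rewrite (fsum_delta tD) cE !mcoeffU; case: eqP => _.
    exact: (@scale1r L^c X).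
  exact: (@scale0r L^c X).
Qed.
End Left.
End FreeTensor.

Definition flat (K : fieldType) (L : pzAlgType K) (V : lmodType L) :=
  forall (X' X : lmodType L^c) (i : {linear X' -> X}),
    (forall x, i x = 0 -> x = 0) -> forall u, lmap i V u = 0 -> u = 0.

Lemma free_flat (K : fieldType) (L : pzAlgType K) (T : choiceType) :
  flat (fs T L^o : lmodType L).
Proof.
move=> X' X i i0 u; have [h uE] := free_left_decomp u => e0.
rewrite uE /fsum; apply: big1_seq => t /andP[_ ht].
suff -> : h@_t = 0 by rewrite tens0l.
apply: i0; have [c cE] := free_left_coord X' t.
have [c' cE'] := free_left_coord X t.
have nat v : c' (lmap i _ v) = restr_map i (c v).
  elim/tensor_ind: v => [|v w ev ew|x y].
  - by rewrite !linear0.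
    - rewrite !linearD; exact: (congr2 +%R ev ew).
    - by rewrite lmapE cE cE'; exact: esym (linearZ_LR i _ _).
have := nat u; rewrite e0 linear0 uE (free_left_coordE cE); exact: esym.
Qed.

(** * Flat resolutions compute Tor *)

Section Comparison.
Variables (K : fieldType) (L : pzAlgType K).

Record flat_resolution (V : lmodType L) := FlatResolution {
  rmod : nat -> lmodType L;
  rdiff : forall n, {linear rmod n.+1 -> rmod n};
  raug : {linear rmod 0 -> V};
  raug_surj : forall v, exists x, raug x = v;
  raug_exact : forall x, raug x = 0 <-> exists y, x = rdiff 0 y;
  rdiff_exact : forall n x, rdiff n x = 0 <-> exists y, x = rdiff n.+1 y;
  rmod_flat : forall n, flat (rmod n)
}.

Definition res_flat_resolution (V : lmodType L) : flat_resolution V.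
Proof.
apply: (@FlatResolution V (res V) (@res_d L V) (@eps L V)).
- by move=> v; exists (delta v 1); exact: eps_delta.
- by move=> x; exact: res_stepP.
- by move=> n x; exact: res_exact.
- by move=> n; exact: free_flat.
Defined.

Definition tor_diff (X : lmodType L^c) V (C : flat_resolution V) n :
  {linear tensor X (rmod C n.+1) -> tensor X (rmod C n)} := rmap X (rdiff C n).

Definition tor (X : lmodType L^c) V (C : flat_resolution V) n :=
  homology (tor_diff X C) n.

Section Complex.
Variables (V : lmodType L) (C : flat_resolution V).

Lemma tor_diff_diff X n u : tor_diff X C n (tor_diff X C n.+1 u) = 0.
Proof.
rewrite /tor_diff; elim/tensor_ind: u => [|u v eu ev|x y];
  first by rewrite !linear0.
  by rewrite !linearD; exact: etrans (congr2 +%R eu ev) (addr0 _).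
rewrite !rmapE (_ : rdiff C n (rdiff C n.+1 y) = 0) ?tens0r //.
by apply/rdiff_exact; exists y.
Qed.

Lemma tor_aug_diff X u : rmap X (raug C) (tor_diff X C 0 u) = 0.
Proof.
rewrite /tor_diff; elim/tensor_ind: u => [|u v eu ev|x y];
  first by rewrite !linear0.
  by rewrite !linearD; exact: etrans (congr2 +%R eu ev) (addr0 _).
rewrite !rmapE (_ : raug C (rdiff C 0 y) = 0) ?tens0r //.
by apply/raug_exact; exists y.
Qed.

Lemma tor_aug_surj X v : exists u, rmap X (raug C) u = v.
Proof. exact: rmap_surj (@raug_surj _ C) v. Qed.

Lemma tor_aug_exact X u : rmap X (raug C) u = 0 -> exists v,
    u = tor_diff X C 0 v.
Proof.
by apply: rmap_exact => [v|y /raug_exact //]; exact: raug_surj.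
Qed.

Lemma tor_free_exact (T : choiceType) n u :
  tor_diff (fs T (L^c)^o : lmodType L^c) C n u = 0 -> exists v,
    u = tor_diff _ C n.+1 v.
Proof. by apply: free_right_exact => y /rdiff_exact. Qed.
End Complex.

Section ShortExact.
Variables (X X' : lmodType L^c) (T : choiceType).
Let F : lmodType L^c := fs T (L^c)^o.
Variables (i : {linear X' -> F}) (p : {linear F -> X}).
Hypothesis i0 : forall x, i x = 0 -> x = 0.
Hypothesis p_surj : forall x, exists y, p y = x.
Hypothesis p_exact : forall y, p y = 0 <-> exists x, y = i x.

Lemma lmap_pi Y u : lmap p Y (lmap i Y u) = 0.
Proof.
elim/tensor_ind: u => [|u v eu ev|x y]; first by rewrite !linear0.
  by rewrite !linearD; exact: etrans (congr2 +%R eu ev) (addr0 _).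
rewrite !lmapE (_ : p (i x) = 0) ?tens0l //.
by apply/p_exact; exists x.
Qed.

Lemma lmap_p_exact Y u : lmap p Y u = 0 -> exists v, u = lmap i Y v.
Proof. by apply: lmap_exact => // y /p_exact. Qed.

Lemma lmap_p_surj Y u : exists v, lmap p Y v = u.
Proof. exact: lmap_surj. Qed.

Section Shift.
Variables (V : lmodType L) (C : flat_resolution V).
Local Notation pC n := (lmap p (rmod C n)).
Local Notation iC n := (lmap i (rmod C n)).
Local Notation d Y n := (tor_diff Y C n).

Lemma iC0 n u : iC n u = 0 -> u = 0.
Proof. exact: (@rmod_flat _ C n X' F i i0). Qed.

Lemma pC_diff n u : pC n (d F n u) = d X n (pC n.+1 u).
Proof. exact: lmap_rmap. Qed.

Lemma iC_diff n u : iC n (d X' n u) = d F n (iC n.+1 u).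
Proof. exact: lmap_rmap. Qed.

(* The connecting map of 0 -> X' (x) C -> F (x) C -> X (x) C -> 0, exact because
   C is flat; F (x) C is acyclic because F is free. *)
Lemma tor_shift n : isom (tor X C n.+2) (tor X' C n.+1).
Proof.
apply: (homology_isom (R := fun z z' =>
  exists2 y, pC n.+2 y = z & d F n.+1 y = iC n.+1 z')).
- move=> k _ _ z' w' [y <- e] [y' <- e'].
  by exists (k *: y + y'); rewrite !linearP // e e'.
- move=> z; rewrite unfold_in => /eqP dz.
  have [y py] := lmap_p_surj z.
  have [z' dy] : exists z', d F n.+1 y = iC n.+1 z'.
    by apply: lmap_p_exact; rewrite pC_diff py.
  exists z'; last by exists y.
  rewrite unfold_in; apply/eqP/iC0.
  by rewrite iC_diff -dy tor_diff_diff.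
- move=> z'; rewrite unfold_in => /eqP dz'.
  have [y dy] : exists y, iC n.+1 z' = d F n.+1 y.
    by apply: tor_free_exact; rewrite -iC_diff dz' linear0.
  exists (pC n.+2 y); last by exists y.
  by rewrite unfold_in; apply/eqP; rewrite -pC_diff -dy lmap_pi.
- move=> z z' _ _ [y <- dy]; split=> [[w zw]|[u zu]].
    have [v pv] := lmap_p_surj w.
    have [u yu] : exists u, y - d F n.+2 v = iC n.+2 u.
      by apply: lmap_p_exact; rewrite linearB zw pC_diff pv subrr.
    exists u; apply/eqP; rewrite -subr_eq0; apply/eqP/iC0.
    by rewrite linearB iC_diff -yu linearB -dy tor_diff_diff subr0 subrr.
  have [v yv] : exists v, y - iC n.+2 u = d F n.+2 v.
    by apply: tor_free_exact; rewrite linearB dy zu iC_diff subrr.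
  exists (pC n.+3 v); rewrite -pC_diff -yv linearB.
  by rewrite lmap_pi subr0.
Qed.
End Shift.

Section One.
Variables (V : lmodType L) (C C' : flat_resolution V).

(* Both first homologies are the kernel of X' (x) V -> F (x) V: here z in
   X (x) C_1 represents the element v of that kernel. *)
Definition tor1_rep (D : flat_resolution V) (z : tensor X (rmod D 1))
    (v : tensor X' V) :=
  exists y u, [/\ lmap p _ y = z, tor_diff F D 0 y = lmap i _ u
                & rmap X' (raug D) u = v].

Lemma tor1_rep_lin D k z z' v v' : @tor1_rep D z v -> tor1_rep z' v' ->
  tor1_rep (k *: z + z') (k *: v + v').
Proof.
move=> [y [u [<- e <-]]] [y' [u' [<- e' <-]]].
exists (k *: y + y'), (k *: u + u').
by split; rewrite !linearP // e e'.
Qed.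

Lemma tor1_rep_total D z : tor_diff X D 0 z = 0 ->
  exists2 v, @tor1_rep D z v & lmap i V v = 0.
Proof.
move=> dz; have [y py] := lmap_p_surj z.
have [u dy] : exists u, tor_diff F D 0 y = lmap i _ u.
  by apply: lmap_p_exact; rewrite pC_diff py.
exists (rmap X' (raug D) u); first by exists y, u.
by rewrite lmap_rmap -dy tor_aug_diff.
Qed.

Lemma tor1_rep_onto D v : lmap i V v = 0 ->
  exists2 z, @tor1_rep D z v & tor_diff X D 0 z = 0.
Proof.
move=> iv; have [u uv] := tor_aug_surj D v.
have [y dy] : exists y, lmap i _ u = tor_diff F D 0 y.
  by apply: tor_aug_exact; rewrite -lmap_rmap uv.
exists (lmap p _ y); first by exists y, u.
by rewrite -pC_diff -dy lmap_pi.
Qed.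

Lemma tor1_rep0 D z v : @tor1_rep D z v ->
  v = 0 <-> exists w, z = tor_diff X D 1 w.
Proof.
move=> [y [u [<- dy <-]]]; split=> [/tor_aug_exact[t ut]|[w zw]].
  have [v' yv] : exists v', y - lmap i _ t = tor_diff F D 1 v'.
    by apply: tor_free_exact; rewrite linearB dy ut iC_diff subrr.
  by exists (lmap p _ v'); rewrite -pC_diff -yv linearB lmap_pi subr0.
have [v' pv] := lmap_p_surj w.
have [t yt] : exists t, y - tor_diff F D 1 v' = lmap i _ t.
  by apply: lmap_p_exact; rewrite linearB zw pC_diff pv subrr.
suff -> : u = tor_diff X' D 0 t by exact: tor_aug_diff.
apply/eqP; rewrite -subr_eq0; apply/eqP/(@iC0 _ D).
by rewrite linearB iC_diff -yt linearB -dy tor_diff_diff subr0 subrr.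
Qed.

(** The shift does not reach this degree: F (x) C has homology F (x) V in degree 0, so the
    connecting map hits only the kernel of X' (x) V -> F (x) V. That kernel does not see the
    resolution, and it links the two sides. *)
Lemma tor1_isom : isom (tor X C 1) (tor X C' 1).
Proof.
apply: (homology_isom (R := fun z z' =>
  exists2 v, tor1_rep z v & tor1_rep z' v)).
- move=> k z t z' t' [v r r'] [w s s'].
  by exists (k *: v + w); exact: tor1_rep_lin.
- move=> z; rewrite unfold_in => /eqP/tor1_rep_total[v r iv].
  have [z' r' dz'] := tor1_rep_onto C' iv.
  by exists z'; [rewrite unfold_in; apply/eqP|exists v].
- move=> z; rewrite unfold_in => /eqP/tor1_rep_total[v r iv].
  have [z' r' dz'] := tor1_rep_onto C iv.
  by exists z'; [rewrite unfold_in; apply/eqP|exists v].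
- move=> z z' _ _ [v /tor1_rep0 r /tor1_rep0 r'].
  by split=> [/r/r'|/r'/r].
Qed.
End One.
End ShortExact.

(** By right exactness both sides are X (x) V, so cycles correspond when their augmentations
    agree. *)
Lemma tor0_isom X (V : lmodType L) (C C' : flat_resolution V) :
  isom (tor X C 0) (tor X C' 0).
Proof.
apply: (homology_isom (R := fun z z' => rmap X (raug C) z =
  rmap X (raug C') z')).
- by move=> k z t z' t' e e'; rewrite !linearP e e'.
- by move=> z _; have [z' e] := tor_aug_surj C' (rmap X (raug C) z); exists z'.
- by move=> z _; have [z' e] := tor_aug_surj C (rmap X (raug C') z); exists z'.
- move=> z z' _ _ e; split=> -[w ew]; apply: tor_aug_exact.
    by rewrite -e ew tor_aug_diff.
  by rewrite e ew tor_aug_diff.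
Qed.

Theorem tor_isom X (V : lmodType L) (C C' : flat_resolution V) n :
  isom (tor X C n) (tor X C' n).
Proof.
have valZ (Y : lmodType L^c) : linear (val : subm (ker (@eps L^c Y)) -> free Y).
  by move=> k x y; exact: linearP.
have i0 Y x : linmap (valZ Y) x = 0 -> x = 0 by move=> e; apply: val_inj.
have ps (Y : lmodType L^c) y : exists x, @eps L^c Y x = y.
  by exists (delta y 1); exact: eps_delta.
have pe (Y : lmodType L^c) y : @eps L^c Y y = 0 <-> exists x, y =
  linmap (valZ Y) x.
  split=> [e|[x ->]]; last exact/eqP/(valP x).
  have yk : y \in ker (@eps L^c Y) by apply/eqP.
  by exists (Sub y yk).
(* The shift starts in degree 2, hence two base cases. X is generalised because the induction
   hypothesis is used at the kernel of the free cover of X. *)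
elim: n X => [|[|n] IHn] X; first exact: tor0_isom.
  exact: (@tor1_isom X _ X _ (@eps L^c X) (i0 X) (ps X) (pe X)).
have sh := @tor_shift X _ X _ (@eps L^c X) (i0 X) (ps X) (pe X) V.
by apply: isom_trans (sh C n) _; apply: isom_trans (IHn _) _; exact: isom_sym.
Qed.
End Comparison.

(** * Flat quotients of flat modules *)

(** Over a field the image of f has a complement: A is maximal, by Zorn's lemma, among the subspaces
    meeting the image only in 0, and r is the projection along A followed by the inverse of f. *)
Lemma split_injection (K : fieldType) (U W : lmodType K) (f : {linear U -> W}) :
  (forall u, f u = 0 -> u = 0) -> exists r : {linear W -> U}, forall u,
    r (f u) = u.
Proof.
move=> f0.
pose P (Z : set W) := is_submod (fun w => w = 0 \/ Z w) /\ forall u, Z (f u) ->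
  u = 0.
have [F FP Ftot|A [[A0 AP] Amax]] := @Zorn_bigcup W P.
  split=> [|u [Z FZ /((FP _ FZ).2)]//]; split; first by left.
  move=> k u v [->|[Z FZ Zu]] [->|[Z' FZ' Zv]].
  - by left; rewrite scaler0 addr0.
  - by right; exists Z'; rewrite // scaler0 add0r.
  - have [| | |] := (FP _ FZ).1.2 k u 0; [by right|by left|by left|].
    by right; exists Z.
  - have [le|le] := Ftot _ _ FZ FZ'.
      have [| | |] := (FP _ FZ').1.2 k u v;
        [by right; exact: le|by right|by left|by right; exists Z'].
    have [| | |] := (FP _ FZ).1.2 k u v;
      [by right|by right; exact: le|by left|by right; exists Z].
pose A' w := w = 0 \/ A w.
have A'f u : A' (f u) -> u = 0 by case=> [/f0|/AP].
have decomp w : exists u, A' (w - f u).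
  apply: contrapT => nw.
  pose B : set W := fun b => exists k a, A' a /\ b = a + k *: w.
  have sub : subset A B by move=> a Aa; exists 0, a; rewrite scale0r addr0;
    split=> //; right.
  apply: (Amax B).
    split=> // BA; apply: nw; exists 0; rewrite linear0 subr0; right; apply: BA.
    by exists 1, 0; rewrite scale1r add0r; split=> //; left.
  have B0 : B 0 by exists 0, 0; rewrite scale0r addr0; split=> //; left.
  split.
    split=> [|k u v hu hv]; first by left.
    have {hu}[l [a [Aa ->]]] : B u by case: hu => [->|].
    have {hv}[m [b [Ab ->]]] : B v by case: hv => [->|].
    right; exists (k * l + m), (k *: a + b); split; first exact: A0.2.
    by rewrite scalerDr scalerDl scalerA addrACA.
  move=> u [k [a [Aa e]]].
  have [k0|k0] := eqVneq k 0; first by apply: A'f; rewrite e k0 scale0r addr0.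
  (* Here f u = a + k w with k invertible, so w already lies in A' plus the image of f. *)
  case: nw; exists (k^-1 *: u).
  suff -> : w - f (k^-1 *: u) = (- k^-1) *: a + 0 by apply: A0.2 => //; left.
  rewrite linearZ_LR e scalerDr scalerA mulVf // scale1r addr0 scaleNr.
  by rewrite opprD addrCA subrr addr0.
pose r w := sval (cid (decomp w)).
have rP w : A' (w - f (r w)) := svalP (cid (decomp w)).
have r_uniq w u : A' (w - f u) -> r w = u.
  move=> h; apply/eqP; rewrite -subr_eq0; apply/eqP/A'f.
  rewrite (_ : f _ = (-1) *: (w - f (r w)) + (w - f u));
    first exact: A0.2 (rP w) h.
  by rewrite scaleN1r opprB linearB addrA subrK.
have r_lin : linear r.
  move=> k u v; apply: r_uniq.
  rewrite (_ : _ - _ = k *: (u - f (r u)) + (v - f (r v)));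
    first exact: A0.2 (rP u) (rP v).
  by rewrite linearP scalerBr opprD addrACA.
by exists (linmap r_lin) => u; apply: r_uniq; rewrite subrr; left.
Qed.

Section FlatQuotient.
Variables (K : fieldType) (L : pzAlgType K) (V W : lmodType L).
Variables (q : {linear W -> V}) (I : Type) (D : I -> {linear W -> W}).
Hypothesis q_surj : forall v, exists w, q w = v.
Hypothesis DC : forall i j w, D i (D j w) = D j (D i w).
Hypothesis D3 : forall i w, D i (D i (D i w)) = D i w.
Hypothesis qD : forall i w, q (D i w) = 0.
Hypothesis q_ker : forall w, q w = 0 -> w \in span
    (fun z => exists i y, z = D i y).

(** The finite products of operators 1 - D_i^2 have these two properties. Only the properties are
    kept: they are stable under composition, which plays the part of filteredness of the colimit. *)
Let good (P : {linear W -> W}) :=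
  (forall w, q (P w) = q w) /\ (forall i w, P (D i w) = D i (P w)).

Let good_comp (P P' : {linear W -> W}) : good P -> good P' -> good (P' \o P).
Proof.
by move=> [qP PD] [qP' P'D]; split=> [w|i w] /=; rewrite ?qP' ?qP // PD P'D.
Qed.

(** The claim is made for P w with P any good operator so that it passes to sums: once P1 kills P u,
    the hypothesis on v is applied to P1 P in place of P. *)
Let kill w : q w = 0 -> forall P, good P -> exists2 P', good P' & P' (P w) = 0.
Proof.
pose G w := forall P, good P -> exists2 P', good P' & P' (P w) = 0.
move=> /q_ker; apply: (span_min (W := G)).
  split=> [P gP|k u v Gu Gv P gP]; first by exists P; rewrite ?linear0.
  have [P1 g1 e1] := Gu P gP; have [P2 g2 e2] := Gv _ (good_comp gP g1).
  exists (P2 \o P1); first exact: good_comp.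
  by rewrite linearP /= linearP e1 scaler0 add0r.
move=> _ [i [y ->]] P gP.
(* P (D_i y) = D_i (P y) is killed by 1 - D_i^2 since D_i^3 = D_i, and q does not see the change
   since q D_i = 0. *)
have PL : linear (fun w => w - D i (D i w)).
  by move=> k u v; rewrite 2!linearP scalerBr opprD addrACA.
exists (linmap PL); last by rewrite linmapE gP.2 D3 subrr.
split=> [z|j z]; rewrite !linmapE linearB ?qD ?subr0 //.
by congr (_ - _); rewrite (DC i j) (DC i j).
Qed.

(* W modulo the images of finitely many D_i is a direct summand of W, cut out by
   the product of the idempotents 1 - D_i^2;
     V is the filtered colimit of these. *)
Lemma flat_quotient : flat W -> flat V.
Proof.
move=> Wflat X' X i i0 u; have [w <-] := rmap_surj (X := X') q_surj u => e.
have killt z : rmap X q z = 0 -> forall P, good P ->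
    exists2 P', good P' & rmap X P' (rmap X P z) = 0.
  apply: (rmap_ker (W := fun z => forall P, good P ->
    exists2 P', good P' & rmap X P' (rmap X P z) = 0) q_surj).
    split=> [P gP|k a b Ga Gb P gP]; first by exists P; rewrite ?linear0.
    have [P1 g1 e1] := Ga P gP; have [P2 g2 e2] := Gb _ (good_comp gP g1).
    exists (P2 \o P1); first exact: good_comp.
    rewrite (rmap_comp (g := P1) (h := P2)) // !linearP e1 linear0 scaler0
      add0r.
    by rewrite -e2 (rmap_comp (g := P) (h := P1) (k := P1 \o P)).
  move=> x y qy P gP; have [P' g' e'] := kill qy gP.
  by exists P'; rewrite // !rmapE e' tens0r.
(* The image of w in X (x) W dies in X (x) V, so a good P' kills it. By flatness of W, P' already
   kills w in X' (x) W, and q P' = q. *)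
have [||P' [qP' _] e'] := killt (lmap i W w) _ idfun.
- by rewrite -lmap_rmap.
- by [].
suff e0 : rmap X' P' w = 0.
  by rewrite (rmap_comp (g := P') (h := q)) ?e0 ?linear0.
apply: (Wflat _ _ _ i0); rewrite lmap_rmap -[RHS]e'; congr (rmap X P' _).
by rewrite rmap_id.
Qed.
End FlatQuotient.

(** * Modules over a monoid algebra *)

Lemma mon_delta_pzin (K : comPzRingType) (G : monoidType) (g h : G) (k : K) :
  (delta (g * h)%g 1 : mon_alg K G) * pzin k =
  (delta g k : mon_alg K G) * (delta h 1 : mon_alg K G).
Proof. by rewrite -[pzin k]/(delta 1%g k : mon_alg K G) !mon_delta mulg1 mul1r
  mulr1. Qed.

Section MonoidModules.
Variables (K : comPzRingType) (G : monoidType).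

Lemma lrep_deltaE (W : lmodType K) (r : left_rep G W) g k (w : W) :
  (delta g k : mon_alg K G) *: (w : lrep_mod r) = (k *: r g w : W).
Proof. exact: mon_act_delta. Qed.

Lemma lrep_pzinE (W : lmodType K) (r : left_rep G W) (k : K) (w : W) :
  (pzin k : mon_alg K G) *: (w : lrep_mod r) = (k *: w : W).
Proof. by rewrite lrep_deltaE lrep1. Qed.

Lemma equivariant_linear (W W' : lmodType K) (r : left_rep G W)
    (r' : left_rep G W') (f : {linear W -> W'}) :
  (forall g w, f (r g w) = r' g (f w)) ->
  linear (fun w : lrep_mod r => f w : lrep_mod r').
Proof.
move=> fr; apply: linear_from_additive => [x y|l x]; first exact: (linearD f).
have sD (V : lmodType (mon_alg K G)) (v : V) (a b : mon_alg K G) :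
  (a + b) *: v = a *: v + b *: v by exact: scalerDl.
move: l; apply: additive_eq => [a b|a b|g k].
- by rewrite sD; exact: (linearD f).
- exact: sD.
- by rewrite !lrep_deltaE; apply: etrans (linearZ_LR f _ _) _; rewrite fr.
Qed.
End MonoidModules.

Section Translation.
Variables (K : fieldType) (G : monoidType) (N : lmodType K).

Let delta_linear g h : linear (fun n => delta (g * h)%g n : fs G N).
Proof. by move=> k x y; rewrite deltaD deltaZ. Qed.

Definition translate (g : G) : fs G N -> fs G N :=
  fsum (fun h n => delta (g * h)%g n).
Lemma translate_linear g : linear (translate g).
Proof. by apply: fsum_linear => h; exact: delta_linear. Qed.
Lemma translateD g f f' : translate g (f + f') = translate g f + translate g f'.
Proof. by apply: fsumD => h n n'; exact: deltaD. Qed.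
Lemma translate_delta g h n : translate g (delta h n) = delta (g * h)%g n.
Proof. by apply: fsum_delta => s m m'; exact: deltaD. Qed.
Lemma translate1 f : translate 1%g f = f.
Proof.
move: f; apply: additive_eq => // [|h n]; first exact: translateD.
by rewrite translate_delta mul1g.
Qed.
Lemma translateM g h f : translate (g * h)%g f = translate g (translate h f).
Proof.
move: f; apply: additive_eq => [|f f'|s n]; first exact: translateD.
  by rewrite !translateD.
by rewrite !translate_delta mulgA.
Qed.
Definition translation_rep : left_rep G (fs G N) :=
  LeftRep translate_linear translate1 translateM.

(* KG (x)_K N *)
Definition translation : lmodType (mon_alg K G) := lrep_mod translation_rep.

(** X (x)_KG (KG (x)_K N) is X (x)_K N. A K-linear retraction r of i, which need not respect KG, is
    thus enough: x (x) (s (x) n) goes to r(x s) (x) (1 (x) n), and this is balanced over KG and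
    splits [lmap i]. *)
Lemma translation_flat : flat translation.
Proof.
move=> X' X i i0.
have [r rE] := @split_injection K _ _ (restr_map i) i0.
pose act s (x : X) : X := (delta s 1 : (mon_alg K G)^c) *: x.
have actD s x y : act s (x + y) = act s x + act s y by exact: scalerDr.
have actM s t x : act t (act s x) = act (s * t)%g x.
  rewrite /act scalerA; congr (_ *: x).
  exact: etrans (mon_delta s t 1 1) (congr1 _ (mulr1 1)).
have actZ s k x : act s ((pzin k : (mon_alg K G)^c) *: x) =
  (pzin k : (mon_alg K G)^c) *: act s x.
  by rewrite /act !scalerA pzinC.
pose phi (x : X) (w : translation) : tensor X' translation :=
  fsum (fun s n => tens (r (act s x) : X') (delta 1%g n : translation)) w.
have tD (x : X') n n' : tens x (delta 1%g (n + n') : translation) =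
  tens x (delta 1%g n : translation) + tens x (delta 1%g n' : translation)
  :> tensor X' translation by rewrite deltaD; exact: tensDr.
have phiD x : {morph phi x : w w' / w + w'} by move=> w w';
  apply: fsumD => s n n'; exact: tD.
have phi_delta x s n : phi x (delta s n) = tens (r (act s x) : X')
  (delta 1%g n : translation).
  by apply: (fsum_delta (F := fun s n => tens (r (act s x) : X')
    (delta 1%g n : translation))) => t m m'; exact: tD.
clearbody phi.
have scale1D s k n : (delta s k : mon_alg K G) *: (delta 1%g n : translation) =
  delta s (k *: n).
  by rewrite (lrep_deltaE translation_rep) /= translate_delta mulg1 deltaZ.
have scaleK k n : delta 1%g (k *: n) = (pzin k : mon_alg K G) *:
  (delta 1%g n : translation).
  by rewrite scale1D.
have [||||rho rhoE] := @tensor_univ K _ X translation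
  (tensor X' translation) phi.
- move=> x x'; apply: additive_eq => [w w'|w w'|s n]; first exact: phiD.
    by rewrite 2!phiD addrACA.
  rewrite 3!phi_delta actD (linearD r); exact: tensDl.
- exact: phiD.
- move=> l x; apply: additive_eq => [w w'|w w'|s n]; first exact: phiD.
    by rewrite scalerDr phiD.
  have sDx (a b : mon_alg K G) : (a + b : (mon_alg K G)^c) *: x =
      (a : (mon_alg K G)^c) *: x + (b : (mon_alg K G)^c) *: x.
    exact: (@scalerDl (mon_alg K G)^c).
  have sDw (a b : mon_alg K G) : (a + b) *: (delta s n : translation) =
      a *: (delta s n : translation) + b *: (delta s n : translation).
    exact: scalerDl.
  move: l; apply: additive_eq => [l l'|l l'|t k].
  - by rewrite sDx 3!phi_delta actD (linearD r); exact: tensDl.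
  - by rewrite sDw phiD.
  - rewrite (lrep_deltaE translation_rep) /= translate_delta -deltaZ 2!phi_delta
      scaleK -tensZ; congr (tens _ _).
    have -> : (delta t k : (mon_alg K G)^c) *: x = (pzin k : (mon_alg K G)^c) *:
      act t x.
      by rewrite /act scalerA; congr (_ *: x);
        rewrite -[RHS]/((delta t 1 : mon_alg K G) * pzin k) mon_delta mulg1
        mul1r.
    by rewrite actZ actM; exact: (linearZ_LR r).
- move=> k x; apply: additive_eq => [w w'|w w'|s n].
  - by rewrite scalerDr phiD.
  - by rewrite phiD scalerDr.
  - by rewrite (lrep_pzinE translation_rep) -deltaZ 2!phi_delta scaleK tensK.
move=> u u0; suff <- : rho (lmap i _ u) = u by rewrite u0 linear0.
elim/tensor_ind: u {u0} => [|u v eu ev|x w]; first by rewrite !linear0.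
  by rewrite !linearD; exact: congr2 eu ev.
rewrite lmapE rhoE; move: w; apply: additive_eq => [w w'|w w'|s n];
  first exact: phiD.
  exact: tensDr.
have iact : act s (i x) = restr_map i ((delta s 1 : (mon_alg K G)^c) *: x).
  by rewrite /act -linearZ_LR.
rewrite phi_delta iact rE (tensZ (delta s 1 : mon_alg K G)); congr (tens x _).
by rewrite scale1D scale1r.
Qed.
End Translation.

(** * Enveloping algebras and crossed products *)

(** The kernel of an additive f need not be an ideal, but the elements that f kills with arbitrary
    factors on both sides form one. *)
Lemma ideal_gen_kill (A : pzRingType) (U : A -> Prop) (Z : zmodType)
    (f : A -> Z) :
  (forall x y, f (x + y) = f x + f y) ->
  (forall u, U u -> forall y z, f (y * u * z) = 0) ->
  forall a, a \in ideal_gen U -> f a = 0.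
Proof.
move=> fD fU a aU.
have f0 := additive0 fD.
have fB := additiveB fD.
suff : forall y z, f (y * a * z) = 0 by move=> /(_ 1 1); rewrite mul1r mulr1.
apply: (ideal_gen_min (J := fun a => forall y z, f (y * a * z) = 0)) aU => //.
split=> [y z|b c hb hc y z|b c hc]; first by rewrite mulr0 mul0r f0.
  by rewrite mulrBr mulrBl fB hb hc subrr.
split=> y z; first by rewrite (mulrA y b c).
by rewrite (mulrA y c b) -(mulrA _ b z).
Qed.

Section QuotientUniversal.
Variables (K : pzRingType) (A : pzAlgType K) (U : A -> Prop).

Lemma alg_quo_univ (Z : zmodType) (f : A -> Z) :
  (forall x y, f (x + y) = f x + f y) ->
  (forall u, U u -> forall y z, f (y * u * z) = 0) ->
  forall a, f (repr (acls U a : alg_quo U)) = f a.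
Proof.
move=> fD fU a; have := repr_cls (ideal_gen U) a.
move=> /(ideal_gen_kill fD fU) e.
by rewrite -[repr _ in LHS](subrK a) fD e add0r.
Qed.

Lemma aq_lmodE (X : lmodType A) (UX : forall u (x : X), U u -> u *: x = 0) a
    (x : X) :
  acls U a *: (x : aq_lmod UX) = (a *: x : X).
Proof.
apply: (alg_quo_univ (f := fun a => a *: x)) => [b c|u Uu y z];
  first exact: scalerDl.
by rewrite -!scalerA (UX u _ Uu) scaler0.
Qed.

Lemma aq_rmodE (X : lmodType A^c)
    (UX : forall u (x : X), U u -> (u : A^c) *: x = 0) (a : A) (x : X) :
  (acls U a : (alg_quo U)^c) *: (x : aq_rmod UX) = ((a : A^c) *: x : X).
Proof.
apply: (alg_quo_univ (f := fun a => (a : A^c) *: x)) => [b c|u Uu y z].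
  exact: (@scalerDl A^c).
transitivity ((z : A^c) *: ((u : A^c) *: ((y : A^c) *: x))).
  by rewrite !scalerA; congr (_ *: x); exact: esym (mulrA y u z).
by rewrite (UX u _ Uu) scaler0.
Qed.
End QuotientUniversal.

Section EnvUniversal.
Variables (K : fieldType) (R : pzAlgType K).
Local Notation MR := (mon_alg K (opair R)).

Lemma env_tensM (a b c d : R) : env_tens a b * env_tens c d = env_tens (a * c)
    (d * b).
Proof. by rewrite /env_tens -rmorphM mon_delta mulr1. Qed.

Let relE (u v w : MR) : env_rel (u - v - w) ->
  acls (@env_rel K R) u = acls (@env_rel K R) v + acls (@env_rel K R) w.
Proof.
by move=> h; rewrite -raddfD; apply/aclsE; rewrite opprD addrA;
  exact: mem_ideal_gen.
Qed.

Lemma env_tensDl (a a' b : R) : env_tens (a + a') b = env_tens a b + env_tens a'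
    b.
Proof. exact: relE (EnvDl a a' b). Qed.
Lemma env_tensDr (a b b' : R) : env_tens a (b + b') = env_tens a b + env_tens a
    b'.
Proof. exact: relE (EnvDr a b b'). Qed.

Let pzin_delta k (a b : R) : pzin k * env_tens a b =
  acls (@env_rel K R) (delta ((a, b) : opair R) (k : K)).
Proof.
rewrite /env_tens -[pzin k]/(acls (@env_rel K R) (pzin k)) -rmorphM.
by congr (acls _ _); rewrite mon_delta mul1g mulr1.
Qed.

Lemma env_tensKl k (a b : R) : env_tens (pzin k * a) b = pzin k * env_tens a b.
Proof. by rewrite pzin_delta; apply/aclsE; apply: mem_ideal_gen;
  exact: EnvZl. Qed.
Lemma env_tensKr k (a b : R) : env_tens a (pzin k * b) = pzin k * env_tens a b.
Proof. by rewrite pzin_delta; apply/aclsE; apply: mem_ideal_gen;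
  exact: EnvZr. Qed.

Lemma env_ext (Z : zmodType) (f g : env R -> Z) :
  (forall x y, f (x + y) = f x + f y) -> (forall x y, g (x + y) = g x + g y) ->
  (forall a b, f (env_tens a b) = g (env_tens a b)) -> f =1 g.
Proof.
move=> fD gD e; elim/acls_ind => z; elim/fs_ind: z => [|x y ex ey|[a b] k].
- by rewrite raddf0 (additive0 fD) (additive0 gD).
- by rewrite raddfD fD gD; exact: congr2 ex ey.
- by rewrite -pzin_delta -env_tensKl.
Qed.

Lemma env_ind (P : env R -> Prop) : P 0 -> (forall x y, P x -> P y -> P (x + y))
    ->
  (forall a b, P (env_tens a b)) -> forall x, P x.
Proof.
move=> P0 PD Pt; elim/acls_ind => z; elim/fs_ind: z => [|x y ex ey|[a b] k].
- by rewrite raddf0.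
- by rewrite raddfD; exact: PD.
- by rewrite -pzin_delta -env_tensKl.
Qed.

Lemma env_univ (Z : lmodType K) (phi : R -> R -> Z) :
  (forall a a' b, phi (a + a') b = phi a b + phi a' b) ->
  (forall a b b', phi a (b + b') = phi a b + phi a b') ->
  (forall k a b, phi (pzin k * a) b = k *: phi a b) ->
  (forall k a b, phi a (pzin k * b) = k *: phi a b) ->
  exists F : {linear restr (env R)^o -> Z}, forall a b, F (env_tens a b) =
    phi a b.
Proof.
move=> phiDl phiDr phiKl phiKr.
pose f : MR -> Z := fs_lin (fun p : opair R => phi p.1 p.2).
have fD x y : f (x + y) = f x + f y by exact: raddfD (fs_lin _) x y.
have fB x y : f (x - y) = f x - f y by exact: raddfB (fs_lin _) x y.
have fE (p : opair R) (k : K) : f (delta p k) = k *: phi p.1 p.2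
  by exact: fs_lin_delta.
clearbody f.
have f0 := additive0 fD.
have kill u : env_rel u -> forall y z, f (y * u * z) = 0.
  move=> hu y z.
  have Dl (v v' w : MR) : f ((v + v') * u * w) = f (v * u * w) + f (v' * u * w).
    by rewrite 2!mulrDl fD.
  have Dr (v w w' : MR) : f (v * u * (w + w')) = f (v * u * w) + f (v * u * w').
    by rewrite mulrDr fD.
  have l0 (w : MR) : f (0 * u * w) = 0 by rewrite !mul0r f0.
  have r0 (v : MR) : f (v * u * 0) = 0 by rewrite mulr0 f0.
  elim/fs_ind: y => [|y y' e e'|[c d] k]; first exact: l0.
    exact: etrans (Dl _ _ _) (etrans (congr2 +%R e e') (addr0 _)).
  elim/fs_ind: z => [|z z' e e'|[c' d'] k']; first exact: r0.
    exact: etrans (Dr _ _ _) (etrans (congr2 +%R e e') (addr0 _)).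
  case: hu => [a a' b|a b b'|l a b|l a b];
    rewrite !(mulrBr, mulrBl) !mon_delta !fB !fE /= ?mulr1.
  - by rewrite mulrDr mulrDl phiDl scalerDr -addrA -opprD subrr.
  - by rewrite mulrDl mulrDr phiDr scalerDr -addrA -opprD subrr.
  - rewrite (mulrA c) -(pzinC l c) -!mulrA phiKl scalerA !mulrA.
    by rewrite mulrAC subrr.
  - rewrite -(mulrA (pzin l)) (mulrA d') -(pzinC l d') -(mulrA (pzin l)) phiKr
      scalerA.
    by rewrite mulrAC subrr.
have FE u := alg_quo_univ fD kill u.
have FL : linear (fun x : restr (env R)^o => f (repr (x : env R))).
  move=> k; elim/acls_ind => x; elim/acls_ind => y.
  rewrite restrE -[_ *: _]/(acls _ (pzin k) * acls _ x) -rmorphM -raddfD !FE fD.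
  congr (_ + _); elim/fs_ind: x => [|x x' e e'|[a b] l].
  - by rewrite mulr0 f0 scaler0.
  - by rewrite mulrDr !fD e e' scalerDr.
  - by rewrite mon_delta mul1g !fE scalerA.
exists (linmap FL) => a b.
by rewrite linmapE /env_tens FE fE scale1r.
Qed.
End EnvUniversal.

Section CrossedProduct.
Variables (K : fieldType) (S : inverseMonoidType) (A : pzAlgType K).
Variable th : unital_action S A.
Local Notation one := (ua_one th).
Local Notation u := (unit_cls th).
Local Notation i := (incl th).
Implicit Types (s t e : S) (a b : A).

Lemma skew_monD s a b : skew_mon th s (a + b) = skew_mon th s a + skew_mon th s
    b.
Proof. by apply: val_inj; rewrite /= mulrDr deltaD. Qed.

Lemma inclD a b : i (a + b) = i a + i b.
Proof. by rewrite /incl skew_monD raddfD. Qed.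
Lemma inclM a b : i (a * b) = i a * i b.
Proof. by rewrite /incl -rmorphM skew_monM mul1g beta_id. Qed.
Lemma incl1 : i 1 = 1.
Proof. by rewrite -(unit_cls1 th) /unit_cls one1. Qed.

Lemma skew_mon_one s a : skew_mon th s (one s * a) = skew_mon th s a.
Proof. by apply: val_inj; rewrite /= mulrA ua_one_idem. Qed.

Lemma acls_skew_mon s a : acls (skew_rel (th := th)) (skew_mon th s a) =
    i a * u s.
Proof.
rewrite /incl /unit_cls -rmorphM skew_monM mul1g beta_id -skew_mon_one.
by rewrite ua_one_central.
Qed.

Lemma skew_decomp (f : skew th) :
  f = \sum_(s <- msupp (val f)) skew_mon th s (val f)@_s.
Proof.
apply: val_inj; rewrite raddf_sum [LHS]monalgE; apply: eq_bigr => s _ /=.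
by have /skew_predP -> := valP f.
Qed.

Lemma skew_ind (P : skew th -> Prop) : P 0 ->
    (forall x y, P x -> P y -> P (x + y)) ->
  (forall s a, P (skew_mon th s a)) -> forall f, P f.
Proof.
by move=> P0 PD Pm f; rewrite (skew_decomp f); elim/big_ind: _ => // s _;
  exact: Pm.
Qed.

Lemma crossed_ind (P : crossed th -> Prop) : P 0 ->
  (forall x y, P x -> P y -> P (x + y)) -> (forall a s, P (i a * u s)) ->
  forall x, P x.
Proof.
move=> P0 PD Pm; elim/acls_ind => f; elim/skew_ind: f => [|f g Pf Pg|s a].
- by rewrite raddf0.
- by rewrite raddfD; exact: PD.
- by rewrite acls_skew_mon.
Qed.

Lemma crossed_ext (Z : zmodType) (f g : crossed th -> Z) :
  (forall x y, f (x + y) = f x + f y) -> (forall x y, g (x + y) = g x + g y) ->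
  (forall a s, f (i a * u s) = g (i a * u s)) -> f =1 g.
Proof.
move=> fD gD e; elim/crossed_ind => [|x y ex ey|//].
  by rewrite (additive0 fD) (additive0 gD).
by rewrite fD gD ex ey.
Qed.

Lemma beta_idemE e a : (e * e = e)%g -> beta th e a = one e * a.
Proof. by move=> ee; have := beta_idem th e a; rewrite (sinv_idem ee) ee. Qed.

(** Since e <= 1, the ideal N identifies 1_e d_e with 1_e d_1: idempotents of S become central
    idempotents of A. *)
Lemma unit_idem e : (e * e = e)%g -> u e = i (one e).
Proof.
move=> ee; apply/aclsE; apply: mem_ideal_gen; exists e, 1%g, (one e); split.
- by exists e; rewrite ?mulg1.
- by exists 1; rewrite mulr1.
- by rewrite /= one1 mul1r ua_one_idem.
Qed.

Lemma incl_one_unit s : i (one s) * u s = u s.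
Proof. by rewrite -acls_skew_mon. Qed.

Lemma unit_sVs s : u s * u (sinv s) = i (one s).
Proof.
rewrite unit_clsM unit_idem ?idem_sVs // oneM.
by rewrite -[one (sinv s)]mulr1 beta_one beta1.
Qed.

(** Although N is an ideal, phi is tested only on single relations a d_(es) = a d_s, because
    multiplying such a relation by monomials on both sides yields another one of the same kind. *)
Lemma crossed_univ (Z : zmodType) (phi : S -> A -> Z) :
  (forall s a b, phi s (a + b) = phi s a + phi s b) ->
  (forall e s a, (e * e = e)%g -> one (e * s)%g * a = a ->
     phi (e * s)%g a = phi s a) ->
  exists2 F : crossed th -> Z, (forall x y, F (x + y) = F x + F y) &
    forall s a, F (i a * u s) = phi s (one s * a).
Proof.
move=> phiD phi_le.
pose f (m : skew th) : Z := fsum phi (val m).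
have fD m n : f (m + n) = f m + f n by rewrite /f raddfD fsumD.
have fE s a : f (skew_mon th s a) = phi s (one s * a) by exact: fsum_delta.
clearbody f; have f0 := additive0 fD.
have kill m : skew_rel m -> forall y z, f (y * m * z) = 0.
  move=> [s [t [a [[e ee ->] [b ab] me]]]] y z.
  have a_et : one (e * t)%g * a = a by rewrite ab mulrA ua_one_idem.
  have one_et : one (e * t)%g = one e * one t by rewrite oneM beta_idemE.
  have a_e : one e * a = a by rewrite -{1}a_et one_et !mulrA ua_one_idem
    -one_et.
  have a_t : one t * a = a.
    rewrite -{1}a_et one_et mulrA (ua_one_central th t (_ * _))
      -(mulrA (one e)).
    by rewrite ua_one_idem -one_et.
  have -> : m = skew_mon th (e * t)%g a - skew_mon th t a.
    by apply: val_inj; rewrite me /= a_et a_t.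
  elim/skew_ind: y => [|y y' e1 e2|p c]; first by rewrite !mul0r f0.
    by rewrite !mulrDl fD e1 e2 addr0.
  elim/skew_ind: z => [|y y' e1 e2|r d]; first by rewrite mulr0 f0.
    by rewrite mulrDr fD e1 e2 addr0.
  rewrite mulrBr mulrBl !skew_monM.
  rewrite (additiveB fD) !fE.
  (* Moving e across p turns it into the idempotent p e p^-1, so p e t r lies below p t r. *)
  have pe : (p * (e * t) * r = (p * e * sinv p) * (p * t * r))%g.
    rewrite !mulgA -(mulgA (p * e)%g _ p) -(mulgA p e (sinv p * p)%g)
      (idem_comm ee (idem_Vss p)).
    by rewrite !mulgA mulVs.
  have pee : (p * e * sinv p * (p * e * sinv p) = p * e * sinv p)%g.
    by have := idem_conj (sinv p) ee; rewrite sinvK.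
  set X := c * beta th p a.
  have XE g : one (g * r)%g * (X * beta th g d) = X * beta th g (one r * d).
    by rewrite mulrA ua_one_central -mulrA oneM -betaM.
  (* The two coefficients agree: both contain [beta th p a], and a = 1_e a absorbs the extra e. *)
  have <- : one (p * (e * t) * r)%g * (X * beta th (p * (e * t))%g d) =
            one (p * t * r)%g * (X * beta th (p * t)%g d).
    rewrite !XE !betaC (beta_idemE _ ee) /X -!mulrA -!betaM;
      congr (_ * beta th p _).
    by rewrite mulrA -ua_one_central a_e.
  rewrite pe phi_le ?subrr // -pe.
  by rewrite mulrA ua_one_idem.
exists (fun x => f (repr x)).
  elim/acls_ind => x; elim/acls_ind => y.
  by rewrite -raddfD !(alg_quo_univ fD kill) fD.
by move=> s a; rewrite -acls_skew_mon (alg_quo_univ fD kill) fE.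
Qed.
End CrossedProduct.

(** * Coinvariants of bimodules *)

Section Bimul.
Variables (K : fieldType) (R : pzAlgType K) (M : lmodType (env R)).
Implicit Types (a b : R) (x y : M).

Lemma bimulDl a a' x b : bimul (a + a') x b = bimul a x b + bimul a' x b.
Proof. by rewrite /bimul env_tensDl scalerDl. Qed.
Lemma bimulDr a x b b' : bimul a x (b + b') = bimul a x b + bimul a x b'.
Proof. by rewrite /bimul env_tensDr scalerDl. Qed.
Lemma bimulD a x y b : bimul a (x + y) b = bimul a x b + bimul a y b.
Proof. exact: scalerDr. Qed.
Lemma bimul0l x b : bimul 0 x b = 0.
Proof. by apply: (additive0 (f := fun a => bimul a x b)) => a a';
  exact: bimulDl. Qed.
Lemma bimul0r a x : bimul a x 0 = 0.
Proof. by apply: (additive0 (f := fun b => bimul a x b)) => b b';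
  exact: bimulDr. Qed.
Lemma bimulKl k a x b : bimul (pzin k * a) x b = (pzin k : env R) *: bimul a x
    b.
Proof. by rewrite /bimul env_tensKl scalerA. Qed.
Lemma bimulKm k a x b : bimul a ((pzin k : env R) *: x) b =
    (pzin k : env R) *: bimul a x b.
Proof. by rewrite /bimul !scalerA pzinC. Qed.
Lemma bimulKr k a x b : bimul a x (pzin k * b) = (pzin k : env R) *: bimul a x
    b.
Proof. by rewrite /bimul env_tensKr scalerA. Qed.
Lemma bimul_map (M' : lmodType (env R)) (f : {linear M -> M'}) a x b :
  f (bimul a x b) = bimul a (f x) b.
Proof. exact: linearZ_LR. Qed.

Lemma reg_rmodE a b (x : R) :
  (env_tens a b : (env R)^c) *: (x : reg_rmod R) = b * x * a.
Proof.
rewrite /env_tens (aq_rmodE (@reg_right_env K R)).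
by apply: etrans (mon_act_delta _ _ _ _) (scale1r _).
Qed.

Lemma reg_lmodE a b (x : R) :
  (env_tens a b : env R) *: (x : reg_lmod R) = a * x * b.
Proof.
rewrite /env_tens (aq_lmodE (@reg_left_env K R)).
by apply: etrans (mon_act_delta _ _ _ _) (scale1r _).
Qed.
End Bimul.

Section Coinv.
Variables (K : fieldType) (S : inverseMonoidType) (A : pzAlgType K).
Variable th : unital_action S A.
Local Notation Lam := (crossed th).
Local Notation u := (unit_cls th).
Local Notation i := (incl th).
Local Notation KS := (mon_alg K S).

Section Class.
Variable M : lmodType (env Lam).
Implicit Types x y : M.

Definition ccls (x : M) : coinv M := qcls (@comm_gen K S A th M) (x : restr M).

Lemma cclsD x y : ccls (x + y) = ccls x + ccls y.
Proof. exact: (linearD (qcls (@comm_gen K S A th M))). Qed.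
Lemma ccls0 : ccls 0 = 0.
Proof. exact: additive0 cclsD. Qed.

Lemma coinv_deltaE s k x : (delta s k : KS) *: ccls x =
  ccls ((pzin k : env Lam) *: bimul (u s) x (u (sinv s))).
Proof.
rewrite [LHS](lrep_deltaE _) /= coinv_actE.
exact: esym (linearZ_LR (qcls (@comm_gen K S A th M)) k _).
Qed.

Lemma coinv_act1E s x : (delta s 1 : KS) *: ccls x =
  ccls (bimul (u s) x (u (sinv s))).
Proof. by rewrite coinv_deltaE rmorph1 scale1r. Qed.

Lemma coinv_pzinE k x : (pzin k : KS) *: ccls x =
    ccls ((pzin k : env Lam) *: x).
Proof. by rewrite coinv_deltaE sinv1 unit_cls1 bimul1. Qed.

Lemma ccls_ind (P : coinv M -> Prop) : (forall x, P (ccls x)) -> forall v, P v.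
Proof. by move=> Px; elim/qcls_ind. Qed.

Lemma ccls_comm a x : ccls (bimul (i a) x 1) = ccls (bimul 1 x (i a)).
Proof. by apply/qclsE; apply: mem_span; exists a, x. Qed.

Lemma ccls_univ (Z : lmodType K) (f : {linear restr M -> Z}) :
  (forall a x, f (bimul (i a) x 1) = f (bimul 1 x (i a))) ->
  exists g : {linear quo (@comm_gen K S A th M) -> Z}, forall x, g (ccls x) =
    f x.
Proof.
move=> fc; have f0 z : comm_gen z -> f z = 0.
  move=> [a [x ->]]; apply: etrans (linearB f _ _) _.
  by apply/eqP; rewrite subr_eq0; apply/eqP; exact: fc.
by exists (linmap (quo_lift_linear f0)) => x; exact: quo_liftE.
Qed.
End Class.

Section Functor.
Variables (M M' : lmodType (env Lam)) (f : {linear M -> M'}).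

Lemma coinv_map_exists : exists g : {linear coinv M -> coinv M'},
  forall x, g (ccls x) = ccls (f x).
Proof.
pose q' := qcls (@comm_gen K S A th M').
have [|g gE] := @ccls_univ M (quo (@comm_gen K S A th M')) (q' \o restr_map f).
  move=> a x; apply: etrans (etrans (ccls_comm a (f x)) _).
    by congr q'; exact: bimul_map.
  by congr q'; exact: esym (bimul_map _ _ _ _).
have gD v w : g (v + w) = g v + g w by exact: linearD.
have gL : linear (g : coinv M -> coinv M').
  apply: linear_from_additive => [v w|l v]; first exact: gD.
  have sD (V : lmodType KS) (w : V) (a b : KS) : (a + b) *: w = a *: w + b *: w.
    exact: scalerDl.
  move: l; apply: additive_eq => [a b|a b|s k].
  - by rewrite sD gD.
  - exact: sD.
  - elim/ccls_ind: v => x; rewrite coinv_deltaE.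
    apply: etrans (gE _) _; rewrite gE.
    apply: etrans (esym (coinv_deltaE s k (f x))).
    by congr q'; rewrite /= linearZ_LR; congr (_ *: _); exact: bimul_map.
by exists (linmap gL) => x; exact: gE.
Qed.
Definition coinv_map : {linear coinv M -> coinv M'} :=
    sval (cid coinv_map_exists).
Lemma coinv_mapE x : coinv_map (ccls x) = ccls (f x).
Proof. by rewrite /coinv_map; case: cid => g /= ->. Qed.
End Functor.

Local Notation E := (idempotents S).
Definition idem1 : E := exist (fun e => idem e) 1%g (introT eqP (mulg1 1%g)).
Local Notation kd e := (delta (e : E) 1 : KE K S).
Implicit Types (e : E).

Lemma idem_val e : (val e * val e = val e)%g.
Proof. exact/eqP/(valP e). Qed.

Lemma KE_scaleE s k (w : KE K S) : (delta s k : KS^c) *: w =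
    (k *: KE_act s w : fs E K^o).
Proof. exact: mon_act_delta. Qed.

Lemma KE_act_delta s e (k : K) :
  KE_act s (delta e (k : K^o)) = delta (idem_conj_by s e) (k : K^o).
Proof. by rewrite /KE_act fs_lin_delta -deltaZ [_ *: _]mulr1. Qed.

Lemma KE_delta s e : (delta s 1 : KS^c) *: kd e = kd (idem_conj_by s e).
Proof. by rewrite KE_scaleE scale1r KE_act_delta. Qed.

Lemma KE_delta1 e : kd e = (delta (val e) 1 : KS^c) *: kd idem1.
Proof.
rewrite KE_delta; congr delta; apply: val_inj => /=.
by rewrite mulg1 (sinv_idem (idem_val e)) idem_val.
Qed.

Section TensorIsom.
Variable M : lmodType (env Lam).

(** d_e comes from the idempotent 1_e of A, so modulo [A, M] its copy on the right moves to the left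
    and is absorbed there. *)
Lemma coinv_idemE e (x : M) : (delta (val e) 1 : KS) *: ccls x =
    ccls (bimul (u (val e)) x 1).
Proof.
have ee := idem_val e.
rewrite coinv_act1E (sinv_idem ee) (unit_idem th ee).
have -> : bimul (i (ua_one th (val e))) x (i (ua_one th (val e))) =
          bimul 1 (bimul (i (ua_one th (val e))) x 1) (i (ua_one th (val e))).
  by rewrite bimulM !mul1r.
by rewrite -ccls_comm bimulM -inclM ua_one_idem mulr1.
Qed.

Lemma tens_idem e x :
  tens (kd e) (ccls x) = tens (kd idem1) (ccls (bimul (u (val e)) x 1))
  :> tensor (KE K S) (coinv M).
Proof. by rewrite KE_delta1 (tensZ (delta (val e) 1 : KS)) coinv_idemE. Qed.

(* s . (y a d_s) is congruent to a d_s y modulo [A, M], and 1 . s = s^-1 s in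
   KE(S). *)
Lemma tens_trace b (y : M) :
  tens (kd idem1) (ccls (bimul b y 1)) = tens (kd idem1) (ccls (bimul 1 y b))
  :> tensor (KE K S) (coinv M).
Proof.
elim/crossed_ind: b => [|b b' e e'|a s].
- by rewrite bimul0l bimul0r.
- rewrite bimulDl bimulDr.
  apply: etrans (congr1 (tens (kd idem1)) (cclsD _ _)) _.
  apply: etrans (tensDr _ _ _) (etrans (congr2 +%R e e') _).
  by apply: etrans (esym (tensDr _ _ _)) _; congr tens; exact: esym (cclsD _ _).
set v := sinv s.
have usE : i (ua_one th s) * u s = u s := incl_one_unit th s.
have c a' (x : M) : ccls (bimul (i a') x 1) = ccls (bimul 1 x (i a')) :=
  ccls_comm a' x.
(* Modulo [A, M]: a d_s y is d_s y a = 1_s d_s y a, which is d_s y a 1_s = d_s (y a d_s) d_v. The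
   factor 1_s is inserted to produce d_s d_v on the right. *)
have -> : bimul (i a * u s) y 1 = bimul (i a) (bimul (u s) y 1) 1.
  by rewrite bimulM mulr1.
rewrite c bimulM mul1r mul1r -{1}usE.
have -> : bimul (i (ua_one th s) * u s) y (i a) =
    bimul (i (ua_one th s)) (bimul (u s) y (i a)) 1.
  by rewrite bimulM mulr1.
rewrite c bimulM mul1r -unit_sVs.
have -> : bimul (u s) y (i a * (u s * u v)) =
    bimul (u s) (bimul 1 y (i a * u s)) (u v).
  by rewrite bimulM mulr1 mulrA.
rewrite -coinv_act1E -(tensZ (delta s 1 : KS)) KE_delta tens_idem.
apply: (congr1 (fun v => tens _ v)) => /=;
  rewrite mulg1 (unit_idem th (idem_Vss s)) c bimulM mul1r.
by rewrite -(unit_idem th (idem_Vss s)) -mulrA unit_clsM mulgA mulVs.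
Qed.
End TensorIsom.
End Coinv.

Lemma chain_isom (K : pzRingType) (C C' : nat -> lmodType K)
    (d : forall n, {linear C n.+1 -> C n})
      (d' : forall n, {linear C' n.+1 -> C' n})
    (F : forall n, {linear C n -> C' n}) :
  (forall n z, F n z = 0 -> z = 0) -> (forall n z', exists z, F n z = z') ->
  (forall n z, F n (d n z) = d' n (F n.+1 z)) ->
  forall n, isom (homology d n) (homology d' n).
Proof.
move=> F0 Fsurj Fd n.
have cycF z : (z \in @cycle K C d n) = (F n z \in @cycle K C' d' n).
  case: n z => [//|n] z; rewrite !unfold_in -Fd.
  by apply/eqP/eqP => [->|/F0 //]; rewrite linear0.
apply: (homology_isom (R := fun z z' => F n z = z')).
- by move=> k z w z' w' <- <-; rewrite linearP.
- by move=> z cz; exists (F n z); rewrite -?cycF.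
- by move=> z' cz; have [z e] := Fsurj _ z'; exists z; rewrite // cycF e.
- move=> z z' _ _ <-; split=> -[w e]; first by exists (F n.+1 w); rewrite e Fd.
  have [v vw] := Fsurj _ w; exists v.
  by apply/eqP; rewrite -subr_eq0; apply/eqP/F0; rewrite linearB Fd vw e subrr.
Qed.

Lemma Tor_isom_tor (K : fieldType) (L : pzAlgType K) n (X : lmodType L^c)
    (Y : lmodType L) : isom (Tor n X Y) (tor X (res_flat_resolution Y) n).
Proof.
apply: (chain_isom (F := fun n => idfun)) => // [m z'|m z]; first by exists z'.
exact: tmap_rmap.
Qed.

Lemma reg_tens_bimul (K : fieldType) (R : pzAlgType K) (M : lmodType (env R))
    (r a b : R) (x : M) :
  tens (r : reg_rmod R) (bimul a x b) = tens (b * r * a : reg_rmod R) x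
  :> tensor (reg_rmod R) M.
Proof. by rewrite /bimul -tensZ reg_rmodE. Qed.

Lemma reg_pzinE (K : fieldType) (R : pzAlgType K) k (r : R) :
  (pzin k : (env R)^c) *: (r : reg_rmod R) = pzin k * r.
Proof.
have e : (pzin k : env R) = env_tens (pzin k) 1.
  by rewrite -[pzin k in RHS]mulr1 env_tensKl -[RHS]/(pzin k * 1) mulr1.
apply: etrans (congr1 (fun c : (env R)^c => c *: (r : reg_rmod R)) e) _.
by rewrite reg_rmodE mul1r pzinC.
Qed.

(** * The natural isomorphism between KE(S) (x)_KS F(M) and L (x)_(L^e) M *)

Section Coinvariants.
Variables (K : fieldType) (S : inverseMonoidType) (A : pzAlgType K).
Variable th : unital_action S A.
Local Notation Lam := (crossed th).
Local Notation u := (unit_cls th).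
Local Notation i := (incl th).
Local Notation KS := (mon_alg K S).
Local Notation E := (idempotents S).
Local Notation kd e := (delta (e : E) 1 : KE K S).

Definition idem_units : fs E K^o -> restr Lam^o :=
  fs_lin (fun e => u (val e) : restr Lam^o).

Lemma idem_unitsD w w' : idem_units (w + w') = idem_units w + idem_units w'.
Proof. exact: linearD (fs_lin _) _ _. Qed.

Lemma idem_units_delta e (k : K) :
  idem_units (delta e (k : K^o)) = (pzin k : Lam) * u (val e).
Proof. exact: fs_lin_delta. Qed.

Lemma idem_unitsZ k w : idem_units (k *: w) = (pzin k : Lam) * idem_units w.
Proof. exact: linearZ_LR (fs_lin _) _ _. Qed.

Lemma idem_units_act s w :
  idem_units (KE_act s w) = u (sinv s) * (idem_units w : Lam) * u s.
Proof.
move: w; apply: additive_eq => [w w'|w w'|e k].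
- by rewrite -idem_unitsD; congr idem_units; exact: linearD (fs_lin _) _ _.
- by rewrite idem_unitsD mulrDr mulrDl.
- by rewrite KE_act_delta !idem_units_delta mulrA -pzinC -!mulrA !unit_clsM
    !mulgA.
Qed.

(** This lets [forward] pass to M/[A, M]; it holds because d_e is the central idempotent 1_e of
    A. *)
Lemma idem_units_central a w : i a * (idem_units w : Lam) =
    (idem_units w : Lam) * i a.
Proof.
move: w; apply: additive_eq => [w w'|w w'|e k].
- by rewrite idem_unitsD mulrDr.
- by rewrite idem_unitsD mulrDl.
- rewrite idem_units_delta (unit_idem th (idem_val e)) mulrA -pzinC -!mulrA.
  by rewrite -!inclM ua_one_central.
Qed.

Section Forward.
Variable M : lmodType (env Lam).

Lemma forward_pre (w : KE K S) :
  exists g : {linear quo (@comm_gen K S A th M) -> tensor (reg_rmod Lam) M},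
  forall x, g (ccls x) = tens (idem_units w : reg_rmod Lam) x.
Proof.
have fL : linear (fun x : restr M => tens (idem_units w : reg_rmod Lam)
  (x : M) : tensor (reg_rmod Lam) M).
  by move=> k x y; rewrite restrE tensDr tensK.
apply: (ccls_univ (f := linmap fL)) => a x.
apply: etrans (reg_tens_bimul _ _ _ _) _.
apply: etrans (esym (reg_tens_bimul _ _ _ _)).
by rewrite mul1r mulr1 idem_units_central.
Qed.

Lemma forward_exists :
  exists F : {linear tensor (KE K S) (coinv M) -> tensor (reg_rmod Lam) M},
  forall w x, F (tens w (ccls x)) = tens (idem_units w : reg_rmod Lam) x.
Proof.
pose phi w (v : coinv M) := sval (cid (forward_pre w)) v.
have phiE w x : phi w (ccls x) = tens (idem_units w : reg_rmod Lam) x.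
  exact: svalP (cid (forward_pre w)) x.
have phiDr w v v' : phi w (v + v') = phi w v + phi w v' by exact: linearD.
clearbody phi.
have [||l w v|k w v|F FE] := @tensor_univ K _ _ _ _ phi.
- move=> w w' v; elim/ccls_ind: v => x; rewrite !phiE idem_unitsD;
    exact: tensDl.
- exact: phiDr.
- elim/ccls_ind: v => x.
  have sDw (a b : KS) : (a + b : KS^c) *: w = (a : KS^c) *: w + (b : KS^c) *: w.
    exact: (@scalerDl KS^c).
  have sDv (a b : KS) : (a + b) *: ccls x = a *: ccls x + b *: ccls x.
    exact: scalerDl.
  have phiDl w1 w2 : phi (w1 + w2) (ccls x) = phi w1 (ccls x) + phi w2 (ccls x).
    by rewrite !phiE idem_unitsD; exact: tensDl.
  move: l; apply: additive_eq => [a b|a b|s k].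
  - by rewrite sDw phiDl.
  - by rewrite sDv phiDr.
  - rewrite KE_scaleE coinv_deltaE !phiE tensK reg_tens_bimul.
    rewrite idem_unitsZ idem_units_act -tensKl.
    by rewrite reg_pzinE.
- by elim/ccls_ind: v => x; rewrite coinv_pzinE !phiE tensK.
- by exists F => w x; rewrite FE.
Qed.

Definition forward :
    {linear tensor (KE K S) (coinv M) -> tensor (reg_rmod Lam) M} :=
  sval (cid forward_exists).
Lemma forwardE w x :
  forward (tens w (ccls x)) = tens (idem_units w : reg_rmod Lam) x.
Proof. exact: svalP (cid forward_exists) w x. Qed.

(** Balancedness over a (x) b asks that [b r a x] and [r a x b] agree after tensoring with 1 on the
    left, which is [tens_trace] for b and r a x. *)
Lemma backward_exists :
  exists G : {linear tensor (reg_rmod Lam) M -> tensor (KE K S) (coinv M)},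
  forall (r : Lam) x, G (tens (r : reg_rmod Lam) x) = tens (kd (idem1 S))
    (ccls (bimul r x 1)).
Proof.
apply: (tensor_univ (phi := fun (r : reg_rmod Lam) x =>
  tens (kd (idem1 S)) (ccls (bimul (r : Lam) x 1)) : tensor (KE K S)
    (coinv M))).
- move=> r r' x; apply: etrans (tensDr _ _ _); congr (tens _ _).
  by apply: etrans (cclsD _ _); congr ccls; exact: bimulDl.
- move=> r x x'; apply: etrans (tensDr _ _ _); congr (tens _ _).
  by apply: etrans (cclsD _ _); congr ccls; exact: bimulD.
- move=> c r x.
  have aD (r1 r2 : Lam) : tens (kd (idem1 S)) (ccls (bimul (r1 + r2) x 1)) =
      tens (kd (idem1 S)) (ccls (bimul r1 x 1)) +
      tens (kd (idem1 S)) (ccls (bimul r2 x 1)) :> tensor (KE K S) (coinv M).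
    apply: etrans (tensDr _ _ _); congr (tens _ _).
    by apply: etrans (cclsD _ _); congr ccls; exact: bimulDl.
  have bD (x1 x2 : M) : tens (kd (idem1 S)) (ccls (bimul (r : Lam) (x1 + x2) 1))
    =
      tens (kd (idem1 S)) (ccls (bimul (r : Lam) x1 1)) +
      tens (kd (idem1 S)) (ccls (bimul (r : Lam) x2 1)) :> tensor (KE K S)
        (coinv M).
    apply: etrans (tensDr _ _ _); congr (tens _ _).
    by apply: etrans (cclsD _ _); congr ccls; exact: bimulD.
  move: c; apply: env_ext => [c c'|c c'|a b].
  - by apply: etrans (aD _ _); congr (tens _ (ccls (bimul _ x 1)));
      exact: (@scalerDl (env Lam)^c (reg_rmod Lam) r c c').
  - by apply: etrans (bD _ _); congr (tens _ (ccls (bimul _ _ 1)));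
      exact: (@scalerDl (env Lam) M x c c').
  - rewrite reg_rmodE -[env_tens a b *: x]/(bimul a x b) bimulM mulr1.
    have -> : bimul (b * (r : Lam) * a) x 1 =
      bimul b (bimul ((r : Lam) * a) x 1) 1.
      by rewrite bimulM mulr1 mulrA.
    by rewrite tens_trace bimulM mul1r mul1r.
- move=> k r x; apply: etrans _ (tensK _ _ _); apply: (congr1 (tens _)).
  apply: etrans _ (esym (coinv_pzinE _ _)); apply: (congr1 (@ccls K S A th M)).
  exact: bimulKm.
Qed.

Lemma forward_surj u : exists v, forward v = u.
Proof.
have [G GE] := backward_exists; exists (G u).
elim/tensor_ind: u => [|u v eu ev|r x]; first by rewrite !linear0.
  by rewrite !linearD; exact: congr2 eu ev.
rewrite GE forwardE reg_tens_bimul idem_units_delta rmorph1 !mul1r.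
by rewrite unit_cls1 mul1r.
Qed.

Lemma forward_inj u : forward u = 0 -> u = 0.
Proof.
have [G GE] := backward_exists => u0.
suff <- : G (forward u) = u by rewrite u0 linear0.
elim/tensor_ind: u {u0} => [|u v eu ev|w v]; first by rewrite !linear0.
  by rewrite !linearD; exact: congr2 eu ev.
elim/ccls_ind: v => x; rewrite forwardE GE.
elim/fs_ind: w => [|w w' e e'|e k].
- rewrite tens0l; apply: etrans (tens0r _ _); congr (tens _ _).
  apply: etrans (ccls0 M); congr ccls; apply: etrans (bimul0l x 1).
  by apply: (congr1 (fun r => bimul r x 1)); exact: (additive0 idem_unitsD).
- apply: etrans (esym (tensDl _ _ _)); apply: etrans (congr2 +%R e e').
  apply: etrans (tensDr _ _ _); congr (tens _ _).
  apply: etrans (cclsD _ _); congr ccls; apply: etrans (bimulDl _ _ _ _).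
  by apply: (congr1 (fun r => bimul r x 1)); exact: idem_unitsD.
- rewrite idem_units_delta bimulKl -coinv_pzinE tensK.
  have -> : (delta e (k : K^o) : KE K S) = (pzin k : KS^c) *: kd e.
    rewrite KE_scaleE KE_act_delta -deltaZ; congr delta.
      by apply: val_inj; rewrite /= sinv1 mul1g mulg1.
    exact: esym (mulr1 k).
  by rewrite tensKl -tens_idem.
Qed.
End Forward.

Lemma forward_natural (M M' : lmodType (env Lam)) (f : {linear M -> M'}) z :
  forward M' (rmap _ (coinv_map f) z) = rmap _ f (forward M z).
Proof.
elim/tensor_ind: z => [|z z' e e'|w v]; first by rewrite !linear0.
  by rewrite !linearD; exact: congr2 e e'.
by elim/ccls_ind: v => x; rewrite forwardE !rmapE coinv_mapE forwardE.
Qed.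
End Coinvariants.

(** * Separable coefficients *)

Section Separable.
Variables (K : fieldType) (S : inverseMonoidType) (A : pzAlgType K).
Variable th : unital_action S A.
Local Notation Lam := (crossed th).
Local Notation i := (incl th).

Lemma incl_pzinM k a : i (pzin k * a) = pzin k * i a.
Proof. by rewrite inclM. Qed.

Section Action.
Variable M : lmodType (env Lam).

(** M is regarded as a right A^e-module by x . (a (x) b) = b x a. On this side an element e with (a
    (x) 1) e = (1 (x) a) e acts with the same value on x a and a x. *)
Lemma right_env_exists (x : M) : exists F : {linear restr (env A)^o -> restr M},
  forall a b, F (env_tens a b) = bimul (i b) x (i a).
Proof.
apply: (env_univ (phi := fun a b => bimul (i b) x (i a) : restr M))
  => [a a' b|a b b'|k a b|k a b].
- by rewrite inclD; exact: bimulDr.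
- by rewrite inclD; exact: bimulDl.
- by rewrite incl_pzinM; exact: bimulKr.
- by rewrite incl_pzinM; exact: bimulKl.
Qed.

Definition right_env (c : env A) (x : M) : M := sval (cid (right_env_exists x))
    c.
Lemma right_envE a b x : right_env (env_tens a b) x = bimul (i b) x (i a).
Proof. exact: svalP (cid (right_env_exists x)) a b. Qed.
Lemma right_envD c c' x : right_env (c + c') x = right_env c x + right_env c' x.
Proof. exact: (linearD (sval (cid (right_env_exists x)))). Qed.

Lemma right_env_linear c : linear (right_env c : restr M -> restr M).
Proof.
move=> k x y.
have rD (v v' : restr M) : k *: (v + v') = k *: v + k *: v' by exact: scalerDr.
move: c; apply: env_ext => [c c'|c c'|a b]; first exact: right_envD.
  rewrite !right_envD; apply: etrans (congr2 +%R (rD _ _) erefl) _;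
    exact: addrACA.
rewrite !right_envE; exact: bimul_linear.
Qed.

Lemma right_env_mull a c x : right_env (env_tens a 1 * c) x =
    right_env c (bimul 1 x (i a)).
Proof.
move: c; apply: env_ext => [c c'|c c'|d b]; first by rewrite mulrDr right_envD.
  exact: right_envD.
by rewrite env_tensM mulr1 !right_envE bimulM inclM mulr1.
Qed.

Lemma right_env_mulr a c x : right_env (env_tens 1 a * c) x =
    right_env c (bimul (i a) x 1).
Proof.
move: c; apply: env_ext => [c c'|c c'|d b]; first by rewrite mulrDr right_envD.
  exact: right_envD.
by rewrite env_tensM mul1r !right_envE bimulM inclM mul1r.
Qed.

(** Modulo [A, M] the left factor of b x a moves to the right, leaving x a b, and a b is a (x) b
    applied to 1. *)
Lemma ccls_right_env c x :
  ccls (right_env c x) = ccls (bimul 1 x (i (c *: (1 : reg_lmod A)))).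
Proof.
move: c; apply: env_ext => [c c'|c c'|a b].
- by rewrite right_envD cclsD.
- have mD := @scalerDl _ (reg_lmod A) 1 c c'.
  apply: etrans (congr1 (fun r => ccls (bimul 1 x (i r))) mD) _.
  by apply: etrans _ (cclsD _ _); congr ccls; rewrite -bimulDr -inclD.
- rewrite right_envE reg_lmodE mulr1.
  have -> : bimul (i b) x (i a) = bimul (i b) (bimul 1 x (i a)) 1.
    by rewrite bimulM !mulr1.
  by rewrite ccls_comm bimulM mul1r inclM.
Qed.
End Action.

Lemma right_env_map (M M' : lmodType (env Lam)) (f : {linear M -> M'}) c x :
  f (right_env c x) = right_env c (f x).
Proof.
move: c; apply: env_ext => [c c'|c c'|a b].
- by rewrite right_envD linearD.
- exact: right_envD.
- by rewrite !right_envE bimul_map.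
Qed.

(** Projectivity gives an A^e-linear section h of the map A^e -> A, c -> c . 1, and e is h(1); both
    sides of the first equation are h(a). *)
Lemma separability_idempotent : separable A -> exists e : env A,
  (forall a, env_tens a 1 * e = env_tens 1 a * e) /\ e *: (1 : reg_lmod A) = 1.
Proof.
move=> sepA.
have gL : linear (fun c : (env A)^o => c *: (1 : reg_lmod A)).
  by move=> k c d; rewrite scalerDl scalerA.
have [|h hE] := sepA _ _ (linmap gL) idfun.
  move=> y; exists (env_tens (y : A) 1); rewrite linmapE reg_lmodE.
  by rewrite !mulr1.
exists (h (1 : A)); split=> [a|]; last exact: hE.
have hZ c (y : reg_lmod A) : h (c *: y) = c * (h y : env A)
  by exact: linearZ_LR.
by rewrite -!hZ !reg_lmodE !mulr1 mul1r.
Qed.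

(* The separability idempotent acts on a bimodule as a natural operator p that
   kills [A, M] and is congruent to the identity modulo [A, M]. *)
Lemma coinv_exact (M1 M2 M3 : lmodType (env Lam)) (f : {linear M1 -> M2})
    (g : {linear M2 -> M3}) : separable A ->
  (forall y, g y = 0 -> exists x, y = f x) ->
  forall v, coinv_map g v = 0 -> exists w, v = coinv_map f w.
Proof.
move=> /separability_idempotent[e [eC e1]] ex; elim/ccls_ind => y.
have rc a (x : M3) : right_env e (bimul (i a) x 1) =
  right_env e (bimul 1 x (i a)).
  apply: etrans (esym (right_env_mulr a e x)) (etrans _ (right_env_mull a e x)).
  by rewrite eC.
have [|p pE] := @ccls_univ K S A th M3 _
  (linmap (right_env_linear (M := M3) e)).
  exact: rc.
rewrite coinv_mapE => gy.
(* The class of g y vanishes, so e kills g y, and y . e lies in the kernel of g. Its preimage under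
   f represents the class of y because y . e and y are congruent modulo [A, M2]. *)
have [x xE] : exists x, right_env e y = f x.
  apply: ex; rewrite right_env_map.
  apply: etrans (esym (pE (g y))) _; rewrite gy; exact: (linear0 p).
exists (ccls x); rewrite coinv_mapE -xE ccls_right_env e1 incl1.
by rewrite bimul1.
Qed.

Lemma coinv_surj (M M' : lmodType (env Lam)) (f : {linear M -> M'}) :
  (forall y, exists x, f x = y) -> forall v, exists w, coinv_map f w = v.
Proof.
move=> fs; elim/ccls_ind => y; have [x <-] := fs y.
by exists (ccls x); rewrite coinv_mapE.
Qed.
End Separable.

(** * Coinvariants of free bimodules *)

Section CoinvFree.
Variables (K : fieldType) (S : inverseMonoidType) (A : pzAlgType K).
Variables (th : unital_action S A) (T : choiceType).
Local Notation Lam := (crossed th).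
Local Notation u := (unit_cls th).
Local Notation i := (incl th).
Local Notation KS := (mon_alg K S).
Local Notation E := (idempotents S).
Let P : lmodType (env Lam) := fs T (env Lam)^o.
Let N : lmodType K := fs T (restr Lam^o).
Let W : lmodType KS := translation S N.
Implicit Types (s : S) (t : T) (e : E) (x : Lam).

Definition lmulN (s : S) : N -> N :=
    fsum (fun t (x : Lam) => delta t (u s * x)).
Lemma lmulND s n n' : lmulN s (n + n') = lmulN s n + lmulN s n'.
Proof. by apply: fsumD => t x y; rewrite mulrDr; exact: deltaD. Qed.
Lemma lmulN_delta s t (x : Lam) : lmulN s (delta t x) = delta t (u s * x).
Proof. by apply: fsum_delta => r y z; rewrite mulrDr; exact: deltaD. Qed.
Lemma lmulN_linear s : linear (lmulN s).
Proof.
apply: fsum_linear => t k x y; rewrite -deltaZ -deltaD; congr delta.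
rewrite -[k *: (x : restr Lam^o) + y]/(pzin k * (x : Lam) + y).
by rewrite mulrDr mulrA -pzinC -mulrA.
Qed.
Lemma lmulN_M s r n : lmulN (s * r)%g n = lmulN s (lmulN r n).
Proof.
move: n; apply: additive_eq => [x y|x y|t x]; first exact: lmulND.
  by rewrite !lmulND.
by rewrite !lmulN_delta mulrA unit_clsM.
Qed.

(* s (x) n |-> s e (x) n - s (x) e n; the images of these operators are the
   relations that make KS (x)_K N into KS (x)_KE(S) N. *)
Definition rel_op (e : E) : fs S N -> fs S N :=
  fsum (fun s n => delta (s * val e)%g n - delta s (lmulN (val e) n)).

Let rel_op_aux e s : linear (fun n : N =>
  delta (s * val e)%g n - delta s (lmulN (val e) n) : fs S N).
Proof.
apply: (@linear_sub K N (fs S N)) => k n n'.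
  by rewrite deltaD deltaZ.
by rewrite (lmulN_linear (val e)) deltaD deltaZ.
Qed.
Lemma rel_op_linear e : linear (rel_op e).
Proof. exact: fsum_linear (rel_op_aux e). Qed.
Lemma rel_opD e w w' : rel_op e (w + w') = rel_op e w + rel_op e w'.
Proof. exact: (linearD (linmap (rel_op_linear e))). Qed.
Lemma rel_opB e w w' : rel_op e (w - w') = rel_op e w - rel_op e w'.
Proof. exact: (linearB (linmap (rel_op_linear e))). Qed.
Lemma rel_op_delta e s n :
  rel_op e (delta s n) = delta (s * val e)%g n - delta s (lmulN (val e) n).
Proof.
by apply: fsum_delta => r m m'; have := rel_op_aux e r 1 m m'; rewrite !scale1r.
Qed.

Lemma rel_opC e f w : rel_op e (rel_op f w) = rel_op f (rel_op e w).
Proof.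
move: w; apply: additive_eq => [w w'|w w'|s n]; first by rewrite !rel_opD.
  by rewrite !rel_opD.
rewrite !rel_op_delta !rel_opB !rel_op_delta -!lmulN_M -!mulgA.
by rewrite (idem_comm (idem_val e) (idem_val f)); exact: subr_subACA.
Qed.

Lemma rel_op3 e w : rel_op e (rel_op e (rel_op e w)) = rel_op e w.
Proof.
move: w; apply: additive_eq => [w w'|w w'|s n]; first by rewrite !rel_opD.
  by rewrite !rel_opD.
have idN : lmulN (val e) (lmulN (val e) n) = lmulN (val e) n.
  by rewrite -lmulN_M idem_val.
have idS : (s * val e * val e = s * val e)%g by rewrite -mulgA idem_val.
have Da := rel_op_delta e (s * val e)%g n; rewrite idS in Da.
have Db := rel_op_delta e s (lmulN (val e) n); rewrite idN in Db.
have Dc := rel_op_delta e (s * val e)%g (lmulN (val e) n);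
  rewrite idS idN subrr in Dc.
rewrite (rel_op_delta e s n).
exact: (additive_cube (rel_opB e) Da Db Dc).
Qed.

Lemma rel_op_equivariant e s w : rel_op e (@translate K S N s w) =
    @translate K S N s (rel_op e w).
Proof.
have tB (w1 w2 : fs S N) : @translate K S N s (w1 - w2) =
    @translate K S N s w1 - @translate K S N s w2.
  exact: (additiveB (@translateD K S N s)).
move: w; apply: additive_eq => [w w'|w w'|r n].
- by rewrite translateD rel_opD.
- by rewrite rel_opD translateD.
- by rewrite translate_delta !rel_op_delta tB !translate_delta mulgA.
Qed.

Definition rel_map (e : E) : {linear W -> W} :=
  linmap (@equivariant_linear _ _ _ _ (translation_rep S N)
    (translation_rep S N)
    (linmap (rel_op_linear e)) (rel_op_equivariant e)).

(** Second factor 1 is enough: modulo [A, P], the action of S produces all the others, see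
    [cover_surj]. *)
Definition embN : N -> P :=
    fsum (fun t (x : Lam) => delta t (env_tens x 1 : (env Lam)^o)).
Lemma embND n n' : embN (n + n') = embN n + embN n'.
Proof. by apply: fsumD => t x y; rewrite env_tensDl; exact: deltaD. Qed.
Lemma embN_delta t (x : Lam) : embN (delta t x) =
    delta t (env_tens x 1 : (env Lam)^o).
Proof. by apply: fsum_delta => r y z; rewrite env_tensDl; exact: deltaD. Qed.
Lemma embNZ k n : embN (k *: n) = (pzin k : env Lam) *: embN n.
Proof.
move: n; apply: additive_eq => [n n'|n n'|t x].
- by rewrite scalerDr embND.
- by rewrite embND scalerDr.
- apply: etrans (congr1 embN (esym (deltaZ t k (x : restr Lam^o)))) _.
  apply: etrans (embN_delta t (pzin k * (x : Lam))) _.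
  apply: etrans _ (congr1 (fun p : P => (pzin k : env Lam) *: p)
    (esym (embN_delta t x))).
  apply: etrans (congr1 (delta t) (env_tensKl k x 1)) _.
  exact: (deltaZ t (pzin k : env Lam) (env_tens x 1 : (env Lam)^o)).
Qed.

Lemma bimul_free a b t (c : env Lam) :
  bimul a (delta t (c : (env Lam)^o) : P) b =
    delta t (env_tens a b * c : (env Lam)^o).
Proof. exact: esym (deltaZ _ _ _). Qed.

Lemma ccls_free_comm t a (x y : Lam) :
  ccls (delta t (env_tens (i a * x) y : (env Lam)^o) : P) =
  ccls (delta t (env_tens x (y * i a) : (env Lam)^o) : P).
Proof.
have eL := bimul_free (i a) 1 t (env_tens x y); rewrite env_tensM mulr1 in eL.
have eR := bimul_free 1 (i a) t (env_tens x y); rewrite env_tensM mul1r in eR.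
exact: etrans (congr1 (@ccls K S A th P) (esym eL))
  (etrans (ccls_comm a _) (congr1 (@ccls K S A th P) eR)).
Qed.

Definition cover : W -> coinv P :=
  fsum (fun s n => (delta s 1 : KS) *: ccls (embN n)).

Let coverD_aux s n n' : (delta s 1 : KS) *: ccls (embN (n + n')) =
  (delta s 1 : KS) *: ccls (embN n) + (delta s 1 : KS) *: ccls (embN n').
Proof.
rewrite embND; apply: etrans (congr1 _ (cclsD _ _)) _; exact: scalerDr.
Qed.
Lemma coverD w w' : cover (w + w') = cover w + cover w'.
Proof. exact: fsumD coverD_aux _ _. Qed.
Lemma cover_delta s n : cover (delta s n) = (delta s 1 : KS) *: ccls (embN n).
Proof. exact: fsum_delta coverD_aux _ _. Qed.

Lemma cover_linear : linear cover.
Proof.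
apply: linear_from_additive => [w w'|l w]; first exact: coverD.
have sD (V : lmodType KS) (v : V) (a b : KS) : (a + b) *: v = a *: v + b *: v.
  exact: scalerDl.
move: l; apply: additive_eq => [a b|a b|s k]; first by rewrite sD coverD.
  exact: sD.
move: w; apply: additive_eq => [w w'|w w'|r n];
  first by rewrite scalerDr coverD.
  by rewrite coverD scalerDr.
rewrite (lrep_deltaE (translation_rep S N)) /= translate_delta -deltaZ
  !cover_delta.
rewrite embNZ -coinv_pzinE !scalerA.
exact: (congr1 (fun c : KS => c *: ccls (embN n)) (mon_delta_pzin s r k)).
Qed.

Lemma cover_rel_op e (w : W) : cover (rel_op e w) = 0.
Proof.
have coverB := additiveB coverD.
move: w; apply: additive_eq => [w w'|w w'|s n].
- by rewrite rel_opD; exact: coverD.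
- by rewrite addr0.
rewrite rel_op_delta; apply: etrans (coverB _ _) _; rewrite !cover_delta.
apply/eqP; rewrite subr_eq0; apply/eqP.
have -> : (delta (s * val e)%g 1 : KS) = (delta s 1 : KS) *
  (delta (val e) 1 : KS).
  by apply: etrans _ (esym (mon_delta _ _ _ _)); rewrite mulr1.
rewrite -scalerA; congr (_ *: _).
move: n; apply: additive_eq => [n n'|n n'|t x].
- by rewrite embND cclsD scalerDr.
- by rewrite lmulND embND; exact: cclsD.
- by rewrite coinv_idemE lmulN_delta !embN_delta bimul_free env_tensM mulr1.
Qed.

Lemma cover_surj v : exists w, cover w = v.
Proof.
elim/ccls_ind: v => p.
elim/fs_ind: p => [|p p' [w e] [w' e']|t c].
- by exists 0; rewrite ccls0; exact: additive0 coverD.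
- by exists (w + w'); rewrite coverD e e' cclsD.
elim/env_ind: c => [|c c' [w e] [w' e']|x y].
- by exists 0; rewrite delta0 ccls0; exact: additive0 coverD.
- by exists (w + w'); rewrite coverD e e' deltaD cclsD.
elim/crossed_ind: y => [|y y' [w e] [w' e']|a s].
- exists 0; apply: etrans (additive0 coverD) _; rewrite -(ccls0 P); congr ccls.
  rewrite -(delta0 _ t); congr delta; apply: esym.
  by apply: (additive0 (f := env_tens x)) => y y'; exact: env_tensDr.
- by exists (w + w'); rewrite coverD e e' env_tensDr deltaD cclsD.
(* The choice of b gives a d_s = d_s b. Then r . [d_s b x (x) 1] = [1_r b x (x) d_s], and 1_r and b
   cross to the right end of the second factor, where d_s 1_r = d_s, giving [x (x) d_s b] =
   [x (x) a d_s]. *)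
set r := sinv s; have rs : sinv r = s := sinvK s.
set b := beta th r a; set y := u s * (i b * x).
exists (delta r (delta t y)); rewrite cover_delta embN_delta coinv_act1E rs.
rewrite bimul_free env_tensM mul1r.
have -> : u r * y = i (ua_one th r) * (i b * x)
  by rewrite /y mulrA -rs unit_sVs.
apply: etrans (ccls_free_comm t _ _ _) _.
have -> : u s * i (ua_one th r) = u s.
  by rewrite -unit_sVs rs !unit_clsM mulgA mulVs.
apply: etrans (ccls_free_comm t _ _ _) _.
by have := incl_unit th r a; rewrite rs => ->.
Qed.
End CoinvFree.

(* The map constructed here sends the class of x (x) a d_s at t to
   pt s^-1 t (a d_s x). *)
Section CoinvFreeUniversal.
Variables (K : fieldType) (S : inverseMonoidType) (A : pzAlgType K).
Variables (th : unital_action S A) (T : choiceType).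
Local Notation Lam := (crossed th).
Local Notation u := (unit_cls th).
Local Notation i := (incl th).
Local Notation KS := (mon_alg K S).
Let P : lmodType (env Lam) := fs T (env Lam)^o.
Implicit Types (s : S) (t : T) (x y : Lam).

Variables (Z : lmodType K) (pt : S -> T -> Lam -> Z).
Hypothesis ptD : forall s t x y, pt s t (x + y) = pt s t x + pt s t y.
Hypothesis ptZ : forall s t k x, pt s t (pzin k * x) = k *: pt s t x.
Hypothesis pt_idem : forall (e : idempotents S) s t x,
  pt (s * val e)%g t x = pt s t (u (val e) * x).

Let fiber_exists t x : exists F : Lam -> Z,
    (forall y y', F (y + y') = F y + F y') /\
  forall s a, F (i a * u s) = pt (sinv s) t (i a * u s * x).
Proof.
pose phi s a := pt (sinv s) t (i a * u s * x).
have [||F FD FE] := @crossed_univ K S A th Z phi.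
- by move=> s a b; rewrite /phi inclD !mulrDl ptD.
- move=> f s a ff fa; have fE : idem f by apply/eqP.
  have one_f : ua_one th f * a = a.
    by rewrite -fa oneM (beta_idemE th _ ff) !mulrA ua_one_idem.
  (* (f s)^-1 = s^-1 f, so [pt_idem] turns the extra f into the factor d_f = 1_f, which a
     absorbs. *)
  rewrite /phi sinvM (sinv_idem ff) -unit_clsM (unit_idem th ff)
    (mulrA (i a)) -inclM.
  rewrite -ua_one_central one_f (pt_idem (exist (fun e => idem e) f fE)) /=.
  by rewrite (unit_idem th ff) !mulrA -inclM one_f.
exists F; split=> // s a; rewrite FE /phi.
have -> : i (ua_one th s * a) * u s = i a * u s.
  by rewrite ua_one_central inclM -mulrA incl_one_unit.
by [].
Qed.

Let fib t x : Lam -> Z := sval (cid (fiber_exists t x)).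
Let fibD t x y y' : fib t x (y + y') = fib t x y + fib t x y'.
Proof. exact: (svalP (cid (fiber_exists t x))).1. Qed.
Let fibE t x s a : fib t x (i a * u s) = pt (sinv s) t (i a * u s * x).
Proof. exact: (svalP (cid (fiber_exists t x))).2. Qed.

Let row_exists t : exists F : {linear restr (env Lam)^o -> Z},
  forall x y, F (env_tens x y) = fib t x y.
Proof.
apply: env_univ => [x x'|x y y'|k x|k x]; last 1 first.
- apply: crossed_ext => [y y'|y y'|a s].
  + by rewrite mulrDr fibD.
  + by rewrite fibD scalerDr.
  + by rewrite mulrA -incl_pzinM !fibE incl_pzinM -ptZ !mulrA.
- apply: crossed_ext => [y y'|y y'|a s].
  + by rewrite fibD.
  + by rewrite !fibD addrACA.
  + by rewrite !fibE mulrDr ptD.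
- exact: fibD.
- apply: crossed_ext => [y y'|y y'|a s].
  + by rewrite fibD.
  + by rewrite fibD scalerDr.
  + by rewrite !fibE mulrA -pzinC -ptZ !mulrA.
Qed.

Let row t : {linear restr (env Lam)^o -> Z} := sval (cid (row_exists t)).
Let rowE t x y : row t (env_tens x y) = fib t x y.
Proof. exact: svalP (cid (row_exists t)) x y. Qed.

Lemma coinv_free_univ : exists g : {linear quo (@comm_gen K S A th P) -> Z},
  forall s t x, g ((delta s 1 : KS) *: ccls
    (delta t (env_tens x 1 : (env Lam)^o) : P)) = pt s t x.
Proof.
clearbody row; clearbody fib.
pose f : P -> Z := fsum (fun t (c : env Lam) => row t c).
have rowD t (c d : env Lam) : row t (c + d) = row t c + row t d.
  exact: (linearD (row t)).
have fD p q : f (p + q) = f p + f q by exact: fsumD rowD p q.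
have fE t (c : env Lam) : f (delta t (c : (env Lam)^o)) = row t c
  by exact: fsum_delta rowD t c.
clearbody f.
have fL : linear (f : restr P -> Z).
  apply: linear_from_additive => [p q|k]; first exact: fD.
  have restrD (p q : restr P) : k *: (p + q) = k *: p + k *: q
    by exact: scalerDr.
  apply: additive_eq => [p q|p q|t c].
  - by apply: etrans (congr1 f (restrD p q)) _; exact: fD.
  - by rewrite fD scalerDr.
  - apply: etrans (congr1 f (esym
      (deltaZ t (pzin k : env Lam) (c : (env Lam)^o)))) _.
    apply: etrans (fE t (pzin k * c)) _.
    apply: etrans _ (congr1 (fun z => k *: z) (esym (fE t c))).
    exact: (linearZ_LR (row t) k (c : restr (env Lam)^o)).
(* The value at x (x) y depends on x only through the product y x. Both a x (x) y and x (x) y a give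
   y a x, and d_s a = beta_s(a) d_s leaves the index s unchanged. *)
have fC a (p : P) : f (bimul (i a) p 1) = f (bimul 1 p (i a)).
  move: p; apply: additive_eq => [p q|p q|t c].
  - by rewrite bimulD fD.
  - by rewrite bimulD fD.
  have fb x y : f (bimul x (delta t (c : (env Lam)^o) : P) y) =
    row t (env_tens x y * c).
    exact: etrans (congr1 f (bimul_free x y t c)) (fE t _).
  apply: etrans (fb _ _) (etrans _ (esym (fb _ _))).
  move: c {fb}; apply: env_ext => [c d|c d|x y].
  - by rewrite mulrDr rowD.
  - by rewrite mulrDr rowD.
  have rM a1 b1 : row t (env_tens a1 b1 * env_tens x y) = fib t (a1 * x)
    (y * b1).
    exact: etrans (congr1 (row t) (env_tensM _ _ _ _)) (rowE _ _ _).
  apply: etrans (rM _ _) (etrans _ (esym (rM _ _))); rewrite mulr1 mul1r {rM}.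
  move: y; apply: crossed_ext => [y y'|y y'|b s]; first exact: fibD.
    by rewrite mulrDl fibD.
  have e : i b * u s * i a = i (b * beta th s a) * u s.
    by rewrite -mulrA unit_incl mulrA inclM.
  by rewrite e !fibE -e !mulrA.
have [g gE] := ccls_univ (f := linmap fL) fC.
exists g => s t x; rewrite coinv_act1E.
have -> : bimul (u s) (delta t (env_tens x 1 : (env Lam)^o) : P) (u (sinv s)) =
    delta t (env_tens (u s * x) (i 1 * u (sinv s)) : (env Lam)^o).
  by rewrite bimul_free env_tensM incl1.
(* This evaluates to [pt] at s and d_(s^-1) d_s x; [pt_idem] returns the idempotent s^-1 s to the
   index, where s s^-1 s = s. *)
rewrite gE linmapE fE rowE fibE sinvK incl1 mul1r mulrA unit_clsM.
have ss : idem (sinv s * s)%g by apply/eqP; exact: idem_Vss.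
by rewrite -(pt_idem (exist (fun e => idem e) _ ss)) /= mulgA mulVs.
Qed.
End CoinvFreeUniversal.

(** * Flatness of the coinvariants of free bimodules *)

Section CoinvFreeFlat.
Variables (K : fieldType) (S : inverseMonoidType) (A : pzAlgType K).
Variables (th : unital_action S A) (T : choiceType).
Local Notation Lam := (crossed th).
Local Notation u := (unit_cls th).
Local Notation KS := (mon_alg K S).
Local Notation E := (idempotents S).
Let P : lmodType (env Lam) := fs T (env Lam)^o.
Let N : lmodType K := fs T (restr Lam^o).
Let W : lmodType KS := translation S N.

(** The universal property of [coinv P] supplies a map g back to W modulo the images of the
    operators [rel_op], and g after [cover] is the quotient map; hence whatever [cover] kills is a
    relation. *)
Lemma cover_ker (w : W) : cover (th := th) w = 0 ->
  w \in span (fun z : W => exists e y, z = rel_map th T e y).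
Proof.
pose rel (w : fs S N) : Prop := exists e v, w = rel_op e v.
pose cl := qcls rel.
have clD w1 w2 : cl (w1 + w2) = cl w1 + cl w2 by exact: qclsD.
have clZ k w1 : cl (k *: w1) = k *: cl w1 by exact: qclsZ.
have cl0 w1 : cl w1 = 0 -> w1 \in span rel.
  by rewrite -[X in _ = X -> _](linear0 (qcls rel)) => /qclsE; rewrite subr0.
have cl_rel (e : E) s (n : N) : cl (delta (s * val e)%g n) =
  cl (delta s (lmulN (val e) n)).
  by apply/qclsE; apply: mem_span; exists e, (delta s n); rewrite rel_op_delta.
clearbody cl.
pose pt s t (x : Lam) := cl (delta s (delta t x : N)).
have [s t x y|s t k x|e s t x|g gE] := @coinv_free_univ K S A th T (quo rel) pt.
- by rewrite /pt -clD -deltaD; congr (cl (delta s _)); exact: deltaD.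
- rewrite /pt -clZ -deltaZ; congr (cl (delta s _)).
  exact: (deltaZ t k (x : restr Lam^o)).
- by rewrite /pt cl_rel lmulN_delta.
have gcl v : g (cover v) = cl v.
  move: v; apply: additive_eq => [v w1|v w1|s n].
  - by rewrite coverD; exact: linearD.
  - exact: clD.
  move: n; apply: additive_eq => [n m|n m|t x].
  - by rewrite deltaD coverD; exact: linearD.
  - by rewrite deltaD clD.
  - by rewrite cover_delta embN_delta gE.
move=> w0; have wr : w \in span rel by apply: cl0; rewrite -gcl w0;
  exact: linear0.
(* So far w lies in the K-span of the relations; [flat_quotient] wants their KS-span, which contains
   it because K acts through KS. *)
pose G (z : fs S N) := (z : W) \in span
  (fun z : W => exists e y, z = rel_map th T e y).
apply: (@span_min K (fs S N) rel G _ _ w wr).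
  split=> [|k a b ha hb]; first exact: rpred0.
  have := rpredD (rpredZ (pzin k : KS) ha) hb.
  by rewrite (lrep_pzinE (translation_rep S N)).
by move=> _ [e [v ->]]; apply: mem_span; exists e, v.
Qed.

Lemma coinv_free_flat : flat (coinv P).
Proof.
apply: (@flat_quotient K KS (coinv P) W (linmap (@cover_linear K S A th T)) E
  (rel_map th T)).
- exact: cover_surj.
- exact: rel_opC.
- exact: rel_op3.
- exact: cover_rel_op.
- exact: cover_ker.
- exact: translation_flat.
Qed.
End CoinvFreeFlat.

(** * The flat resolution of M/[A, M] and the final comparison *)

Section CoinvResolution.
Variables (K : fieldType) (S : inverseMonoidType) (A : pzAlgType K).
Variables (th : unital_action S A) (M : lmodType (env (crossed th))).
Hypothesis sepA : separable A.

Lemma coinv_map0 (M1 M2 M3 : lmodType (env (crossed th)))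
    (f : {linear M1 -> M2})
    (g : {linear M2 -> M3}) v :
  (forall x, g (f x) = 0) -> coinv_map g (coinv_map f v) = 0.
Proof. by move=> gf; elim/ccls_ind: v => x; rewrite !coinv_mapE gf ccls0. Qed.

Definition coinv_resolution : flat_resolution (coinv M).
Proof.
apply: (@FlatResolution K _ (coinv M) (fun n => coinv (res M n))
  (fun n => coinv_map (res_d M n)) (coinv_map (@eps _ M))).
- by apply: coinv_surj => x; exists (delta x 1); exact: eps_delta.
- move=> v; split; first by apply: coinv_exact => // y /res_stepP.
  by move=> [w ->]; apply: coinv_map0 => x; apply/res_stepP; exists x.
- move=> n v; split; first by apply: coinv_exact => // y /res_exact.
  by move=> [w ->]; apply: coinv_map0 => x; apply/res_exact; exists x.
- by move=> n; exact: coinv_free_flat.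
Defined.

Lemma coinv_tor_isom n : isom (tor (KE K S) coinv_resolution n)
    (hochschild n M).
Proof.
apply: (chain_isom (F := fun n => forward (res M n))) => [m z|m z|m z].
- exact: forward_inj.
- exact: forward_surj.
- apply: etrans (forward_natural _ _) _; exact: esym (tmap_rmap _ _).
Qed.
End CoinvResolution.

Theorem corollary4p19 (K : fieldType) (S : inverseMonoidType)
    (A : pzAlgType K) (theta : unital_action S A)
    (M : lmodType (env (crossed theta))) (sepA : separable A) (n : nat) :
  exists f : {linear inv_homology n (coinv M) -> hochschild n M}, bijective f.
Proof.
apply: isom_trans (Tor_isom_tor n (KE K S) (coinv M)) _.
apply: isom_trans (tor_isom _ _ (coinv_resolution M sepA) n) _.
exact: coinv_tor_isom.
Qed.
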